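(* Let $m\ge 1$, let $C\in\mathrm{Cat}(m,n)$, and let $c$ be a removable arc of $C$ with left end $y_a$ and right end $y'_b$, where $1-n\le a,b\le m+n$. Then $$C(A)=A^{b-a}\,C'(A),\qquad\text{where } C'=C\smallsetminus c.$$ In particular, $C$ is realizable if and only if $C'$ is realizable.
   Context: Catalan states. $\mathrm{Cat}(m,n)$ is the set of Catalan states: non-crossing perfect matchings, by arcs embedded in a rectangle, of $2(m+n)$ boundary points: $x_1,\dots,x_n$ on the top side (left to right), $x'_1,\dots,x'_n$ on the bottom side (left to right), $y_1,\dots,y_m$ on the left side and $y'_1,\dots,y'_m$ on the right side (both top to bottom). Extended labels: $x_i=y_{1-i}=y'_{i-n}$ and $x'_i=y_{m+i}=y'_{m+(n-i)+1}$ for $1\le i\le n$. An arc joining two top (bottom, left, right) points is a top (bottom, left, right) return. Coefficients. The $m\times n$ lattice crossing $L(m,n)$ is the grid of $m$ horizontal lines (joining $y_j$ to $y'_j$) and $n$ vertical lines (joining $x_i$ to $x'_i$). A Kauffman state $s$ assigns a marker $\pm1$ to each of the $mn$ crossings. A marker $+1$ smooths the crossing by joining its top half-edge to its right one and its left half-edge to its bottom one; a marker $-1$ joins top to left and bottom to right. Let $|D_s|$ be the number of closed components of the resulting diagram, and $C_s\in\mathrm{Cat}(m,n)$ the Catalan state obtained by discarding them. The coefficient of $C$ (its coefficient when $L(m,n)$ is expanded in the basis $\mathrm{Cat}(m,n)$ of the relative Kauffman bracket skein module) is $$C(A)=\sum_{s:\,C_s=C}A^{\#\{+1\text{ in }s\}-\#\{-1\text{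 in }s\}}(-A^2-A^{-2})^{|D_s|}\in\mathbb{Z}[A^{\pm1}].$$ $C$ is realizable if $C=C_s$ for some $s$. Removing an arc. An arc is proper if it does not join a top point to a bottom point and is neither a left nor a right return. For a proper arc $c$ of $C\in\mathrm{Cat}(m,n)$, $m\ge1$, define $C\smallsetminus c\in\mathrm{Cat}(m-1,n)$ as follows. (i) If $c$ has no end on the bottom side: list the non-bottom points in the order $y_m,\dots,y_1,x_1,\dots,x_n,y'_1,\dots,y'_m$, delete $c$ and its two ends, and relabel the remaining $2m+n-2$ points, in this order, as $y_{m-1},\dots,y_1,x_1,\dots,x_n,y'_1,\dots,y'_{m-1}$; bottom points and all other arcs are kept. (ii) If $c$ has an end on the bottom side: $C\smallsetminus c=(C^*\smallsetminus c^* )^*$, where ${}^*$ denotes rotation by $\pi$ and $c^*$ is the image of $c$. Removable arcs. A proper arc $c$ splits the rectangle into two regions $A_1,A_2$, with $A_1$ touching the top side and $A_2$ touching the bottom side (if $c$ has no end on the bottom side, $A_2$ is the region containing the bottom side; if $c$ has an end on the bottom side, $A_1$ is the region containing the top side). The arc $c$ of $C\in\mathrm{Cat}(m,n)$, $m\ge1$, is removable if it is proper and there is an integer $0\le j_0\le m-1$ such that every other arc of $C$ with ends $y_j,y_{j+1}$ or $y'_j,y'_{j+1}$ (extended labels) lies in $A_1$ if $j\le j_0$ and in $A_2$ if $j>j_0$. Left/right ends. If $c$ has no end on the bottom, its left end is the one occurring first in the order $y_m,\dots,y_1,x_1,\dots,x_n,y'_1,\dots,y'_m$; if $c$ has no end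 on the top, its left end is the one occurring first in the order $y_1,\dots,y_m,x'_1,\dots,x'_n,y'_m,\dots,y'_1$. The left end is written in the (extended) form $y_a$ and the right end in the form $y'_b$. *)

(* Defs.v *)
From HB Require Import structures.
From mathcomp Require Import all_boot all_order all_algebra zify.

Set Implicit Arguments.
Unset Strict Implicit.
Unset Printing Implicit Defensive.

Import GRing.Theory.

(** * Boundary points *)

(* The indices of [Top], [Bot] run from left to right and those of [Lft],
   [Rgt] from top to bottom.  Ordinals start at 0: [Top i] is x_(i+1), [Bot i]
   is x'_(i+1), [Lft j] is y_(j+1) and [Rgt j] is y'_(j+1). *)
Inductive bpt (m n : nat) : Type :=
  | Top of 'I_n
  | Bot of 'I_n
  | Lft of 'I_m
  | Rgt of 'I_m.

Arguments Top {m n}.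
Arguments Bot {m n}.
Arguments Lft {m n}.
Arguments Rgt {m n}.

Definition bpt_encode m n (p : bpt m n) : ('I_n + 'I_n) + ('I_m + 'I_m) :=
  match p with
  | Top i => inl (inl i)
  | Bot i => inl (inr i)
  | Lft j => inr (inl j)
  | Rgt j => inr (inr j)
  end.

Definition bpt_decode m n (u : ('I_n + 'I_n) + ('I_m + 'I_m)) : bpt m n :=
  match u with
  | inl (inl i) => Top i
  | inl (inr i) => Bot i
  | inr (inl j) => Lft j
  | inr (inr j) => Rgt j
  end.

Lemma bpt_encodeK m n : cancel (@bpt_encode m n) (@bpt_decode m n).
Proof. by case. Qed.

HB.instance Definition _ m n :=
  Finite.copy (bpt m n) (can_type (@bpt_encodeK m n)).

Definition on_top m n (p : bpt m n) : bool := if p is Top _ then true else false.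
Definition on_bot m n (p : bpt m n) : bool := if p is Bot _ then true else false.
Definition on_left m n (p : bpt m n) : bool := if p is Lft _ then true else false.
Definition on_right m n (p : bpt m n) : bool := if p is Rgt _ then true else false.

(* Extended labels: [y_label j p] says that p = y_j, and [y'_label j p] that
   p = y'_j.  A point has at most one label of each kind; points on the right
   (left) side have no y-label (y'-label).  Indexing from 1, the labels of the top and
   bottom points are x_i = y_(1-i) = y'_(i-n) and
   x'_i = y_(m+i) = y'_(m+(n-i)+1). *)
Definition y_label m n (j : int) (p : bpt m n) : bool :=
  match p with
  | Lft i => j == (i.+1%:Z)%R
  | Top i => j == (1 - (i.+1)%:Z)%R
  | Bot i => j == (m%:Z + (i.+1)%:Z)%R
  | Rgt _ => false
  end.

Definition y'_label m n (j : int) (p : bpt m n) : bool :=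
  match p with
  | Rgt i => j == (i.+1%:Z)%R
  | Top i => j == ((i.+1)%:Z - n%:Z)%R
  | Bot i => j == (m%:Z + (n%:Z - (i.+1)%:Z) + 1)%R
  | Lft _ => false
  end.

Definition tops m n : seq (bpt m n) := [seq Top i | i <- enum 'I_n].
Definition bots m n : seq (bpt m n) := [seq Bot i | i <- enum 'I_n].
Definition lefts m n : seq (bpt m n) := [seq Lft i | i <- enum 'I_m].
Definition rights m n : seq (bpt m n) := [seq Rgt i | i <- enum 'I_m].

(* y_m, ..., y_1, x_1, ..., x_n, y'_1, ..., y'_m *)
Definition over_top m n : seq (bpt m n) :=
  rev (lefts m n) ++ tops m n ++ rights m n.

(* y_1, ..., y_m, x'_1, ..., x'_n, y'_m, ..., y'_1 *)
Definition under_bot m n : seq (bpt m n) :=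
  lefts m n ++ bots m n ++ rev (rights m n).

(* All boundary points, clockwise from the bottom left corner. *)
Definition clockwise m n : seq (bpt m n) := over_top m n ++ rev (bots m n).

Definition pos m n (p : bpt m n) : nat := index p (clockwise m n).

(** * Catalan states *)

Definition perfect_matching m n (f : {ffun bpt m n -> bpt m n}) : bool :=
  [forall p, (f (f p) == p) && (f p != p)].

Definition non_crossing m n (f : {ffun bpt m n -> bpt m n}) : bool :=
  [forall p, forall q,
     ~~ [&& pos p < pos q, pos q < pos (f p) & pos (f p) < pos (f q)]].

(* A Catalan state is given by the map sending each boundary point to the
   other end of its arc. *)
Record Cat (m n : nat) : Type := MkCat {
  mate :> {ffun bpt m n -> bpt m n};
  _ : perfect_matching mate && non_crossing mate }.

HB.instance Definition _ m n := [isSub for @mate m n].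
HB.instance Definition _ m n := [Finite of Cat m n by <:].

(* An arc is identified with the set of its two ends. *)
Definition arcs m n (C : Cat m n) : {set {set bpt m n}} :=
  [set [set p; C p] | p : bpt m n].

(** * Coefficients *)

(* [true] is the marker +1 and [false] the marker -1; the crossing (i, j) is
   the one of the (i+1)-st horizontal line from the top with the (j+1)-st
   vertical line from the left. *)
Definition kstate (m n : nat) : predArgType := {ffun 'I_m * 'I_n -> bool}.

(* The crossings cut each horizontal line into n.+1 segments (numbered from
   left to right) and each vertical line into m.+1 segments (numbered from
   top to bottom). *)
Definition segment (m n : nat) : predArgType :=
  ('I_m * 'I_n.+1 + 'I_m.+1 * 'I_n)%type.

Definition left_of m n (x : 'I_m * 'I_n) : segment m n :=
  inl (x.1, widen_ord (leqnSn n) x.2).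
Definition right_of m n (x : 'I_m * 'I_n) : segment m n :=
  inl (x.1, lift ord0 x.2).
Definition top_of m n (x : 'I_m * 'I_n) : segment m n :=
  inr (widen_ord (leqnSn m) x.1, x.2).
Definition bot_of m n (x : 'I_m * 'I_n) : segment m n :=
  inr (lift ord0 x.1, x.2).

Definition end_segment m n (p : bpt m n) : segment m n :=
  match p with
  | Top j => inr (ord0, j)
  | Bot j => inr (ord_max, j)
  | Lft i => inl (i, ord0)
  | Rgt i => inl (i, ord_max)
  end.

Definition smoothing m n (s : kstate m n) (x : 'I_m * 'I_n)
    : seq (segment m n * segment m n) :=
  if s x then [:: (top_of x, right_of x); (left_of x, bot_of x)]
  else [:: (top_of x, left_of x); (bot_of x, right_of x)].

Definition joined m n (s : kstate m n) : rel (segment m n) :=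
  fun e f => [exists x, ((e, f) \in smoothing s x) || ((f, e) \in smoothing s x)].

Lemma joined_connect_sym m n (s : kstate m n) : connect_sym (joined s).
Proof. by apply: sym_connect_sym => e f; apply: eq_existsb => x; rewrite orbC. Qed.

(* The components of D_s are the connected components of the graph [joined s]
   on the segments. *)
Definition state_arc m n (s : kstate m n) (p q : bpt m n) : bool :=
  (p != q) && connect (joined s) (end_segment p) (end_segment q).

(* C_s = C *)
Definition realizes m n (s : kstate m n) (C : Cat m n) : bool :=
  [forall p, forall q, state_arc s p q == (C p == q)].

(* |D_s|: the components that contain no boundary point. *)
Definition closed_components m n (s : kstate m n) : nat :=
  n_comp (joined s)
    [pred e | ~~ [exists p, connect (joined s) e (end_segment p)]].

(* The ring of Laurent polynomials Z[A, A^-1] is taken inside the field of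
   fractions of Z[A]. *)
Definition A : {fraction {poly int}} := tofrac 'X%R.

Definition coeff m n (C : Cat m n) : {fraction {poly int}} :=
  (\sum_(s : kstate m n | realizes s C)
     A ^ (#|[set x | s x]|%:Z - #|[set x | ~~ s x]|%:Z)
     * (- A ^+ 2 - A ^- 2) ^+ closed_components s)%R.

Definition realizable m n (C : Cat m n) : Prop := exists s, realizes s C.

(** * Proper arcs, their sides and their ends *)

Definition no_bot_end m n (c : {set bpt m n}) : bool :=
  [forall p in c, ~~ on_bot p].
Definition no_top_end m n (c : {set bpt m n}) : bool :=
  [forall p in c, ~~ on_top p].

Definition proper_arc m n (C : Cat m n) (c : {set bpt m n}) : bool :=
  [&& c \in arcs C,
      ~~ ([exists p in c, on_top p] && [exists p in c, on_bot p]),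
      ~~ [forall p in c, on_left p]
    & ~~ [forall p in c, on_right p]].

(* The points met strictly between the two ends of c along [o].  A point not
   in [o] has index [size o], hence is not among them. *)
Definition between m n (o : seq (bpt m n)) (c : {set bpt m n})
    : {set bpt m n} :=
  [set r | [exists p in c, exists q in c, index p o < index r o < index q o]].

(* The boundary points, other than the ends of c, of the regions A_1 and A_2
   cut out by a proper arc c. *)
Definition side1 m n (c : {set bpt m n}) : {set bpt m n} :=
  if no_bot_end c then between (over_top m n) c
  else ~: (c :|: between (under_bot m n) c).
Definition side2 m n (c : {set bpt m n}) : {set bpt m n} :=
  if no_bot_end c then ~: (c :|: between (over_top m n) c)
  else between (under_bot m n) c.

(* If p is not an end of c, then [[set p; C p]] is an arc of C other than c. *)
Definition removable m n (C : Cat m n) (c : {set bpt m n}) : Prop :=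
  proper_arc C c /\
  exists2 j0 : nat, j0 < m &
    forall (p : bpt m n) (j : int),
      p \notin c ->
      (y_label j p && y_label (j + 1)%R (C p))
        || (y'_label j p && y'_label (j + 1)%R (C p)) ->
      [set p; C p]
        \subset (if (j <= j0%:Z)%R then side1 c else side2 c).

(* Both clauses apply to an arc from the left side to the right side; they
   then select the same end. *)
Definition left_end m n (c : {set bpt m n}) (p : bpt m n) : bool :=
  [&& p \in c,
      no_bot_end c ==>
        [forall q in c, index p (over_top m n) <= index q (over_top m n)]
    & no_top_end c ==>
        [forall q in c, index p (under_bot m n) <= index q (under_bot m n)]].

Definition right_end m n (c : {set bpt m n}) (q : bpt m n) : bool :=
  (q \in c) && ~~ left_end c q.

(** * Removing an arc *)

Definition rotate m n (p : bpt m n) : bpt m n :=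
  match p with
  | Top i => Bot (rev_ord i)
  | Bot i => Top (rev_ord i)
  | Lft i => Rgt (rev_ord i)
  | Rgt i => Lft (rev_ord i)
  end.

Definition rotate_ffun m n (f : {ffun bpt m n -> bpt m n})
    : {ffun bpt m n -> bpt m n} :=
  [ffun p => rotate (f (rotate p))].

(* The non-bottom points that are left when c is deleted. *)
Definition kept m n (c : {set bpt m n}) : seq (bpt m n) :=
  [seq q <- over_top m n | q \notin c].

(* [new_point] relabels the points other than the ends of c and [old_point]
   undoes the relabelling.  The default values of [nth], in particular d, are
   irrelevant when c is an arc without end on the bottom side. *)
Definition old_point m n (c : {set bpt m.+1 n}) (p : bpt m n) : bpt m.+1 n :=
  match p with
  | Bot i => Bot i
  | p => nth (Lft ord0) (kept c) (index p (over_top m n))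
  end.

Definition new_point m n (c : {set bpt m.+1 n}) (d : bpt m n)
    (q : bpt m.+1 n) : bpt m n :=
  match q with
  | Bot i => Bot i
  | q => nth d (over_top m n) (index q (kept c))
  end.

(* Case of an arc c without end on the bottom side. *)
Definition remove_over_ffun m n (f : {ffun bpt m.+1 n -> bpt m.+1 n})
    (c : {set bpt m.+1 n}) : {ffun bpt m n -> bpt m n} :=
  [ffun p => new_point c p (f (old_point c p))].

Definition remove_ffun m n (f : {ffun bpt m.+1 n -> bpt m.+1 n})
    (c : {set bpt m.+1 n}) : {ffun bpt m n -> bpt m n} :=
  if no_bot_end c then remove_over_ffun f c
  else rotate_ffun (remove_over_ffun (rotate_ffun f)
                                     [set rotate p | p in c]).

(** ** C \ c is a Catalan state *)

Definition catalan m n (f : {ffun bpt m n -> bpt m n}) : bool :=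
  perfect_matching f && non_crossing f.

Lemma posE m n (p : bpt m n) :
  pos p = match p with
          | Lft j => m - j.+1
          | Top i => m + i
          | Rgt j => m + n + j
          | Bot i => m + n + m + (n - i.+1)
          end.
Proof.
have injT : injective (@Top m n) by move=> ? ? [].
have injB : injective (@Bot m n) by move=> ? ? [].
have injL : injective (@Lft m n) by move=> ? ? [].
have injR : injective (@Rgt m n) by move=> ? ? [].
have irev (T : eqType) (x : T) s : uniq s -> x \in s ->
    index x (rev s) = size s - (index x s).+1.
  elim: s => [|y s IH] //= /andP[ys us]; rewrite inE rev_cons -cats1 index_cat.
  rewrite mem_rev size_rev; case: eqVneq => [->|ne] /=.
    by rewrite (negbTE ys) eqxx; lia.
  move=> xs; have lt : index x s < size s by rewrite index_mem.
  by rewrite xs IH // eq_sym (negbTE ne) subSS.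
have memL j : Lft j \in lefts m n by rewrite map_f ?mem_enum.
have memR j : Rgt j \in rights m n by rewrite map_f ?mem_enum.
have memT j : Top j \in tops m n by rewrite map_f ?mem_enum.
have memB j : Bot j \in bots m n by rewrite map_f ?mem_enum.
have szL : size (lefts m n) = m by rewrite size_map size_enum_ord.
have szR : size (rights m n) = m by rewrite size_map size_enum_ord.
have szT : size (tops m n) = n by rewrite size_map size_enum_ord.
have szB : size (bots m n) = n by rewrite size_map size_enum_ord.
have uL : uniq (lefts m n) by rewrite map_inj_uniq ?enum_uniq.
have uB : uniq (bots m n) by rewrite map_inj_uniq ?enum_uniq.
rewrite /pos /clockwise /over_top !index_cat !mem_cat !mem_rev.
rewrite !size_cat !size_rev szL szR szT; case: p => i.
- have -> : Top i \in lefts m n = false by apply/mapP => -[].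
  by rewrite memT /= index_map // index_enum_ord.
- have -> : Bot i \in lefts m n = false by apply/mapP => -[].
  have -> : Bot i \in tops m n = false by apply/mapP => -[].
  have -> : Bot i \in rights m n = false by apply/mapP => -[].
  by rewrite /= irev // szB index_map // index_enum_ord; lia.
- by rewrite memL /= irev // szL index_map // index_enum_ord.
- have -> : Rgt i \in lefts m n = false by apply/mapP => -[].
  have -> : Rgt i \in tops m n = false by apply/mapP => -[].
  by rewrite memR /= index_map // index_enum_ord; lia.
Qed.

Lemma mem_clockwise m n (p : bpt m n) : p \in clockwise m n.
Proof.
rewrite /clockwise /over_top !mem_cat !mem_rev.
by case: p => i; rewrite map_f ?mem_enum ?orbT.
Qed.

Lemma size_over_top m n : size (over_top m n) = m + n + m.
Proof.
rewrite !size_cat size_rev /lefts /tops /rights 3!size_map !size_enum_ord.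
by rewrite addnA.
Qed.

Lemma card_bpt m n : #|{: bpt m n}| = (m + n) + (m + n).
Proof.
have dK : cancel (@bpt_decode m n) (@bpt_encode m n) by case=> -[].
rewrite (bij_eq_card (Bijective (@bpt_encodeK m n) dK)).
by rewrite !card_sum !card_ord; lia.
Qed.

Lemma size_clockwise m n : size (clockwise m n) = (m + n) + (m + n).
Proof.
by rewrite size_cat size_over_top size_rev /bots size_map size_enum_ord; lia.
Qed.

Lemma uniq_clockwise m n : uniq (clockwise m n).
Proof.
apply/card_uniqP; rewrite size_clockwise -card_bpt.
by apply: eq_card => p; rewrite mem_clockwise inE.
Qed.

Lemma pos_inj m n : injective (@pos m n).
Proof.
move=> p q; apply: (@index_inj _ p (clockwise m n)); exact: mem_clockwise.
Qed.

Lemma ltn_pos m n (p : bpt m n) : pos p < (m + n) + (m + n).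
Proof. by rewrite -size_clockwise index_mem mem_clockwise. Qed.

Lemma rotateK m n : involutive (@rotate m n).
Proof. by case=> i /=; rewrite rev_ordK. Qed.

Lemma pos_rotate m n (p : bpt m n) :
  pos (rotate p) = if pos p < m + n then pos p + (m + n) else pos p - (m + n).
Proof.
by rewrite !posE; case: p => i /=; have := ltn_ord i; case: ifP; lia.
Qed.

Lemma catalanP m n (f : {ffun bpt m n -> bpt m n}) :
  reflect [/\ involutive f, forall p, f p != p
            & forall p q, ~~ [&& pos p < pos q, pos q < pos (f p)
                                & pos (f p) < pos (f q)]]
          (catalan f).
Proof.
apply: (iffP andP) => [[/forallP H1 /forallP H2]|[H1 H2 H3]].
  split=> [p|p|p q]; first by have /andP[/eqP] := H1 p.
    by have /andP[] := H1 p.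
  by have /forallP := H2 p.
split; apply/forallP => p; first by rewrite H1 eqxx H2.
exact/forallP.
Qed.

Lemma rotate_catalan m n (f : {ffun bpt m n -> bpt m n}) :
  catalan f -> catalan (rotate_ffun f).
Proof.
case/catalanP => H1 H2 H3; apply/catalanP; split=> [p|p|p q].
- by rewrite !ffunE rotateK H1 rotateK.
- by rewrite ffunE -(inj_eq (can_inj (@rotateK m n))) rotateK.
rewrite !ffunE -[p in pos p < _]rotateK -[q in _ < pos q]rotateK
  -[q in pos q < pos (rotate (f _))]rotateK.
move: (rotate p) (rotate q) => {}p {}q; apply/negP.
have := H3 p q; have := H3 q (f p); have := H3 (f p) (f q).
have := H3 (f q) p; rewrite !H1 !pos_rotate.
have := ltn_pos p; have := ltn_pos q.
have := ltn_pos (f p); have := ltn_pos (f q).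
by repeat case: ifP; lia.
Qed.

Lemma index_filter_lt (T : eqType) (P : pred T) (s : seq T) (x y : T) :
  P x -> P y -> x \in s -> y \in s ->
  (index x (filter P s) < index y (filter P s)) = (index x s < index y s).
Proof.
move=> Px Py; have [-> _ _|xy] := eqVneq x y; first by rewrite !ltnn.
elim: s => [|z s IH] //=; rewrite !inE ![_ == z]eq_sym.
have [zx|zx] /= := eqVneq z x; first by rewrite zx Px /= eqxx (negbTE xy).
have [zy|zy] /= := eqVneq z y; first by rewrite zy Py /= eqxx eq_sym (negbTE xy).
by case: (P z) => /= xs ys; rewrite ?(negbTE zx) ?(negbTE zy) ?ltnS IH.
Qed.

Lemma remove_over_catalan m n (f : {ffun bpt m.+1 n -> bpt m.+1 n}) p0 :
  catalan f -> no_bot_end [set p0; f p0] ->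
  catalan (remove_over_ffun f [set p0; f p0]).
Proof.
case/catalanP => H1 H2 H3 /forall_inP nb; set c := [set p0; f p0] in nb *.
pose LL := [seq q <- clockwise m.+1 n | q \notin c].
have cB i : Bot i \notin c by apply/negP => /nb.
have LLE : LL = kept c ++ rev (bots m.+1 n).
  rewrite /LL filter_cat; congr (_ ++ _); apply/all_filterP/allP => q.
  by rewrite mem_rev => /mapP[i _ ->].
have uLL : uniq LL by rewrite filter_uniq ?uniq_clockwise.
have memLL q : (q \in LL) = (q \notin c).
  by rewrite mem_filter mem_clockwise andbT.
have szLL : size LL = m + n + (m + n).
  have /card_uniqP <- := uLL.
  rewrite (eq_card (B := [predC c])) => [|q]; last by rewrite memLL.
  have := cardC c; rewrite card_bpt {1}/c cards2 eq_sym H2 /= => szE.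
  by move: szE; set k := #|_|; lia.
have szk : size (kept c) = size (over_top m n).
  move: szLL; rewrite LLE size_cat size_rev /bots size_map size_enum_ord.
  by rewrite size_over_top => e; apply: (@addIn n); rewrite e; lia.
have notB k (i : 'I_n) : Bot i \in over_top k n = false.
  rewrite !mem_cat mem_rev; apply/negbTE; rewrite !negb_or.
  by apply/and3P; split; apply/mapP => -[].
have memo k (p : bpt k n) : ~~ on_bot p -> p \in over_top k n.
  rewrite !mem_cat mem_rev.
  by case: p => i //= _; rewrite map_f ?mem_enum ?orbT.
have ibot (i : 'I_n) : index (Bot i) (rev (bots m n))
                       = index (Bot i) (rev (bots m.+1 n)).
  by rewrite -!map_rev !index_map // => ? ? [].
have ipos (p : bpt m n) : ~~ on_bot p -> pos p = index p (over_top m n).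
  by move=> pb; rewrite /pos index_cat memo.
have oldE p : old_point c p = nth (Lft ord0) LL (pos p).
  have aux q : ~~ on_bot q -> nth (Lft ord0) (kept c) (index q (over_top m n))
                 = nth (Lft ord0) LL (pos q).
    by move=> qb; rewrite LLE nth_cat ipos // szk index_mem memo.
  case: p => i; rewrite /old_point ?aux //.
  rewrite /pos index_cat notB LLE nth_cat szk ltnNge leq_addr /= addKn ibot.
  by rewrite nth_index // mem_rev map_f ?mem_enum.
have ltpos (p : bpt m n) : pos p < size LL.
  have := mem_clockwise p; rewrite -index_mem => /leq_trans; apply.
  by rewrite szLL size_clockwise; lia.
have oldc p : old_point c p \notin c by rewrite -memLL oldE mem_nth.
have idx p : index (old_point c p) LL = pos p by rewrite oldE index_uniq.
have old_inj : injective (old_point c).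
  by move=> p q e; apply: pos_inj; rewrite -!idx e.
have newE p q : q \notin c -> old_point c (new_point c p q) = q.
  move=> qc; have aux : ~~ on_bot q ->
      old_point c (nth p (over_top m n) (index q (kept c))) = q.
    move=> qb; have qk : q \in kept c by rewrite mem_filter qc memo.
    have lt : index q (kept c) < size (over_top m n) by rewrite -szk index_mem.
    have -> : nth p (over_top m n) (index q (kept c))
              = nth p (clockwise m n) (index q (kept c)).
      by rewrite [RHS]nth_cat lt.
    rewrite oldE /pos index_uniq ?uniq_clockwise //; last first.
      by rewrite size_cat ltn_addr.
    by rewrite LLE nth_cat index_mem qk nth_index.
  by case: q qc aux => i // qc; apply.
have fc q : (f q \in c) = (q \in c).
  rewrite !inE (can2_eq H1 H1) orbC; congr orb.
  by rewrite (inj_eq (can_inj H1)).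
have key p : old_point c (remove_over_ffun f c p) = f (old_point c p).
  by rewrite ffunE newE // fc.
have lt_old p q : (pos (old_point c p) < pos (old_point c q)) = (pos p < pos q).
  rewrite -(idx p) -(idx q) /LL index_filter_lt ?mem_clockwise //.
apply/catalanP; split=> [p|p|p q].
- by apply: old_inj; rewrite !key H1.
- by rewrite -(inj_eq old_inj) key H2.
by rewrite -!lt_old !key H3.
Qed.

Lemma remove_catalan m n (C : Cat m.+1 n) (c : {set bpt m.+1 n}) :
  proper_arc C c -> catalan (remove_ffun C c).
Proof.
case/and4P => /imsetP[p _ ->] tb _ _; have cC : catalan C by case: C {tb}.
rewrite /remove_ffun; case: ifP => [|nb]; first exact: remove_over_catalan.
apply: rotate_catalan.
have -> : [set rotate q | q in [set p; C p]]
          = [set rotate p; rotate_ffun C (rotate p)].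
  by rewrite imsetU1 imset_set1 ffunE rotateK.
apply: remove_over_catalan; first exact: rotate_catalan.
rewrite ffunE rotateK; apply/forall_inP => q.
have ntop r : r \in [set p; C p] -> ~~ on_top r.
  move=> rc; apply: contra tb => rt; apply/andP; split.
    by apply/exists_inP; exists r.
  move/negbT: nb; rewrite negb_forall_in => /exists_inP[r' ? ?].
  by apply/exists_inP; exists r' => //; apply/negPn.
by rewrite !inE => /orP[]/eqP->; [have := ntop p | have := ntop (C p)];
  rewrite !inE eqxx ?orbT => /(_ isT); [case: (p) | case: (C p)].
Qed.

Definition remove m n (C : Cat m.+1 n) (c : {set bpt m.+1 n})
    (cP : proper_arc C c) : Cat m n :=
  MkCat (remove_catalan cP).

(* Main.v *)
(** Numbering the boundary points clockwise, stacking crossings and cups acts on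
    planar matchings through Temperley-Lieb cup-caps.  A horizontal line of the
    lattice is a chord lying over everything drawn before, so by Reidemeister II and
    III the diagram L(m + 1, n) is, for every 0 <= j <= m, obtained from L(m, n) by
    inserting a chord from y_(j + 1) to y'_(j + 1) that lies over all the strands it
    crosses.  If a state has no short arc at (k, k + 1), then moving an end of
    this chord across that place multiplies its coefficient by a power of A.
    Removability says that, for j = j0, both ends can be moved in this way to the
    ends of c; a chord drawn parallel to c then contributes only to states containing
    c, with coefficient that of the state without c.  Rotation by pi reduces the case
    of an arc with a bottom end to that of an arc without one.

    Realizable states are those with a nonzero coefficient, because no cancellation
    can kill a coefficient at A = 1.  There, a crossing becomes the three-term relation
    of the products \prod (b q - b p) over the arcs {p < q} of a matching, so a partial
    lattice is equivalent to one matching with crossings.  Resolving its crossings by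
    the same relation exhibits it as a nonnegative combination of planar matchings, and
    tracking this crossing by crossing shows that every realizable state occurs. *)

From Stdlib Require Import FunctionalExtensionality ProofIrrelevance Classical.
From HB Require Import structures.
Require Import Defs.
From mathcomp Require Import all_boot all_order all_algebra zify ring.

Set Implicit Arguments.
Unset Strict Implicit.
Unset Printing Implicit Defensive.

Import Order.TTheory GRing.Theory Num.Theory.

(** A coefficient is read off by a functional ([agree]) pulled back through the diagram, so no free
    module on matchings is needed and a diagram identity is an identity between functions. A shift
    of an end of the chord by one place is expressed by a crossing drawn last at that place; its -1
    smoothing leaves a short arc there, so for a state without one only the +1 smoothing survives,
    with factor A. The exponents of the two ends add up to b - a because the labels y decrease and
    the labels y' increase along the clockwise numbering. Removability puts the short arcs with j <=
    j0 between the ends of c and the others beyond them, so a chord started in row j0 + 1 passes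
    none of them on its way to c.

    Realizability is the harder half: at A = 1 a closed component counts -2, so the state sum has
    terms of both signs and positivity cannot be seen term by term. Uniqueness makes it visible. The
    arc products of noncrossing matchings are linearly independent, so the signed list of states and
    the sign-free list obtained by resolving crossings have the same coefficients. *)

(* A Catalan state with [M] boundary points, numbered clockwise from 0 at [y_m], is
   extended to all naturals by pairing [2i] with [2i + 1] beyond [M] (see [next]),
   so that insertions and cup-caps need no size index. *)
Record matching : Type := Matching {
  mt :> nat -> nat;
  mtK : involutive mt;
  mt_neq : forall x, mt x <> x }.

Lemma matching_eq (f g : matching) : mt f =1 mt g -> f = g.
Proof.
case: f g => [f fK fN] [g gK gN] /= e.
have E : f = g by apply: functional_extensionality.
by subst g; rewrite (proof_irrelevance _ fK gK) (proof_irrelevance _ fN gN).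
Qed.

Lemma mt_inj (f : matching) : injective f.
Proof. exact: can_inj (mtK f). Qed.

(** The cup joins [a] to [b] and the cap joins their former mates. If [a] and [b] are already mates
    nothing changes; the closed loop that splits off is accounted for by [weight_at] or by the
    counter of [proc]. *)
Definition join_fun (a b : nat) (f : nat -> nat) (x : nat) : nat :=
  if x == a then b else if x == b then a else
  if x == f a then f b else if x == f b then f a else f x.

Ltac eqcases := repeat match goal with
  | |- context [ @eq_op _ ?a ?b ] =>
     lazymatch a with context [if _ then _ else _] => fail | _ =>
     lazymatch b with context [if _ then _ else _] => fail | _ =>
     case: (@eqP _ a b) => ?; try congruence end end
  end.

Lemma join_funK (a b : nat) (f : matching) : a <> b -> involutive (join_fun a b f).
Proof.
move=> ab x; rewrite /join_fun.
have := mtK f a; have := mtK f b; have := mtK f x.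
have := @mt_neq f a; have := @mt_neq f b; have := @mt_neq f x.
move=> ? ? ? ? ? ?.
by eqcases.
Qed.

Lemma join_fun_neq (a b : nat) (f : matching) (x : nat) :
  a <> b -> join_fun a b f x <> x.
Proof.
move=> ab; rewrite /join_fun.
have := mtK f a; have := mtK f b; have := mtK f x.
have := @mt_neq f a; have := @mt_neq f b; have := @mt_neq f x.
move=> ? ? ? ? ? ?.
by eqcases.
Qed.

Definition join (a b : nat) (ab : a <> b) (f : matching) : matching :=
  Matching (join_funK f ab) (fun x => @join_fun_neq a b f x ab).

Lemma joinE a b (ab : a <> b) (f : matching) x : join ab f x = join_fun a b f x.
Proof. by []. Qed.

Lemma joinC a b (ab : a <> b) (ba : b <> a) f : join ab f = join ba f.
Proof.
apply: matching_eq => y; rewrite !joinE /join_fun.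
have := mtK f a; have := mtK f b; have := mtK f y => ? ? ?.
by eqcases.
Qed.

Lemma join_idem a b (ab : a <> b) (f : matching) : join ab (join ab f) = join ab f.
Proof.
apply: matching_eq => x /=; rewrite /join_fun.
have := mtK f a; have := mtK f b; have := mtK f x.
have := @mt_neq f a; have := @mt_neq f b; have := @mt_neq f x.
move=> ? ? ? ? ? ?.
by eqcases.
Qed.

(** The Temperley-Lieb relation e_i e_j e_i = e_i. It holds for any three distinct points, so it
    covers both neighbours of a strand and later the inversion of a cup-cap by [tjoin]. *)
Lemma join_braid a b c (ab : a <> b) (bc : b <> c) (f : matching) : a <> c ->
  join ab (join bc (join ab f)) = join ab f.
Proof.
move=> ac; apply: matching_eq => x /=; rewrite /join_fun.
have := mtK f a; have := mtK f b; have := mtK f x; have := mtK f c.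
have := @mt_neq f a; have := @mt_neq f b; have := @mt_neq f x; have := @mt_neq f c.
move=> ? ? ? ? ? ? ? ?.
by eqcases.
Qed.

Lemma join_comm a b c d (ab : a <> b) (cd : c <> d) (f : matching) : a <> c -> a <> d -> b <> c -> b <> d ->
  join ab (join cd f) = join cd (join ab f).
Proof.
move=> ac ad bc bd; apply: matching_eq => x /=; rewrite /join_fun.
have := mtK f a; have := mtK f b; have := mtK f x; have := mtK f c; have := mtK f d.
have := @mt_neq f a; have := @mt_neq f b; have := @mt_neq f x; have := @mt_neq f c; have := @mt_neq f d.
move=> ? ? ? ? ? ? ? ? ? ?.
by eqcases.
Qed.

Lemma n_neqSn k : k <> k.+1. Proof. lia. Qed.
Definition cupcap k (f : matching) : matching := join (@n_neqSn k) f.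

(** * Inserting a short arc *)

Definition up (k x : nat) := x + (k <= x).*2.
Definition down (k x : nat) := x - (k <= x).*2.

Lemma upK k : cancel (up k) (down k).
Proof. by move=> x; rewrite /up /down; lia. Qed.
Lemma downK k x : x <> k -> x <> k.+1 -> up k (down k x) = x.
Proof. by rewrite /up /down; lia. Qed.
Lemma up_neq k x : up k x <> k. Proof. by rewrite /up; lia. Qed.
Lemma up_neqS k x : up k x <> k.+1. Proof. by rewrite /up; lia. Qed.

Definition ins_fun (k : nat) (f : nat -> nat) (x : nat) : nat :=
  if x == k then k.+1 else if x == k.+1 then k else up k (f (down k x)).

Lemma ins_funK k (f : matching) : involutive (ins_fun k f).
Proof.
move=> x; rewrite /ins_fun.
have := @up_neq k (f (down k x)); have := @up_neqS k (f (down k x)).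
have := upK k (f (down k x)); have := mtK f (down k x); have := @downK k x.
have := @n_neqSn k.
move=> ? ? ? ? ? ?.
eqcases; by intuition congruence.
Qed.

Lemma ins_fun_neq k (f : matching) x : ins_fun k f x <> x.
Proof.
rewrite /ins_fun; case: eqP => [->|h1]; first lia.
case: eqP => [->|h2]; first lia.
move=> e; apply: (@mt_neq f (down k x)).
by rewrite -[LHS](upK k) e.
Qed.

Definition ins (k : nat) (f : matching) : matching :=
  Matching (ins_funK k f) (@ins_fun_neq k f).

Lemma ins_k k f : ins k f k = k.+1.
Proof. by rewrite /= /ins_fun eqxx. Qed.
Lemma ins_Sk k f : ins k f k.+1 = k.
Proof. by rewrite /= /ins_fun eqxx; case: eqP => // /esym /n_neqSn. Qed.
Lemma ins_up k f x : ins k f (up k x) = up k (f x).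
Proof.
rewrite /= /ins_fun; case: eqP => [/up_neq|] //; case: eqP => [/up_neqS|] //.
by rewrite upK.
Qed.

Lemma upP k x : [\/ x = k, x = k.+1 | exists y, x = up k y].
Proof.
case: (eqVneq x k) => [->|/eqP h]; first by constructor 1.
case: (eqVneq x k.+1) => [->|/eqP h']; first by constructor 2.
by constructor 3; exists (down k x); rewrite downK.
Qed.

Lemma up_inj k : injective (up k). Proof. exact: can_inj (upK k). Qed.

Lemma ins_ex k (f : matching) : f k = k.+1 -> exists g, f = ins k g.
Proof.
move=> fk.
have fSk : f k.+1 = k by rewrite -fk mtK.
have h1 x : f (up k x) <> k.
  by move=> e; have := mtK f (up k x); rewrite e fk => /esym /up_neqS.
have h2 x : f (up k x) <> k.+1.
  by move=> e; have := mtK f (up k x); rewrite e fSk => /esym /up_neq.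
have gK : involutive (fun x => down k (f (up k x))).
  by move=> x; rewrite downK // mtK upK.
have gN x : down k (f (up k x)) <> x.
  move=> e; apply: (@mt_neq f (up k x)).
  by rewrite -[in RHS]e downK.
exists (Matching gK gN); apply: matching_eq => x.
case: (upP k x) => [->|->|[y ->]]; rewrite ?ins_k ?ins_Sk ?ins_up //=.
by rewrite downK.
Qed.

Lemma join_ins a b k (ab : a <> b) (ab' : up k a <> up k b) f :
  join ab' (ins k f) = ins k (join ab f).
Proof.
apply: matching_eq => x; have upE := fun x y => inj_eq (@up_inj k) x y.
have nk y : (k == up k y) = false by apply/eqP => /esym /up_neq.
have nk' y : (k.+1 == up k y) = false by apply/eqP => /esym /up_neqS.
case: (upP k x) => [->|->|[y ->]]; rewrite ?ins_k ?ins_Sk ?ins_up.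
- by rewrite joinE /join_fun !ins_up !nk ins_k.
- by rewrite joinE /join_fun !ins_up !nk' ins_Sk.
rewrite !joinE /join_fun !ins_up !upE /= /join_fun.
by do !case: ifP.
Qed.

Lemma cupcap_ins_lt j k f : j.+1 < k -> cupcap j (ins k f) = ins k (cupcap j f).
Proof.
move=> h; have e1 : up k j = j by rewrite /up; lia.
have e2 : up k j.+1 = j.+1 by rewrite /up; lia.
have ab' : up k j <> up k j.+1 by rewrite e1 e2; lia.
rewrite -(join_ins _ ab'); apply: matching_eq => x /=; by rewrite e1 e2.
Qed.

Lemma cupcap_ins_ge j k f : k <= j -> cupcap j.+2 (ins k f) = ins k (cupcap j f).
Proof.
move=> h; have e1 : up k j = j.+2 by rewrite /up; lia.
have e2 : up k j.+1 = j.+3 by rewrite /up; lia.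
have ab' : up k j <> up k j.+1 by rewrite e1 e2; lia.
rewrite -(join_ins _ ab'); apply: matching_eq => x /=; by rewrite e1 e2.
Qed.

Lemma cupcap_id k (f : matching) : f k = k.+1 -> cupcap k f = f.
Proof.
move=> fk; have fSk : f k.+1 = k by rewrite -fk mtK.
apply: matching_eq => x /=; rewrite /join_fun fk fSk; by eqcases.
Qed.

Lemma cupcap_k k (f : matching) : cupcap k f k = k.+1.
Proof. by rewrite /= /join_fun eqxx. Qed.
Lemma cupcap_Sk k (f : matching) : cupcap k f k.+1 = k.
Proof. by rewrite -(cupcap_k k f) mtK. Qed.

(** Isotopy of a zigzag: the cap ties the right end of the new arc to the next strand, which thereby
    ends at [k], and the cup is the arc again, one place further on. *)
Lemma ins_shift k f : cupcap k.+1 (ins k f) = ins k.+1 f.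
Proof.
apply: matching_eq => x; case: (upP k x) => [->|->|[y ->]].
- rewrite joinE /join_fun ins_Sk eqxx.
  have -> : (k == k.+1) = false by lia.
  have -> : (k == k.+2) = false by lia.
  have -> : k.+2 = up k k by rewrite /up; lia.
  rewrite ins_up /= /ins_fun.
  have -> : (k == k.+1) = false by lia.
  have -> : (k == k.+2) = false by lia.
  have -> : down k.+1 k = k by rewrite /down; lia.
  by have := @mt_neq f k; rewrite /up; lia.
- by rewrite cupcap_k ins_k.
rewrite joinE /join_fun ins_Sk.
have -> : k.+2 = up k k by rewrite /up; lia.
rewrite !ins_up !(inj_eq (@up_inj k)).
have -> : (up k y == k.+1) = false by rewrite /up; lia.
have -> : (up k y == k) = false by rewrite /up; lia.
rewrite /= /ins_fun.
have -> : (up k y == k.+1) = false by rewrite /up; lia.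
have -> : (up k y == k.+2) = (y == k) by rewrite /up; lia.
case: eqP => [_|yk] //.
have -> : down k.+1 (up k y) = y by rewrite /up /down; lia.
case: eqP => [->|yfk]; first by rewrite mtK /up; lia.
have : f y <> k by move=> e; apply: yfk; rewrite -e mtK.
by rewrite /up; lia.
Qed.

Lemma ins_shiftV k f : cupcap k (ins k.+1 f) = ins k f.
Proof.
by rewrite -ins_shift -{1}(cupcap_id (ins_k k f)) /cupcap join_braid; [exact: cupcap_id (ins_k k f) | lia].
Qed.

Lemma ins_comm k l f : k <= l -> ins l.+2 (ins k f) = ins k (ins l f).
Proof.
move=> kl; apply: matching_eq => x.
case: (upP k x) => [->|->|[y ->]].
- have -> : ins l.+2 (ins k f) k = ins l.+2 (ins k f) (up l.+2 k) by congr (_ _); rewrite /up; lia.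
  by rewrite ins_up !ins_k /up; lia.
- have -> : ins l.+2 (ins k f) k.+1 = ins l.+2 (ins k f) (up l.+2 k.+1) by congr (_ _); rewrite /up; lia.
  by rewrite ins_up !ins_Sk /up; lia.
rewrite ins_up.
case: (upP l y) => [->|->|[z ->]].
- have -> : up k l = l.+2 by rewrite /up; lia.
  by rewrite !ins_k /up; lia.
- have -> : up k l.+1 = l.+3 by rewrite /up; lia.
  by rewrite !ins_Sk /up; lia.
have e t : up k (up l t) = up l.+2 (up k t) by rewrite /up; lia.
by rewrite e !ins_up e.
Qed.

(** * Noncrossing matchings *)

Definition noncrossing (f : nat -> nat) : Prop :=
  forall p q, p < q < f p -> p < f q < f p.

(** No point lies between [k] and [k.+1], so an arc separating their mates would have to cross one
    of the two old arcs. The proof locates [p] and then [q] among the four points concerned. *)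
Lemma noncrossing_cupcap k (f : matching) : noncrossing f -> noncrossing (cupcap k f).
Proof.
move=> nf p q; rewrite !joinE /join_fun.
have ka := mtK f k; have kd := mtK f k.+1; have qf := mtK f q.
have na := @mt_neq f k; have nd := @mt_neq f k.+1.
case: (eqVneq p k) => [->|pk]; first by lia.
case: (eqVneq p k.+1) => [->|pk1]; first by lia.
have [pa|pa] := eqVneq p (f k).
  case: (eqVneq q k) => [->|qk]; first by lia.
  case: (eqVneq q k.+1) => [->|qk1]; first by lia.
  case: (eqVneq q (f k)) => [->|qa]; first by lia.
  case: (eqVneq q (f k.+1)) => [->|qd]; first by lia.
  move: pk pk1; rewrite {}pa => pk pk1.
  have dk : f k.+1 != k by apply/eqP => e; move/eqP: pk1; apply; rewrite -{1}e mtK.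
  have s1 := nf k k.+1; have s2 := nf (f k) (f k.+1).
  have s3 := nf (f k) q; have s4 := nf k.+1 q.
  by case: (ltngtP (f k) k) s1 s2 s3 s4; lia.
have [pd|pd] := eqVneq p (f k.+1).
  have ak : f k != k.+1 by apply/eqP => e; move/eqP: pk; apply; rewrite pd -e mtK.
  case: (eqVneq q k) => [->|qk]; first by lia.
  case: (eqVneq q k.+1) => [->|qk1]; first by lia.
  case: (eqVneq q (f k)) => [->|qa]; first by lia.
  case: (eqVneq q (f k.+1)) => [->|qd]; first by lia.
  move: pk pk1 pa; rewrite {}pd => pk pk1 pa.
  have q1 : f q != k by apply: contra qa => /eqP <-; rewrite qf.
  have q2 : f q != k.+1 by apply: contra qd => /eqP <-; rewrite qf.
  have q3 : f q != f k.+1 by rewrite (inj_eq (@mt_inj f)).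
  have q4 : f q != f k by rewrite (inj_eq (@mt_inj f)).
  have s1 := nf k k.+1; have s2 := nf (f k.+1) (f k).
  have s3 := nf k q; have s4 := nf k.+1 (f q).
  have s5 := nf (f k.+1) q; have s6 := nf (f k) (f q).
  move=> h.
  by case: (ltngtP (f k) k); lia.
have p1 : f p != k by apply: contra pa => /eqP <-; rewrite mtK.
have p2 : f p != k.+1 by apply: contra pd => /eqP <-; rewrite mtK.
case: (eqVneq q k) => [->|qk]; first by lia.
case: (eqVneq q k.+1) => [->|qk1]; first by lia.
case: (eqVneq q (f k)) => [->|qa].
  have := nf p (f k); have := nf p k.+1; lia.
case: (eqVneq q (f k.+1)) => [->|qd].
  have := nf p (f k.+1); have := nf p k; lia.
exact: nf.
Qed.

Lemma noncrossing_ins k (f : matching) : noncrossing (ins k f) <-> noncrossing f.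
Proof.
have lt x y : (up k x < up k y) = (x < y) by rewrite /up; lia.
split=> nf p q.
  by have := nf (up k p) (up k q); rewrite !ins_up !lt.
case: (upP k p) => [->|->|[x ->]]; rewrite ?ins_k ?ins_Sk ?ins_up; try lia.
case: (upP k q) => [->|->|[y ->]]; rewrite ?ins_k ?ins_Sk ?ins_up.
- by rewrite /up; lia.
- by rewrite /up; lia.
by rewrite !lt; exact: nf.
Qed.

(** * The Temperley-Lieb action *)

Section TL.
Local Open Scope ring_scope.
Variables (R : comNzRingType) (A Ai : R).
Hypothesis AAi : A * Ai = 1.
Notation fn := (matching -> R).
Implicit Types (phi : fn) (f : matching).

(* Diagrams act on functionals of matchings by precomposition, so a composite
   [F (G phi)] applies the diagram of [F] to the matching first. *)

Definition loop_value : R := - A ^+ 2 - Ai ^+ 2.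
Definition weight_at k f : R := if f k == k.+1 then loop_value else 1.
Definition cupcapF k phi : fn := fun f => weight_at k f * phi (cupcap k f).
Definition crossF k phi : fn := fun f => A * phi f + Ai * cupcapF k phi f.
Definition insF k phi : fn := fun f => phi (ins k f).

Lemma weight_at_loop k f : weight_at k (cupcap k f) = loop_value.
Proof. by rewrite /weight_at cupcap_k eqxx. Qed.
Lemma weight_at_S k f : weight_at k.+1 (cupcap k f) = 1.
Proof. by rewrite /weight_at cupcap_Sk; case: eqP => //; lia. Qed.
Lemma weight_at_P k f : weight_at k (cupcap k.+1 f) = 1.
Proof.
rewrite /weight_at; case: eqP => // e; have := mtK (cupcap k.+1 f) k.
by rewrite e cupcap_k; lia.
Qed.

(** The factors need not agree one by one: if [f] joins {k, k + 1} to {l, l + 1}, the loop is closed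
    by whichever cup-cap comes second. *)
Lemma weight_at_comm k l f : (k.+1 < l)%N ->
  weight_at k f * weight_at l (cupcap k f) = weight_at l f * weight_at k (cupcap l f).
Proof.
move=> kl; rewrite /weight_at !joinE /join_fun.
have /eqP/negbTE-> : l <> k by lia.
have /eqP/negbTE-> : l <> k.+1 by lia.
have /eqP/negbTE-> : k <> l by lia.
have /eqP/negbTE-> : k <> l.+1 by lia.
have h1 : l <> k by lia.
have h2 : l <> k.+1 by lia.
have h3 : l.+1 <> k by lia.
have h4 : l.+1 <> k.+1 by lia.
have h5 := @n_neqSn k; have h6 := @n_neqSn l.
have := mtK f k; have := mtK f k.+1; have := mtK f l; have := mtK f l.+1.
move=> ? ? ? ?.
eqcases; by rewrite ?mulr1 ?mul1r.
Qed.

Lemma fext phi psi : phi =1 psi -> phi = psi.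
Proof. by move=> e; apply: functional_extensionality. Qed.

Lemma cupcapF_idem k phi f : cupcapF k (cupcapF k phi) f = loop_value * cupcapF k phi f.
Proof. by rewrite /cupcapF weight_at_loop /cupcap join_idem mulrCA. Qed.

Lemma cupcapF_braid k phi : cupcapF k (cupcapF k.+1 (cupcapF k phi)) = cupcapF k phi.
Proof.
apply: fext => f; rewrite /cupcapF weight_at_S weight_at_P !mul1r; congr (_ * phi _).
by rewrite /cupcap join_braid //; lia.
Qed.

Lemma cupcapF_braidV k phi : cupcapF k.+1 (cupcapF k (cupcapF k.+1 phi)) = cupcapF k.+1 phi.
Proof.
apply: fext => f; rewrite /cupcapF weight_at_S weight_at_P !mul1r; congr (_ * phi _).
have ab : k.+2 <> k.+1 by lia.
have bc : k.+1 <> k by lia.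
have e1 g : cupcap k.+1 g = join ab g by apply: joinC.
have e2 g : cupcap k g = join bc g by apply: joinC.
by rewrite !e1 e2 join_braid //; lia.
Qed.

Lemma cupcapF_comm k l phi : (k.+1 < l)%N -> cupcapF k (cupcapF l phi) = cupcapF l (cupcapF k phi).
Proof.
move=> kl; apply: fext => f; rewrite /cupcapF !mulrA weight_at_comm //; congr (_ * phi _).
by rewrite /cupcap join_comm //; lia.
Qed.

Lemma crossF_comm k l phi : (k.+1 < l)%N -> crossF k (crossF l phi) = crossF l (crossF k phi).
Proof.
move=> kl; apply: fext => f; have := congr1 (fun g : fn => g f) (cupcapF_comm phi kl).
by rewrite /crossF /cupcapF => e; ring: e.
Qed.

(** Reidemeister III. Both sides expand in cup-caps, and the Temperley-Lieb relations together with
    the loop value identify the results. *)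
Lemma crossF_braid k phi : crossF k (crossF k.+1 (crossF k phi)) = crossF k.+1 (crossF k (crossF k.+1 phi)).
Proof.
apply: fext => f.
have e1 := congr1 (fun g : fn => g f) (cupcapF_braid k phi).
have e2 := congr1 (fun g : fn => g f) (cupcapF_braidV k phi).
have e3 := cupcapF_idem k phi f; have e4 := cupcapF_idem k.+1 phi f.
by move: e1 e2 e3 e4; rewrite /crossF /cupcapF /loop_value => e1 e2 e3 e4; ring: e1 e2 e3 e4 AAi.
Qed.

Lemma insF_crossF_lt k l phi : (k.+1 < l)%N -> insF l (crossF k phi) = crossF k (insF l phi).
Proof.
move=> kl; apply: fext => f; rewrite /insF /crossF /cupcapF cupcap_ins_lt //.
suff -> : weight_at k (ins l f) = weight_at k f by [].
have e x : (x < l)%N -> up l x = x by rewrite /up; lia.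
have E : ins l f k = up l (f k) by rewrite -ins_up e //; lia.
by rewrite /weight_at E -[in LHS](e k.+1) // (inj_eq (@up_inj l)).
Qed.

Lemma insF_crossF_ge k l phi : (l <= k)%N -> insF l (crossF k.+2 phi) = crossF k (insF l phi).
Proof.
move=> kl; apply: fext => f; rewrite /insF /crossF /cupcapF cupcap_ins_ge //.
suff -> : weight_at k.+2 (ins l f) = weight_at k f by [].
have e x : (l <= x)%N -> x.+2 = up l x by rewrite /up; lia.
have E : ins l f k.+2 = up l (f k) by rewrite -ins_up -e.
by rewrite /weight_at E (e k.+1) ?(inj_eq (@up_inj l)) //; lia.
Qed.

Lemma weight_at_ins k f : weight_at k (ins k f) = loop_value.
Proof. by rewrite /weight_at ins_k eqxx. Qed.
Lemma weight_at_insS k f : weight_at k.+1 (ins k f) = 1.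
Proof. by rewrite /weight_at ins_Sk; case: eqP => //; lia. Qed.
Lemma weight_at_insP k f : weight_at k (ins k.+1 f) = 1.
Proof.
rewrite /weight_at; case: eqP => // e; have := mtK (ins k.+1 f) k.
by rewrite e ins_k; lia.
Qed.

(* Reidemeister II. *)
Lemma insF_crossF2 k phi : insF k (crossF k.+1 (crossF k phi)) = insF k.+1 phi.
Proof.
apply: fext => f; rewrite /insF /crossF /cupcapF weight_at_ins weight_at_insS.
rewrite ins_shift weight_at_insP ins_shiftV cupcap_id ?ins_k //.
by rewrite /loop_value; ring: AAi.
Qed.

Lemma insF_crossF2V k phi : insF k.+1 (crossF k (crossF k.+1 phi)) = insF k phi.
Proof.
apply: fext => f; rewrite /insF /crossF /cupcapF weight_at_ins weight_at_insP.
rewrite ins_shiftV weight_at_insS ins_shift cupcap_id ?ins_k //.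
by rewrite /loop_value; ring: AAi.
Qed.

Lemma insF_comm k l phi : (k <= l)%N -> insF k (insF l.+2 phi) = insF l (insF k phi).
Proof. by move=> kl; apply: fext => f; rewrite /insF ins_comm. Qed.

(** * Chords laid over a block of strands *)

Fixpoint crossesF P d phi : fn := if d is d'.+1 then crossF (P + d') (crossesF P d' phi) else phi.

Lemma crossesF_add P a b phi : crossesF P (a + b) phi = crossesF (P + a) b (crossesF P a phi).
Proof. by elim: b => [|b IH] /=; rewrite ?addn0 // addnS /= IH addnA. Qed.

Lemma crossesFS P d phi : crossesF P d.+1 phi = crossesF P.+1 d (crossF P phi).
Proof. by rewrite -add1n crossesF_add /= addn0 addn1. Qed.

Lemma crossF_crossesF_gt k P d phi : (P + d < k)%N -> crossF k (crossesF P d phi) = crossesF P d (crossF k phi).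
Proof.
elim: d => [|d IH] //= h; rewrite -crossF_comm; last lia.
by rewrite IH //; lia.
Qed.

Lemma crossF_crossesF_lt k P d phi : (k.+1 < P)%N -> crossF k (crossesF P d phi) = crossesF P d (crossF k phi).
Proof.
move=> h; elim: d => [|d IH] //=; rewrite crossF_comm; last lia.
by rewrite IH.
Qed.

Lemma insF_crossesF_gt k P d phi : (P + d < k)%N -> insF k (crossesF P d phi) = crossesF P d (insF k phi).
Proof.
elim: d => [|d IH] //= h; rewrite insF_crossF_lt; last lia.
by rewrite IH //; lia.
Qed.

Lemma insF_crossesF_le k P d phi : (k <= P)%N -> insF k (crossesF P.+2 d phi) = crossesF P d (insF k phi).
Proof.
move=> h; elim: d => [|d IH] //=; rewrite !addSn insF_crossF_ge; last lia.
by rewrite IH.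
Qed.

(** A chord lying over both ends of a new arc is pulled off it by Reidemeister II. The arc then sits
    one place higher, since the moving end of the chord has passed from its right to its left. *)
Lemma insF_crossesF_slide k P d phi : (P <= k <= P + d)%N ->
  insF k (crossesF P d.+2 phi) = crossesF P d (insF k.+1 phi).
Proof.
move=> h; have [a [b [-> ->]]] : exists a b, k = (P + a)%N /\ d = (a + b)%N.
  by exists (k - P)%N, (P + d - k)%N; lia.
have -> : (a + b).+2 = (a + (b.+2))%N by lia.
rewrite crossesF_add !crossesFS insF_crossesF_le // insF_crossF2 insF_crossesF_gt; last lia.
by rewrite crossesF_add.
Qed.

(** Reidemeister III pushes a crossing past the chord; its place shifts by one because the end of
    the chord changes sides. *)
Lemma crossF_crossesF_braid k P d phi : (P <= k)%N -> (k.+1 < P + d)%N ->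
  crossF k (crossesF P d phi) = crossesF P d (crossF k.+1 phi).
Proof.
move=> h1 h2; have [a [b [-> ->]]] : exists a b, k = (P + a)%N /\ d = (a + b.+2)%N.
  by exists (k - P)%N, (P + d - k.+2)%N; lia.
rewrite !crossesF_add !crossesFS crossF_crossesF_lt; last lia.
by rewrite crossF_braid crossF_crossesF_gt //; lia.
Qed.

Lemma crossesF_braid p e P d phi : (P <= p)%N -> (p + e < P + d)%N ->
  crossesF p e (crossesF P d phi) = crossesF P d (crossesF p.+1 e phi).
Proof.
move=> h1; elim: e => [|e IH] //= h2.
by rewrite IH ?(@crossF_crossesF_braid (p + e)); [rewrite addSn | lia | lia | lia].
Qed.

(* Dual to inserting a chord from [P] to [P + d + 1] which crosses, one level above
   them, the strands ending at the [d] points in between. *)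
Definition chordF P d phi : fn := insF (P + d) (crossesF P d phi).

Lemma chordF_left P d phi : chordF P d.+1 phi = chordF P.+1 d (crossF P phi).
Proof. by rewrite /chordF crossesFS addSnnS. Qed.

(** Widening the chord by one strand and then crossing its right end with that strand is undone by
    Reidemeister II. *)
Lemma chordF_right P d phi : chordF P d.+1 (crossF (P + d.+1) phi) = chordF P d phi.
Proof. by rewrite /chordF /= -crossF_crossesF_gt ?addnS // insF_crossF2V. Qed.

(** The order in which two nested chords are drawn is immaterial. When the wide one comes second it
    also lies over the two ends of the narrow one, hence [D.+2]. *)
Lemma chordF_nested P D p d phi : (P <= p)%N -> (p + d <= P + D)%N ->
  chordF P D (chordF p.+1 d phi) = chordF p d (chordF P D.+2 phi).
Proof.
move=> h1 h2; rewrite /chordF.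
have -> : (P + D.+2 = (P + D).+2)%N by lia.
rewrite -(insF_crossesF_gt (k := (P + D).+2)); last lia.
rewrite insF_comm // crossesF_braid //; last lia.
by rewrite insF_crossesF_slide ?addSn //; lia.
Qed.

Fixpoint latticeF n m phi : fn := if m is m'.+1 then latticeF n m' (chordF m' n phi) else phi.

(** A chord starting below [j] left ends and [j] right ends must pass over all of them and over the
    [n] vertical strands. In the induction the top row, nested inside this chord, is moved before it
    by [chordF_nested]. *)
Lemma latticeF_row n m j phi : (j <= m)%N ->
  latticeF n m.+1 phi = latticeF n m (chordF (m - j) (n + j.*2) phi).
Proof.
elim: m j phi => [|m IH] [|j] phi h //; rewrite ?addn0 //.
transitivity (latticeF n m.+1 (chordF m.+1 n phi)) => //.
rewrite (IH j) // chordF_nested //; [|lia|lia].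
by congr (latticeF _ _ (chordF _ _ (chordF _ _ _))); lia.
Qed.

Lemma crossesF_scale P d (c : R) phi : crossesF P d (fun f => c * phi f) = fun f => c * crossesF P d phi f.
Proof.
elim: d => [|d IH] //=; apply: fext => f; rewrite IH /crossF /cupcapF; ring.
Qed.

Lemma chordF_scale P d (c : R) phi : chordF P d (fun f => c * phi f) = fun f => c * chordF P d phi f.
Proof. by rewrite /chordF crossesF_scale. Qed.

Lemma latticeF_scale n m (c : R) phi f : latticeF n m (fun f => c * phi f) f = c * latticeF n m phi f.
Proof. by elim: m phi => [|m IH] phi //=; rewrite chordF_scale IH. Qed.

(** * Coefficient functionals *)

Definition nceq phi psi := forall f, noncrossing f -> phi f = psi f.

Lemma crossesF_nceq P d phi psi : nceq phi psi -> nceq (crossesF P d phi) (crossesF P d psi).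
Proof.
move=> e; elim: d => [|d IH] //= f nf.
by rewrite /crossF /cupcapF !IH //; apply: noncrossing_cupcap.
Qed.

Lemma latticeF_nceq n m phi psi : nceq phi psi -> nceq (latticeF n m phi) (latticeF n m psi).
Proof.
elim: m phi psi => [|m IH] phi psi e //=; apply: IH => f nf.
by apply: crossesF_nceq => //; apply/noncrossing_ins.
Qed.

(** The dual basis vector of [K] on the places below [M]: a diagram applied to it yields the
    coefficient of [K]. *)
Definition agree M (K : matching) : fn := fun f => ([forall x : 'I_M, f x == K x])%:R.

Lemma agreeP M (K f : matching) :
  reflect (forall x, (x < M)%N -> f x = K x) [forall x : 'I_M, f x == K x].
Proof.
apply: (iffP forallP) => [h x lt|h x]; first by have /eqP := h (Ordinal lt).
by apply/eqP/h.
Qed.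

(** The -1 smoothing leaves a short arc at [k], which [K] lacks. *)
Lemma crossF_agree k M (K : matching) : (k < M)%N -> K k != k.+1 ->
  crossF k (agree M K) = fun f => A * agree M K f.
Proof.
move=> kM Kk; apply: fext => f; rewrite /crossF /cupcapF /agree.
case: (agreeP M K (cupcap k f)) => [/(_ _ kM)|_]; last by rewrite !mulr0 addr0.
by rewrite cupcap_k => e; rewrite e eqxx in Kk.
Qed.

Lemma insF_agree k M (K : matching) : (k <= M)%N ->
  insF k (agree M.+2 (ins k K)) = agree M K.
Proof.
move=> kM; apply: fext => f; rewrite /insF /agree; congr (nat_of_bool _)%:R.
apply/agreeP/agreeP => h x hx.
  apply: (@up_inj k); rewrite -!ins_up; apply: h; rewrite /up; lia.
case: (upP k x) hx => [->|->|[y ->]]; rewrite ?ins_k ?ins_Sk ?ins_up //.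
by move=> hx; rewrite h //; move: hx; rewrite /up; lia.
Qed.

Lemma insF_agree0 k M (K : matching) : (k < M)%N -> K k != k.+1 ->
  insF k (agree M K) = fun f => 0.
Proof.
move=> kM Kk; apply: fext => f; rewrite /insF /agree.
case: (agreeP M K (ins k f)) => // /(_ _ kM); rewrite ins_k => e.
by rewrite e eqxx in Kk.
Qed.

(* For [P < Q], [skip2 P Q] enumerates the naturals other than [P] and [Q]. *)
Definition skip2 P Q x := (x + (P <= x) + (Q <= x.+1))%N.
Definition removed P Q (K K' : nat -> nat) : Prop :=
  forall x, K (skip2 P Q x) = skip2 P Q (K' x).

(** As long as the strands still to be crossed lead out of the interval, no resolution joins [P] to
    [(P + d).+1]: at the last crossing the +1 marker leaves an outgoing strand at [P] and the -1
    marker an arc from [P] to [P.+1], too short because [d] is positive. *)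
Lemma crossesF_straight0 P d j M (K g : matching) : (j <= d)%N -> (0 < d)%N ->
  (P < M)%N ->
  K P = (P + d).+1 ->
  (forall i, (i < j)%N -> (g (P + i) < P)%N \/ (P + d.+1 < g (P + i))%N) ->
  (j = 0%N -> g P <> (P + d).+1) ->
  crossesF P j (agree M K) g = 0.
Proof.
move=> jd d0 PM KP; elim: j jd g => [|j IH] jd g out gj /=.
  rewrite /agree; case: (agreeP M K g) => // /(_ _ PM).
  by rewrite KP => /gj -/(_ erefl).
have out0 := out 0%N; rewrite addn0 in out0.
rewrite /crossF /cupcapF !IH ?mulr0 ?addr0 //; try lia.
- move=> i ij; have := out i; have := out j; rewrite joinE /join_fun.
  have /eqP/negbTE -> : (P + i)%N <> (P + j)%N by lia.
  have /eqP/negbTE -> : (P + i)%N <> (P + j).+1 by lia.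
  case: eqP => [|_]; first lia.
  case: eqP => [e|_]; last by lia.
  have : g (P + i)%N = (P + j).+1 by rewrite e mtK.
  by have := out i; lia.
- by move=> j0; rewrite {}j0 addn0 in out gj *; rewrite cupcap_k; lia.
by move=> i ij; apply: out; lia.
Qed.

(** Innermost arc: inside an arc that is not short, the point next to its left end belongs to a
    shorter one. *)
Lemma short_arc P Q (f : matching) x : noncrossing f -> (P <= x < Q)%N -> (P <= f x < Q)%N ->
  exists k, [/\ (P <= k)%N, (k.+1 < Q)%N & f k = k.+1].
Proof.
move=> nf; wlog xf : x / (x < f x)%N.
  move=> h; case: (ltngtP x (f x)); first by exact: h.
    by move=> lt ? ?; apply: (h (f x)); rewrite ?mtK.
  by move=> e; have := @mt_neq f x; rewrite -e.
have [d] := ubnP (f x - x)%N; elim: d x xf => // d IH x xf dx hx hfx.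
have [e|ne] := eqVneq (f x) x.+1; first by exists x; split => //; lia.
have h1 := nf x x.+1; have ne' := @mt_neq f x.+1.
case: (ltngtP x.+1 (f x.+1)) => [h2|h2|/esym //]; first by apply: (IH x.+1); lia.
by apply: (IH (f x.+1)); rewrite ?mtK; lia.
Qed.

(** An arc of [f] under the chord is pulled off it, which lowers [d] by 2. When none is left, either
    the chord is short and is simply removed, or all strands under it lead outside while those of
    [K] stay inside, and both sides vanish. *)
Lemma chordF_straight P d M (K K' f : matching) :
  noncrossing K -> noncrossing f -> (P + d <= M)%N ->
  K P = (P + d).+1 -> removed P (P + d).+1 K K' ->
  chordF P d (agree M.+2 K) f = agree M K' f.
Proof.
have [D] := ubnP d; elim: D d M K K' f => // D IH d M K K' f dD nK nf PdM KP rem.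
have bE := fun x => rem x.
case: d dD PdM KP rem bE => [|d] dD PdM KP rem bE.
  rewrite /chordF addn0 in KP rem bE *.
  have -> : K = ins P K'.
    apply: matching_eq => x; case: (upP P x) => [->|->|[y ->]].
    - by rewrite KP ins_k.
    - by rewrite ins_Sk -KP mtK.
    have e z : skip2 P P.+1 z = up P z by rewrite /skip2 /up; lia.
    by rewrite ins_up -!e.
  by rewrite /= insF_agree // ?addn0; lia.
have inK' x : (P <= x < P + d.+1)%N -> (P <= K' x < P + d.+1)%N.
  move=> hx; have := nK P (skip2 P (P + d.+1).+1 x); rewrite bE KP.
  rewrite /skip2; lia.
case: (boolP [exists i : 'I_d.+1, (P <= f (P + i) < P + d.+1)%N]) => [/existsP[i hi]|].
  have hi' : (P <= P + i < P + d.+1)%N by have := ltn_ord i; lia.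
  have [k [Pk kd fk]] := short_arc nf hi' hi.
  have [f0 ef] := ins_ex fk.
  rewrite ef in nf *; move/noncrossing_ins: nf => nf0.
  have [d' ed] : exists d', d = d'.+1 by exists d.-1; lia.
  subst d.
  have -> : chordF P d'.+2 (agree M.+2 K) (ins k f0) = chordF P d' (insF k.+1 (agree M.+2 K)) f0.
    rewrite /chordF -insF_crossesF_slide; last lia.
    rewrite -[LHS]/(insF k (insF (P + d'.+2) (crossesF P d'.+2 (agree M.+2 K))) f0).
    by rewrite !addnS insF_comm //; lia.
  (* The arc pulled off now ends at [k.+1] and [k.+2]. Either [K] has it too and all the matchings
     lose it, or both sides are zero. *)
  have [Kk|Kk] := eqVneq (K k.+1) k.+2.
    have [K0 eK] := ins_ex Kk.
    have K'k : K' k = k.+1.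
      have := bE k; have -> : skip2 P (P + d'.+2).+1 k = k.+1 by rewrite /skip2; lia.
      rewrite Kk /skip2; lia.
    have [K0' eK'] := ins_ex K'k.
    rewrite eK eK' ; have [M' eM] : exists M', M = M'.+2 by exists M.-2; lia.
    subst M K K'.
    rewrite insF_agree ; last lia.
    have h := @IH d' M' K0 K0' f0; rewrite h //; try lia.
    - by rewrite -(insF_agree (k := k)) //; lia.
    - by move/noncrossing_ins: nK.
    - have e : up k.+1 P = P by rewrite /up; lia.
      apply: (@up_inj k.+1); rewrite -ins_up e KP /up; lia.
    move=> x; apply: (@up_inj k.+1); rewrite -ins_up.
    have e z : up k.+1 (skip2 P (P + d').+1 z) = skip2 P (P + d'.+2).+1 (up k z).
      by rewrite /skip2 /up; lia.
    by rewrite !e bE ins_up.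
  rewrite insF_agree0 //; last lia.
  have -> : chordF P d' (fun=> 0 : R) f0 = 0.
    have -> : (fun=> 0 : R) = (fun g : matching => 0 * (fun=> 0 : R) g).
      by apply: fext => g; rewrite mul0r.
    by rewrite chordF_scale mul0r.
  rewrite /agree; case: (agreeP M K' (ins k f0)) => // h; exfalso.
  have e : K' k = k.+1 by rewrite -h ?ins_k //; lia.
  move/negP: Kk; apply; apply/eqP.
  have := bE k; rewrite e.
  have -> : skip2 P (P + d'.+2).+1 k = k.+1 by rewrite /skip2; lia.
  by move=> ->; rewrite /skip2; lia.
rewrite negb_exists => /forallP out.
have out' i : (i < d.+1)%N -> (f (P + i) < P)%N \/ (P + d.+1 <= f (P + i))%N.
  by move=> lt; have := out (Ordinal lt) => /=; lia.
have -> : agree M K' f = 0.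
  rewrite /agree; case: (agreeP M K' f) => // h; exfalso.
  have := out' 0; have := inK' P; rewrite addn0 -h; lia.
rewrite /chordF /insF.
have e x : (x < P + d.+1)%N -> up (P + d.+1) x = x by rewrite /up; lia.
apply: (@crossesF_straight0 P d.+1) => //; try lia.
- move=> i lt; rewrite -(e (P + i)%N); last lia.
  rewrite ins_up; have := out' i lt; rewrite /up; lia.
Qed.

(** The crossings of the chord at the places from [P] to [P + t - 1] are the ones drawn last, and
    [K] allows only +1 markers there. *)
Lemma chordF_move_left P d t M (K f : matching) : (P + t <= M)%N ->
  (forall k, (P <= k < P + t)%N -> K k <> k.+1) ->
  chordF P (d + t) (agree M K) f = A ^+ t * chordF (P + t) d (agree M K) f.
Proof.
elim: t P => [|t IH] P PM nK; first by rewrite !addn0 mul1r.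
rewrite addnS chordF_left crossF_agree; [|lia|by apply/eqP/nK; lia].
rewrite chordF_scale IH; [|lia|by move=> k hk; apply: nK; lia].
by rewrite addSnnS exprS mulrA.
Qed.

(** By [chordF_right] a narrow chord is a wider one followed by a crossing at its right end, and [K]
    excludes the -1 marker of that crossing. *)
Lemma chordF_move_right P d t M (K f : matching) : (P + d + t < M)%N ->
  (forall k, (P + d < k <= P + d + t)%N -> K k <> k.+1) ->
  A ^+ t * chordF P (d + t) (agree M K) f = chordF P d (agree M K) f.
Proof.
elim: t d => [|t IH] d PM nK; first by rewrite !addn0 mul1r.
rewrite -[chordF P d _ in RHS]chordF_right crossF_agree; [|lia|by apply/eqP/nK; lia].
rewrite chordF_scale exprS -mulrA -addSnnS IH //; first by lia.
by move=> k hk; apply: nK; lia.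
Qed.
End TL.

(** * Kauffman states *)

Section Frontier.
Variable V : finType.
Implicit Types (e : rel V) (act : {set V}) (S : seq V).

(** Classes are counted as sets and not by their roots, because the roots depend on the relation,
    which changes with each crossing. *)
Definition component e x : {set V} := [set y | connect e x y].

Lemma componentP e x y : connect_sym e -> (component e x == component e y) = connect e x y.
Proof.
move=> es; apply/eqP/idP => [E|c].
  have yy : y \in component e y by rewrite inE.
  by rewrite -E inE in yy.
by apply/setP => z; rewrite !inE; apply: same_connect.
Qed.

Lemma n_comp_component e (a : {pred V}) : connect_sym e -> closed e a ->
  n_comp e a = #|[set component e x | x in a]|.
Proof.
move=> es ca; rewrite /n_comp_mem.
rewrite -(card_in_imset (f := component e) (D := predI (roots e) (mem a))); last first.
  move=> x y /andP[/eqP rx _] /andP[/eqP ry _] /eqP; rewrite componentP // => c.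
  by rewrite -rx -ry; apply/eqP; rewrite root_connect.
congr #|pred_of_set _|; apply/setP => X; apply/imsetP/imsetP => [[x /andP[_ xa] ->]|[x xa ->]].
  by exists x.
exists (fingraph.root e x); first by rewrite inE /= roots_root //= -(closed_connect ca (connect_root e x)).
by apply/eqP; rewrite componentP // connect_root.
Qed.

Lemma connect_min e (r : rel V) : reflexive r ->
  (forall a b c, r a b -> e b c -> r a c) -> subrel (connect e) r.
Proof.
move=> rr st u v /connectP[p pth ->].
have gen q w : path e w q -> r u w -> r u (last w q).
  by elim: q w => [|y q IH] w //= /andP[ewy pq] h; apply: IH pq (st _ _ _ h ewy).
exact: gen pth (rr u).
Qed.

(* [S] lists the vertices that meet the boundary of the part [act] of the
   diagram drawn so far, [f] is the matching it induces on the positions of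
   [S] and [l] its number of closed components. *)
Record partial_diagram e act S (f : matching) (l : nat) : Prop := PartialDiagram {
  partial_diagram_sym : symmetric e;
  partial_diagram_act : forall u v, e u v -> u \in act;
  partial_diagram_S : {subset S <= act};
  partial_diagram_f : forall p, p < size S -> f p < size S;
  partial_diagram_conn : forall v0 p q, p < size S -> q < size S ->
    connect e (nth v0 S p) (nth v0 S q) = (q == p) || (q == f p);
  partial_diagram_loops : #|[set component e x | x in [pred x in act | ~~ has (connect e x) S]]| = l }.

Definition add_edge (a b : V) e : rel V :=
  fun u v => [|| (u == a) && (v == b), (u == b) && (v == a) | e u v].

Section Step.
Variables (e : rel V) (act : {set V}) (s1 s2 : seq V) (x h t l : V) (f : matching) (c : nat).
Hypothesis H : partial_diagram e act (s1 ++ x :: h :: s2) f c.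
Hypotheses (ta : t \notin act) (la : l \notin act) (tl : t != l).
Let S := s1 ++ x :: h :: s2.
Let S' := s1 ++ l :: t :: s2.
Let act' := t |: (l |: act).

Let xS : x \in S. Proof. by rewrite mem_cat !inE eqxx orbT. Qed.
Let hS : h \in S. Proof. by rewrite mem_cat !inE eqxx !orbT. Qed.
Let xa : x \in act. Proof. exact: (partial_diagram_S H). Qed.
Let ha : h \in act. Proof. exact: (partial_diagram_S H). Qed.
Let es : connect_sym e. Proof. exact: sym_connect_sym (partial_diagram_sym H). Qed.
Let nt u : u \in act -> (u == t) = false.
Proof. by move=> ua; apply/eqP => e0; move: ta; rewrite -e0 ua. Qed.
Let nl u : u \in act -> (u == l) = false.
Proof. by move=> ua; apply/eqP => e0; move: la; rewrite -e0 ua. Qed.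
Let act2 u v : e u v -> v \in act.
Proof. by rewrite (partial_diagram_sym H); apply: (partial_diagram_act H). Qed.
Let cact u v : connect e u v -> (u \in act) = (v \in act).
Proof.
by move=> cuv; apply: (closed_connect _ cuv) => y z eyz; rewrite (partial_diagram_act H eyz) (act2 eyz).
Qed.
Let sS : size S' = size S. Proof. by rewrite !size_cat. Qed.

(** The +1 marker only prolongs two strands, [x] to [l] and [h] to [t]. The retraction [r] of the
    new segments onto the old ones therefore identifies the components. *)
Lemma partial_diagram_plus e' : e' =2 add_edge t h (add_edge l x e) -> partial_diagram e' act' S' f c.
Proof.
move=> eE; pose r u := if u == t then h else if u == l then x else u.
have rt : r t = h by rewrite /r eqxx.
have rl : r l = x by rewrite /r eqxx eq_sym (negbTE tl).
have ra u : u \in act -> r u = u by move=> ua; rewrite /r nt ?nl.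
have rS : map r S' = S.
  rewrite map_cat /= rt rl; congr (_ ++ _ :: _ :: _).
    by apply: map_id_in => u us; apply/ra/(partial_diagram_S H); rewrite mem_cat us.
  by apply: map_id_in => u us; apply/ra/(partial_diagram_S H); rewrite mem_cat !inE us !orbT.
have sym' : symmetric e'.
  by move=> u v; rewrite !eE /add_edge (partial_diagram_sym H); do !case: eqP => //= _; rewrite ?orbT.
have es' := sym_connect_sym sym'.
have rc u : connect e' u (r u).
  rewrite /r; case: (eqVneq u t) => [->|_]; first by apply: connect1; rewrite eE /add_edge !eqxx.
  by case: (eqVneq u l) => [->|_] //; apply: connect1; rewrite eE /add_edge !eqxx !orbT.
have sub : subrel (connect e) (connect e').
  by apply: connect_sub => u v euv; apply: connect1; rewrite eE /add_edge euv !orbT.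
have cE u v : connect e' u v = connect e (r u) (r v).
  apply/idP/idP => [|cr]; last first.
    by apply: connect_trans (rc u) _; apply: connect_trans (sub _ _ cr) _; rewrite es'.
  apply: (connect_min (r := fun u v => connect e (r u) (r v))) => [w|a b d ab]; first exact: connect0.
  rewrite eE => /or3P[/andP[/eqP eb /eqP ed]|/andP[/eqP eb /eqP ed]|].
  - by move: ab; rewrite eb ed rt (ra h ha).
  - by move: ab; rewrite eb ed rt (ra h ha).
  case/or3P => [/andP[/eqP eb /eqP ed]|/andP[/eqP eb /eqP ed]|ebd].
  - by move: ab; rewrite eb ed rl (ra x xa).
  - by move: ab; rewrite eb ed rl (ra x xa).
  apply: connect_trans ab _; rewrite (ra b (partial_diagram_act H ebd)) (ra d (act2 ebd)); exact: connect1.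
split.
- exact: sym'.
- move=> u v; rewrite eE => /or3P[/andP[/eqP -> _]|/andP[/eqP -> _]|/or3P[/andP[/eqP -> _]|/andP[/eqP -> _]|/(partial_diagram_act H) ua]];
  by rewrite !inE ?eqxx ?xa ?ha ?ua ?orbT.
- move=> u; rewrite mem_cat !inE => /or4P[us|/eqP->|/eqP->|us]; rewrite ?eqxx ?orbT //;
  by rewrite (partial_diagram_S H) ?orbT // mem_cat ?inE us ?orbT.
- by rewrite sS; apply: (partial_diagram_f H).
- move=> v0 p q; rewrite sS => hp hq; rewrite cE -!(nth_map v0 (r v0)) ?sS // rS.
  exact: (partial_diagram_conn H).
rewrite -(partial_diagram_loops H); congr #|pred_of_set _|.
have hasE u : has (connect e' u) S' = has (connect e (r u)) S.
  rewrite -rS has_map; apply: eq_has => v /=; exact: cE.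
have clsE u : u \in act -> ~~ has (connect e u) S -> component e' u = component e u.
  move=> ua uS; apply/setP => v; rewrite !inE cE (ra u) // /r.
  have no w z : w \in S -> z \notin act -> connect e u w = connect e u z.
    move=> wS za; transitivity false; first exact/negbTE/(hasPn uS).
    by apply/esym/negbTE; apply: contra za => /cact <-.
  case: (eqVneq v t) => [->|_]; first exact: no.
  by case: (eqVneq v l) => [->|_] //; apply: no.
apply/setP => X; apply/imsetP/imsetP => -[u /andP[ua uS] ->]; exists u.
- move: uS; rewrite hasE inE /=; move: ua; rewrite !inE /= => /or3P[/eqP ->|/eqP ->|ua].
  + by rewrite rt => /hasP[]; exists h.
  + by rewrite rl => /hasP[]; exists x.
  by rewrite ra // ua.
- move: uS; rewrite hasE; move: ua; rewrite !inE /= => /or3P[/eqP ->|/eqP ->|ua].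
  + by rewrite rt => /hasP[]; exists h.
  + by rewrite rl => /hasP[]; exists x.
  by rewrite ra // => uS; apply: clsE.
- by rewrite inE /= !inE ua !orbT hasE ra.
by rewrite clsE.
Qed.

Let nthx v0 : nth v0 S (size s1) = x.
Proof. by rewrite nth_cat ltnn subnn. Qed.
Let nthh v0 : nth v0 S (size s1).+1 = h.
Proof. by rewrite nth_cat ltnNge leqnSn /= subSnn. Qed.
Let szk : (size s1).+1 < size S.
Proof. by rewrite size_cat /=; lia. Qed.
Let nthS' v0 p : nth v0 S' p =
  if p == size s1 then l else if p == (size s1).+1 then t else nth v0 S p.
Proof.
rewrite !nth_cat; case: (eqVneq p (size s1)) => [->|pk]; first by rewrite ltnn subnn.
case: (eqVneq p (size s1).+1) => [->|pk1]; first by rewrite ltnNge leqnSn subSnn.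
case: ltnP => // lt; have -> : p - size s1 = (p - (size s1).+2).+2 by lia.
by [].
Qed.
Let nthact v0 p : p < size S -> nth v0 S p \in act.
Proof. by move=> lt; apply: (partial_diagram_S H); apply: mem_nth. Qed.
Let nth_out v0 p : p < size S -> p != size s1 -> p != (size s1).+1 ->
  nth v0 S p \in s1 ++ s2.
Proof.
move=> lt pk pk1; rewrite nth_cat mem_cat; case: ltnP => h1; first by rewrite mem_nth.
have -> : p - size s1 = (p - (size s1).+2).+2 by lia.
by rewrite /= mem_nth ?orbT //; move: lt; rewrite size_cat /=; lia.
Qed.

Let nth_in v0 v : v \in s1 ++ s2 ->
  exists p, [/\ p < size S, p != size s1, p != (size s1).+1 & nth v0 S p = v].
Proof.
rewrite mem_cat => /orP[] /(nthP v0)[p hp <-].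
  exists p; rewrite nth_cat hp /S size_cat /=; move: hp; set z := size s1 => hp; split => //; lia.
exists (p + (size s1).+2); rewrite nth_cat.
have -> : (p + (size s1).+2 < size s1) = false by lia.
have -> : p + (size s1).+2 - size s1 = p.+2 by lia.
by move: hp; rewrite /S size_cat /=; set z := size s1; set z2 := size s2 => hp; split => //; lia.
Qed.

(** The -1 marker makes {t, l} a component of its own and merges those of [x] and [h], as expressed
    by [T2] and [C2]. If [f] already joins the two places, their component has no other end on the
    frontier, so it closes up and is counted. *)
Lemma partial_diagram_minus e' : e' =2 add_edge t l (add_edge x h e) ->
  partial_diagram e' act' S' (cupcap (size s1) f) (c + (f (size s1) == (size s1).+1)).
Proof.
move=> eE; set k := size s1.
pose T2 u := (u == t) || (u == l).
have Tt : T2 t by rewrite /T2 eqxx.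
have Tl : T2 l by rewrite /T2 eqxx orbT.
have Ta u : u \in act -> T2 u = false by move=> ua; rewrite /T2 nt ?nl.
pose C2 u v := [|| connect e u v, connect e u x && connect e h v | connect e u h && connect e x v].
have sym' : symmetric e'.
  by move=> u v; rewrite !eE /add_edge (partial_diagram_sym H); do !case: eqP => //= _; rewrite ?orbT.
have es' := sym_connect_sym sym'.
have sub : subrel (connect e) (connect e').
  by apply: connect_sub => u v euv; apply: connect1; rewrite eE /add_edge euv !orbT.
have ctl : connect e' t l by apply: connect1; rewrite eE /add_edge !eqxx.
have cxh : connect e' x h by apply: connect1; rewrite eE /add_edge !eqxx !orbT.
have cE u v : connect e' u v = if T2 u then T2 v else ~~ T2 v && C2 u v.
  apply/idP/idP => [|cr]; last first.
    case: ifP cr => [/orP[]/eqP-> /orP[]/eqP->|_ /andP[_ /or3P[c1|/andP[c1 c2]|/andP[c1 c2]]]] //.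
    - by rewrite es'.
    - exact: sub.
    - exact: connect_trans (connect_trans (sub _ _ c1) cxh) (sub _ _ c2).
    by apply: connect_trans (connect_trans (sub _ _ c1) _) (sub _ _ c2); rewrite es'.
  apply: (connect_min (r := fun u v => if T2 u then T2 v else ~~ T2 v && C2 u v)) => [w|a b d ab].
    by case: ifP => // ->; rewrite /C2 connect0.
  rewrite eE => /or3P[/andP[/eqP eb /eqP ed]|/andP[/eqP eb /eqP ed]|].
  - by move: ab; rewrite eb ed Tt Tl; case: ifP.
  - by move: ab; rewrite eb ed Tt Tl; case: ifP.
  case/or3P => [/andP[/eqP eb /eqP ed]|/andP[/eqP eb /eqP ed]|ebd].
  - move: ab; rewrite eb ed (Ta x) // (Ta h) //; case: ifP => //= _.
    by rewrite /C2 connect0; case/or3P => [->|/andP[-> _]|/andP[-> _]]; rewrite ?connect0 ?orbT.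
  - move: ab; rewrite eb ed (Ta x) // (Ta h) //; case: ifP => //= _.
    by rewrite /C2 connect0; case/or3P => [->|/andP[-> _]|/andP[-> _]]; rewrite ?connect0 ?orbT.
  move: ab; rewrite (Ta b (partial_diagram_act H ebd)) (Ta d (act2 ebd)); case: ifP => //= _.
  have tr w : connect e w b -> connect e w d by move=> cw; apply: connect_trans cw (connect1 ebd).
  by rewrite /C2; case/or3P => [/tr ->|/andP[-> /tr ->]|/andP[-> /tr ->]]; rewrite ?orbT.
have fk := partial_diagram_f H; have fS := fun p => mtK f p.
have conn v0 p q : p < size S -> q < size S ->
    connect e (nth v0 S p) (nth v0 S q) = (q == p) || (q == f p) by exact: (partial_diagram_conn H).
have k1 : k < size S by apply: ltn_trans szk.
have cx v0 p : p < size S -> connect e (nth v0 S p) x = (k == p) || (k == f p).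
  by move=> hp; rewrite -(nthx v0) conn.
have ch v0 p : p < size S -> connect e (nth v0 S p) h = (k.+1 == p) || (k.+1 == f p).
  by move=> hp; rewrite -(nthh v0) conn.
split.
- exact: sym'.
- move=> u v; rewrite eE => /or3P[/andP[/eqP -> _]|/andP[/eqP -> _]|/or3P[/andP[/eqP -> _]|/andP[/eqP -> _]|/(partial_diagram_act H) ua]];
  by rewrite !inE ?eqxx ?xa ?ha ?ua ?orbT.
- move=> u; rewrite mem_cat !inE => /or4P[us|/eqP->|/eqP->|us]; rewrite ?eqxx ?orbT //;
  by rewrite (partial_diagram_S H) ?orbT // mem_cat ?inE us ?orbT.
- move=> p; rewrite sS joinE /join_fun => hp.
  by do !case: ifP => _ //; apply: fk.
- move=> v0 p q; rewrite sS => hp hq; rewrite cE !nthS' joinE /join_fun.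
  have T2n i : i < size S -> T2 (if i == k then l else if i == k.+1 then t else nth v0 S i)
       = (i == k) || (i == k.+1).
    move=> hi; case: (eqVneq i k) => //= _; case: (eqVneq i k.+1) => //= _.
    by rewrite Ta // nthact.
  rewrite !T2n //.
  case: (eqVneq p k) => [->|pk] /=; first by rewrite orbC.
  case: (eqVneq p k.+1) => [->|pk1] /=; first by rewrite ?eqxx ?orbT orbC.
  case: (eqVneq q k) => [->|qk] /=.
    have a1 := mtK f k; have a2 := mtK f k.+1; have a3 := mtK f p.
    have a4 := @mt_neq f k; have a5 := @mt_neq f k.+1; move/eqP: pk pk1 => pk /eqP pk1.
    by eqcases.
  case: (eqVneq q k.+1) => [->|qk1] /=.
    have a1 := mtK f k; have a2 := mtK f k.+1; have a3 := mtK f p.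
    have a4 := @mt_neq f k; have a5 := @mt_neq f k.+1; move/eqP: pk pk1 => pk /eqP pk1.
    by eqcases.
  rewrite /C2 conn // cx // ch // ![connect e _ (nth _ _ q)]es cx // ch //.
  have a1 := mtK f k; have a2 := mtK f k.+1; have a3 := mtK f p; have a6 := mtK f q.
  have a4 := @mt_neq f k; have a5 := @mt_neq f k.+1; move/eqP: pk pk1 => pk /eqP pk1.
  move/eqP: qk qk1 => qk /eqP qk1.
  by eqcases.
have hasE u : u \in act -> has (connect e' u) S' = has (C2 u) (s1 ++ s2).
  move=> ua; rewrite !has_cat /= !cE Ta // Tl Tt /=; congr (_ || _).
    by apply: eq_in_has => v vs; rewrite cE !Ta // (partial_diagram_S H) // mem_cat vs.
  by apply: eq_in_has => v vs; rewrite cE !Ta // (partial_diagram_S H) // mem_cat !inE vs !orbT.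
have T2S u : T2 u -> has (connect e' u) S'.
  move=> Tu; apply/hasP; exists t; first by rewrite mem_cat !inE eqxx !orbT.
  by rewrite cE Tu.
have sub12 v : v \in s1 ++ s2 -> v \in S.
  by rewrite !mem_cat !inE => /orP[->|->]; rewrite ?orbT.
have clsE u : u \in act -> (connect e u x -> connect e x h) -> (connect e u h -> connect e x h) ->
    component e' u = component e u.
  move=> ua ux uh; apply/setP => v; rewrite !inE cE Ta //.
  case: (boolP (T2 v)) => [Tv|Tv] /=.
    by apply/esym/negbTE/negP => /cact; rewrite ua => /esym /Ta; rewrite Tv.
  rewrite /C2; apply/idP/idP => [|-> //].
  case/or3P => [//|/andP[c1 c2]|/andP[c1 c2]].
    by apply: connect_trans (connect_trans c1 (ux c1)) c2.
  have c3 : connect e h x by rewrite es uh.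
  exact: connect_trans c1 (connect_trans c3 c2).
have actT u : u \in act' -> ~~ has (connect e' u) S' -> u \in act.
  rewrite !inE => /or3P[/eqP->|/eqP->|//]; first by rewrite T2S.
  by rewrite T2S.
have act'a u : u \in act -> u \in act' by rewrite !inE => ->; rewrite !orbT.
rewrite -(partial_diagram_loops H).
have chx : connect e x h = (f k == k.+1).
  rewrite -{1}(nthx x) -(nthh x) conn //.
  by rewrite eq_sym [f k == _]eq_sym; have /eqP/negbTE-> := @n_neqSn k.
have [fkk|fkk] := eqVneq (f k) k.+1.
  have hx u : u \in act -> has (connect e' u) S' = has (connect e u) (s1 ++ s2).
    move=> ua; rewrite hasE //; apply: eq_has => v; rewrite /C2.
    apply/idP/idP => [|-> //]; rewrite fkk eqxx in chx.
    case/or3P => [//|/andP[c1 c2]|/andP[c1 c2]].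
      by apply: connect_trans (connect_trans c1 chx) c2.
    have c3 : connect e h x by rewrite es.
    exact: connect_trans c1 (connect_trans c3 c2).
  have xout : ~~ has (connect e x) (s1 ++ s2).
    apply/hasPn => v /(nth_in x)[p [hp pk pk1 <-]].
    by rewrite -[X in connect e X](nthx x) conn // fkk (negbTE pk) (negbTE pk1).
  rewrite addn1.
  have -> : [set component e' u | u in [pred u in act' | ~~ has (connect e' u) S']] =
     component e x |: [set component e u | u in [pred u in act | ~~ has (connect e u) S]].
    apply/setP => X; rewrite in_setU1; apply/imsetP/orP.
      case=> u /andP[ua']; move=> uS; have ua := actT u ua' uS.
      move: uS; rewrite hx // => uS ->; rewrite clsE ?chx ?fkk ?eqxx //.
      case: (boolP (connect e u x)) => ux; first by left; rewrite componentP.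
      right; apply/imsetP; exists u => //; rewrite inE /= ua /=.
      move: uS; rewrite !has_cat /= !negb_or => /andP[-> ->]; rewrite ux /= andbT.
      apply: contra ux => uh; apply: connect_trans uh _; rewrite es chx fkk eqxx //.
    case=> [/eqP ->|/imsetP[u /andP[ua uS] ->]].
      exists x; last by rewrite clsE ?chx ?fkk ?eqxx.
      by rewrite inE /= act'a // hx.
    exists u; last by rewrite clsE ?chx ?fkk ?eqxx.
    rewrite inE /= act'a // hx //; move: uS; rewrite !has_cat /= !negb_or.
    by case/and4P => -> _ _ ->.
  rewrite cardsU1; case: imsetP => [[u /andP[ua uS] /eqP]|_]; last by rewrite addnC addn1.
  by rewrite componentP // => xu; case/hasP: uS; exists x => //; rewrite es.
rewrite addn0; congr #|pred_of_set _|.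
have hx u : u \in act -> has (connect e' u) S' = has (connect e u) S.
  move=> ua; rewrite hasE //; apply/hasP/hasP => -[v vs].
    case/or3P => [c1|/andP[c1 _]|/andP[c1 _]]; [exists v|exists x|exists h] => //.
    exact: sub12.
  move: vs; rewrite mem_cat !inE => /or4P[vs|/eqP->|/eqP->|vs] cv.
  - by exists v; rewrite ?mem_cat ?vs // /C2 cv.
  (* The place of [x] is lost, but its component still reaches the frontier at the mate of that
     place. *)
  - exists (nth x S (f k)).
      by apply: nth_out; rewrite ?fk //; apply/eqP/mt_neq.
    rewrite /C2 (connect_trans cv) // -{1}(nthx x) conn ?fk //; by rewrite eqxx orbT.
  - exists (nth x S (f k.+1)).
      apply: nth_out; rewrite ?fk //; last by apply/eqP/mt_neq.
      by apply: contra fkk => /eqP e1; have := mtK f k.+1; rewrite [f k.+1]e1 => ->.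
    rewrite /C2 (connect_trans cv) // -{1}(nthh x) conn ?fk //; by rewrite eqxx orbT.
  by exists v; rewrite ?mem_cat ?vs ?orbT // /C2 cv.
have ccl u : u \in act -> ~~ has (connect e u) S -> component e' u = component e u.
  move=> ua uS; apply: clsE => // cc; case/hasP: uS; [by exists x|by exists h].
apply/setP => X; apply/imsetP/imsetP => -[u /andP[ua uS] ->].
  have ua1 := actT u ua uS; rewrite hx // in uS.
  by exists u; rewrite ?ccl // inE /= ua1.
by exists u; rewrite ?ccl // inE /= hx // act'a.
Qed.
End Step.
End Frontier.

(** * Diagrams as programs and their state sums *)

Section Programs.
Variable I : finType.

(** One program has several readings: [proc] follows a single state, [eval] sums over all states by
    acting on functionals, and [expand] lists the outcomes at A = 1. The label of [Cross] says which
    marker of the state is consulted. *)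
Inductive instr : Type := Insert of nat | Cross of nat & I.
Implicit Types (p : seq instr) (s : I -> bool) (z : matching * nat).

Fixpoint proc s p z : matching * nat :=
  match p with
  | [::] => z
  | Insert k :: p' => proc s p' (ins k z.1, z.2)
  | Cross k x :: p' =>
      proc s p' (if s x then z else (cupcap k z.1, z.2 + (z.1 k == k.+1)))
  end.

Fixpoint crossings p : seq I :=
  match p with
  | [::] => [::]
  | Insert k :: p' => crossings p'
  | Cross k x :: p' => x :: crossings p'
  end.

Lemma crossings_cat p q : crossings (p ++ q) = crossings p ++ crossings q.
Proof. by elim: p => [|[k|k x] p IH] //=; rewrite IH. Qed.

Lemma proc_cat s p q z : proc s (p ++ q) z = proc s q (proc s p z).
Proof. by elim: p z => [|[k|k x] p IH] z //=. Qed.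

Lemma proc_eq s s' p z : {in crossings p, s =1 s'} -> proc s p z = proc s' p z.
Proof.
elim: p z => [|[k|k x] p IH] z e //=; first exact: IH.
by rewrite e ?mem_head //; apply: IH => y yp; apply: e; rewrite inE yp orbT.
Qed.

Lemma proc_add s p f c : proc s p (f, c) = ((proc s p (f, 0)).1, c + (proc s p (f, 0)).2).
Proof.
elim: p f c => [|[k|k x] p IH] f c /=; first by rewrite addn0.
  exact: IH.
case: (s x); first exact: IH.
by rewrite IH [in RHS]IH /= add0n addnA.
Qed.

Section Eval.
Variables (R : comNzRingType) (A Ai : R).
Local Open Scope ring_scope.
Implicit Types (phi : matching -> R).

Fixpoint eval p phi : matching -> R :=
  match p with
  | [::] => phi
  | Insert k :: p' => insF k (eval p' phi)
  | Cross k x :: p' => crossF A Ai k (eval p' phi)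
  end.

Lemma eval_cat p q phi : eval (p ++ q) phi = eval p (eval q phi).
Proof. by elim: p => [|[k|k x] p IH] //=; rewrite IH. Qed.

Definition state_term p phi f (s : {ffun I -> bool}) : R :=
  A ^+ count s (crossings p) * Ai ^+ count (predC s) (crossings p) *
  loop_value A Ai ^+ (proc s p (f, 0%N)).2 * phi (proc s p (f, 0%N)).1.

(** States are frozen at -1 off the crossings of [p], so that every choice of markers is counted
    once. The induction splits the sum by the marker of the first crossing. *)
Lemma eval_partial p phi f : uniq (crossings p) ->
  eval p phi f = \sum_(s : {ffun I -> bool} | [forall x, (x \notin crossings p) ==> ~~ s x])
                   state_term p phi f s.
Proof.
elim: p f => [|[k|k x] p IH] f up /=.
- rewrite (big_pred1 [ffun=> false]) => [|s].
    by rewrite /state_term /= !expr0 !mul1r.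
  apply/forallP/eqP => [h|-> x]; last by rewrite ffunE.
  by apply/ffunP => x; rewrite ffunE; apply/negbTE/h.
- by rewrite /insF IH.
case/andP: up => xp up; rewrite /crossF /cupcapF !IH // [in RHS](bigID (fun s : {ffun I -> bool} => s x)) /=.
rewrite mulrA !mulr_sumr; congr (_ + _).
  (* The states with +1 at [x] correspond to those frozen at -1 there by resetting this one
     marker. *)
  pose h (s : {ffun I -> bool}) := [ffun y => if y == x then true else s y].
  pose h' (s : {ffun I -> bool}) := [ffun y => if y == x then false else s y].
  rewrite [RHS](reindex_onto h h') /=; last first.
    move=> s /andP[_ sx]; apply/ffunP => y; rewrite !ffunE.
    by case: eqP => [->|] //; rewrite sx.
  apply: eq_big => [s|s /forallP sQ].
    apply/forallP/idP => [sQ|/andP[/andP[/forallP sQ _] /eqP hs] y].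
      apply/andP; split; last first.
        apply/eqP/ffunP => y; rewrite !ffunE; case: eqP => [->|] //.
        by apply/esym/negbTE; have := sQ x; rewrite xp.
      rewrite ffunE eqxx andbT; apply/forallP => y; rewrite ffunE inE negb_or.
      by case: eqP => //= _; apply: sQ.
    apply/implyP => yp; have := sQ y; rewrite inE negb_or yp ffunE andbT.
    by case: eqP => //= -> _; rewrite -hs !ffunE eqxx.
  have e : {in crossings p, s =1 h s}.
    by move=> y yp; rewrite ffunE; case: eqP => // e; rewrite -e yp in xp.
  rewrite /state_term /= ffunE eqxx /= add0n add1n exprS (eq_in_count e).
  rewrite (@eq_in_count _ (predC s) (predC (h s))) => [|y yp]; last by rewrite /= (e y yp).
  rewrite (proc_eq _ e); ring.
apply: eq_big => [s|s /forallP sQ].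
  apply/forallP/idP => [sQ|/andP[/forallP sQ sx] y].
    apply/andP; split; last by have := sQ x; rewrite xp.
    by apply/forallP => y; apply/implyP; rewrite inE negb_or => /andP[_ yp]; have := sQ y; rewrite yp.
  by apply/implyP => yp; have [->|yx] := eqVneq y x; last have := sQ y; rewrite ?inE ?negb_or ?yx ?yp.
have sx : s x = false by apply/negbTE; have := sQ x; rewrite xp.
rewrite /state_term /= sx /= add0n add1n exprS add0n [in RHS]proc_add /= exprD.
by rewrite /weight_at; case: eqP => _; rewrite ?expr1 ?expr0; ring.
Qed.

Lemma eval_states p phi f : perm_eq (crossings p) (enum I) ->
  eval p phi f = \sum_(s : {ffun I -> bool})
     A ^+ #|[set x | s x]| * Ai ^+ #|[set x | ~~ s x]| *
     (loop_value A Ai ^+ (proc s p (f, 0%N)).2 * phi (proc s p (f, 0%N)).1).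
Proof.
move=> pe; rewrite eval_partial; last by rewrite (perm_uniq pe) enum_uniq.
apply: eq_big => [s|s _].
  by apply/forallP => x; rewrite (perm_mem pe) mem_enum.
rewrite /state_term !(permP pe) -mulrA; congr (_ ^+ _ * _ ^+ _ * _).
  by rewrite cardsE cardE -size_filter enumT.
by rewrite cardsE cardE -size_filter enumT.
Qed.

(** The rightmost crossing comes first: the horizontal line enters as a short arc on the right, and
    its left end moves leftwards over the vertical strands. *)
Fixpoint row (P : nat) (xs : seq I) : seq instr :=
  if xs is x :: xs' then rcons (row P.+1 xs') (Cross P x) else [::].

Lemma eval_row P xs phi : eval (row P xs) phi = crossesF A Ai P (size xs) phi.
Proof.
elim: xs P phi => [|x xs IH] P phi //.
by rewrite [size _]/= crossesFS /= -cats1 eval_cat /= IH.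
Qed.

End Eval.

Lemma crossings_row P xs : perm_eq (crossings (row P xs)) xs.
Proof.
elim: xs P => [|x xs IH] P //=; rewrite -cats1 crossings_cat /= cats1 perm_rcons perm_cons.
exact: IH.
Qed.

End Programs.

Lemma partial_diagram_ext (V : finType) (e e' : rel V) act S f c :
  e =2 e' -> partial_diagram e act S f c -> partial_diagram e' act S f c.
Proof.
move=> ee'; suff -> : e' = e by [].
apply: functional_extensionality => u; apply: functional_extensionality => v.
by rewrite ee'.
Qed.

(** The fresh segment [v] meets the frontier at both of its ends, hence occupies two places. *)
Lemma partial_diagram_ins (V : finType) (e : rel V) (act : {set V}) s1 s2 f c v :
  partial_diagram e act (s1 ++ s2) f c -> v \notin act ->
  partial_diagram e (v |: act) (s1 ++ v :: v :: s2) (ins (size s1) f) c.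
Proof.
move=> H va; set S := s1 ++ s2; set S' := s1 ++ _; set k := size s1.
have es : connect_sym e := sym_connect_sym (partial_diagram_sym H).
have sa w : w \in S -> w \in act by exact: (partial_diagram_S H).
have cv u : connect e v u = (u == v).
  apply/idP/eqP => [/connectP[[|y p] //= /andP[evy _]]|->]; last exact: connect0.
  by move/(partial_diagram_act H): evy va => ->.
have cv' u : u \in act -> connect e u v = false.
  by move=> ua; rewrite es cv; apply/eqP => uv; rewrite -uv ua in va.
have nS v0 y : nth v0 S' (up k y) = nth v0 S y.
  rewrite !nth_cat -/k /up; case: (ltnP y k) => hy; first by rewrite addn0 hy.
  have -> : (y + true.*2 < k) = false by lia.
  by have -> : y + true.*2 - k = (y - k).+2 by lia.
have nk v0 : nth v0 S' k = v by rewrite nth_cat ltnn subnn.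
have nk1 v0 : nth v0 S' k.+1 = v by rewrite nth_cat ltnNge leqnSn subSnn.
have szS' : size S' = (size S).+2 by rewrite !size_cat /= !addnS.
have szk : k <= size S by rewrite size_cat leq_addr.
have szu y : (up k y < size S') = (y < size S) by rewrite szS' /up; lia.
split.
- exact: (partial_diagram_sym H).
- by move=> u w /(partial_diagram_act H) ua; rewrite inE ua orbT.
- move=> u; rewrite mem_cat !inE => /or4P[us|->|->|us] //;
  by rewrite sa ?orbT // mem_cat us ?orbT.
- move=> p; case: (upP k p) => [->|->|[y ->]]; rewrite ?ins_k ?ins_Sk ?ins_up ?szu.
  + by rewrite szS'; lia.
  + by rewrite szS'; lia.
  exact: (partial_diagram_f H).
- have nu y : (k == up k y) = false by apply/eqP => /esym /up_neq.
  have nu1 y : (k.+1 == up k y) = false by apply/eqP => /esym /up_neqS.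
  have un y : (up k y == k) = false by apply/eqP/up_neq.
  have un1 y : (up k y == k.+1) = false by apply/eqP/up_neqS.
  move=> v0 p q; case: (upP k p) => [->|->|[y ->]]; case: (upP k q) => [->|->|[z ->]];
  rewrite ?ins_k ?ins_Sk ?ins_up ?szu ?nS ?nk ?nk1 => hp hq;
  rewrite ?connect0 ?eqxx ?orbT ?nu ?nu1 ?un ?un1 //.
  + by rewrite cv; apply/eqP => e0; move: va; rewrite -e0 sa ?mem_nth.
  + by rewrite cv; apply/eqP => e0; move: va; rewrite -e0 sa ?mem_nth.
  + by rewrite cv' ?sa ?mem_nth.
  + by rewrite cv' ?sa ?mem_nth.
  by rewrite (partial_diagram_conn H) // !(inj_eq (@up_inj k)).
rewrite -(partial_diagram_loops H); congr #|pred_of_set _|.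
have hasE u : u \in act -> has (connect e u) S' = has (connect e u) S.
  by move=> ua; rewrite !has_cat /= cv'.
apply/setP => X; apply/imsetP/imsetP => -[u /andP[ua uS] ->]; exists u => //.
- move: ua uS; rewrite !inE /= => /orP[/eqP->|ua].
    by case/hasP; exists v; rewrite ?mem_cat ?inE ?eqxx ?orbT ?cv.
  by rewrite ua -hasE.
by rewrite !inE /= ua orbT hasE.
Qed.

(** * Drawing the lattice row by row *)

Section StateSystem.
Variables (m n : nat) (s : kstate m n).
Notation V := (segment m n).
Notation crossing := ('I_m * 'I_n)%type.

Definition joined_by (X : seq crossing) : rel V :=
  fun u v => has (fun x => ((u, v) \in smoothing s x) || ((v, u) \in smoothing s x)) X.

Lemma joined_by_plus x X : s x ->
  joined_by (x :: X) =2 add_edge (top_of x) (right_of x) (add_edge (left_of x) (bot_of x) (joined_by X)).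
Proof.
move=> sx u v; rewrite /joined_by /= /smoothing sx !inE /add_edge !xpair_eqE.
by do !case: (@eq_op _ _ _) => //=.
Qed.

Lemma joined_by_minus x X : ~~ s x ->
  joined_by (x :: X) =2 add_edge (top_of x) (left_of x) (add_edge (bot_of x) (right_of x) (joined_by X)).
Proof.
move=> sx u v; rewrite /joined_by /= /smoothing (negbTE sx) !inE /add_edge !xpair_eqE.
by do !case: (@eq_op _ _ _) => //=.
Qed.

Fixpoint chain (xs : seq crossing) (h : V) : bool :=
  if xs is x :: xs' then (right_of x == head h [seq left_of y | y <- xs']) && chain xs' h
  else true.

Lemma partial_diagram_row xs s1 s2 h X (act : {set V}) f c : chain xs h ->
  uniq [seq top_of x | x <- xs] -> uniq [seq left_of x | x <- xs] ->
  (forall x, x \in xs -> (top_of x \notin act) && (left_of x \notin act)) ->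
  partial_diagram (joined_by X) act (s1 ++ [seq bot_of x | x <- xs] ++ h :: s2) f c ->
  let z := proc s (row (size s1) xs) (f, c) in
  partial_diagram (joined_by (xs ++ X))
    ([set v in [seq top_of x | x <- xs]] :|: [set v in [seq left_of x | x <- xs]] :|: act)
    (s1 ++ head h [seq left_of x | x <- xs] :: [seq top_of x | x <- xs] ++ s2) z.1 z.2.
Proof.
elim: xs s1 h => [|x xs IH] s1 h /=.
  by move=> _ _ _ _; rewrite !set_nil !set0U.
case/andP => /eqP rx ch /andP[tx ut] /andP[lx ul] fr H.
have {}IH := IH (rcons s1 (bot_of x)) h ch ut ul _.
have frx y : y \in xs -> (top_of y \notin act) && (left_of y \notin act).
  by move=> yx; apply: fr; rewrite inE yx orbT.
have := IH frx; rewrite -cats1 -catA => /(_ H); rewrite size_cat addn1.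
set act1 := _ :|: act; move=> {}IH.
have topE y : (top_of x == left_of y) = false by [].
have ta : top_of x \notin act1.
  rewrite !inE negb_or negb_or tx; have /andP[-> _] := fr x (mem_head _ _).
  by rewrite andbT; apply/mapP => -[].
have la : left_of x \notin act1.
  rewrite !inE negb_or negb_or lx; have /andP[_ ->] := fr x (mem_head _ _).
  by rewrite !andbT; apply/mapP => -[].
have tl : top_of x != left_of x by [].
have e : [set v in top_of x :: [seq top_of x | x <- xs]]
     :|: [set v in left_of x :: [seq left_of x | x <- xs]] :|: act
     = top_of x |: (left_of x |: act1).
  apply/setP => v; rewrite !inE -!orbA.
  by case: (v == top_of x); case: (v == left_of x); rewrite ?orbT.
rewrite e -cats1 proc_cat /=; move: IH.
rewrite -catA /= -rx; case: (proc _ _ _) => g d /= IH.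
case: ifP => sx.
  by apply: (partial_diagram_plus IH ta la tl) => u v; rewrite joined_by_plus.
apply: (partial_diagram_minus IH ta la tl) => u v; rewrite joined_by_minus ?sx //.
Qed.

End StateSystem.

Definition next_fun (x : nat) := x + (~~ odd x) - odd x.
Lemma next_funK : involutive next_fun. Proof. by move=> x; rewrite /next_fun; lia. Qed.
Lemma next_fun_neq x : next_fun x <> x. Proof. by rewrite /next_fun; lia. Qed.
Definition next : matching := Matching next_funK next_fun_neq.
Lemma noncrossing_next : noncrossing next. Proof. by move=> p q; rewrite /= /next_fun; lia. Qed.

(* [L(0, n)]: the arcs {k, 2n - 1 - k}, and [next] from [2n] on. *)
Fixpoint rain n : matching := if n is n'.+1 then ins n' (rain n') else next.

Lemma noncrossing_rain n : noncrossing (rain n).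
Proof. by elim: n => [|n IH] /=; [exact: noncrossing_next | apply/noncrossing_ins]. Qed.

Lemma rainE n p : p < n.*2 -> rain n p = n.*2.-1 - p.
Proof.
elim: n p => [|n IH] p //= hp.
case: (upP n p) hp => [->|->|[y ->]] hp.
- by rewrite -[LHS]/(ins n (rain n) n) ins_k; lia.
- by rewrite -[LHS]/(ins n (rain n) n.+1) ins_Sk; lia.
rewrite -[LHS]/(ins n (rain n) (up n y)) ins_up IH; move: hp; rewrite /up; lia.
Qed.

Section Whole.
Variables (m n : nat) (s : kstate m n).
Notation V := (segment m n).
Notation crossing := ('I_m * 'I_n)%type.

(** [l] counts the rows already drawn. Their left ends precede the [n] open vertical strands, so the
    next row enters at [l + n], just to the right of these strands. *)
Fixpoint prog (l : nat) (rs : seq 'I_m) : seq (instr crossing) :=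
  if rs is r :: rs' then
    Insert _ (l + n) :: row l [seq (r, j) | j <- enum 'I_n] ++ prog l.+1 rs'
  else [::].

Lemma prog_cat l rs rs' : prog l (rs ++ rs') = prog l rs ++ prog (l + size rs) rs'.
Proof.
elim: rs l => [|r rs IH] l /=; first by rewrite addn0.
by rewrite IH -catA addSnnS.
Qed.

(** The boundary of the part formed by the rows from [i] downwards, in the order of [clockwise], so
    that [frontier 0] lists the boundary points of the whole lattice. *)
Definition frontier i : seq V :=
  rev [seq inl (r, ord0) | r <- drop i (enum 'I_m)] ++
  [seq inr (inord i, j) | j <- enum 'I_n] ++
  [seq inl (r, ord_max) | r <- drop i (enum 'I_m)] ++
  rev [seq inr (ord_max, j) | j <- enum 'I_n].

Definition below i : {set V} :=
  [set v : V | match v with inl u => i <= u.1 | inr u => i <= u.1 end].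

(** Before any row is drawn, only the lowest vertical segments are present, each listed once as an
    upper and once as a lower end. *)
Lemma sys0 : partial_diagram (joined_by s [::]) (below m) (frontier m) (rain n) 0.
Proof.
have -> : frontier m = [seq inr (ord_max, j) | j <- enum 'I_n] ++ rev [seq inr (ord_max, j) | j <- enum 'I_n].
  rewrite /frontier drop_oversize ?size_enum_ord //=; congr (_ ++ _).
  by apply: eq_map => j; congr (inr (_, _)); apply/val_inj; rewrite /= inordK.
set T := [seq _ | j <- _].
have szT : size T = n by rewrite size_map size_enum_ord.
have uT : uniq T by rewrite map_inj_uniq ?enum_uniq // => a b [].
have c0 u v : connect (joined_by s [::]) u v = (u == v).
  apply/idP/eqP => [/connectP[[|y p] //= _ ->]|->] //; exact: connect0.
have nE v0 p : p < n.*2 -> nth v0 (T ++ rev T) p = nth v0 T (if p < n then p else n.*2.-1 - p).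
  move=> hp; rewrite nth_cat szT; case: ltnP => // h; rewrite nth_rev szT; last by lia.
  by congr nth; lia.
split=> //.
- move=> v; rewrite mem_cat mem_rev orbb => /mapP[j _ ->].
  by rewrite inE.
- by move=> p; rewrite size_cat size_rev szT => hp; rewrite rainE; lia.
- move=> v0 p q; rewrite size_cat size_rev szT addnn => hp hq.
  rewrite c0 !nE // rainE //.
  have -> : forall a b, a < n -> b < n -> (nth v0 T a == nth v0 T b) = (a == b).
    by move=> a b ha hb; rewrite nth_uniq ?szT.
  + by case: (ltnP p n); case: (ltnP q n); lia.
  + by case: (ltnP p n); lia.
  by case: (ltnP q n); lia.
apply/eqP; rewrite cards_eq0; apply/eqP/setP => X; rewrite inE; apply/negbTE/imsetP.
case=> -[[r j]|[r j]] /andP[]; rewrite inE /= => rm /hasPn h _.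
  by have := ltn_ord r; lia.
have : inr (r, j) \in T ++ rev T.
  rewrite mem_cat; apply/orP; left; have -> : r = ord_max.
    by apply/val_inj => /=; have := ltn_ord r; lia.
  by apply: map_f; rewrite mem_enum.
by move/h; rewrite connect0.
Qed.

Lemma chain_drop (r : 'I_m) i : i <= n ->
  let xs := [seq (r, j) | j <- drop i (enum 'I_n)] in
  let h : V := inl (r, ord_max) in
  chain xs h /\ head h [seq left_of x | x <- xs] = inl (r, inord i).
Proof.
move=> hi; have [k ->] : exists k, i = n - k by exists (n - i); lia.
elim: k => [|k [IH1 IH2]] /=.
  rewrite subn0 drop_oversize ?size_enum_ord //=; split => //.
  by congr (inl (_, _)); apply/ord_inj; rewrite inordK.
have [nk|kn] := leqP n k; first by have -> : n - k.+1 = n - k by lia.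
have hj : n - k.+1 < n by lia.
pose j : 'I_n := Ordinal hj.
have -> : drop (n - k.+1) (enum 'I_n) = j :: drop (n - k) (enum 'I_n).
  rewrite (drop_nth j) ?size_enum_ord //; congr (_ :: drop _ _); last by lia.
  by apply/ord_inj; rewrite nth_enum_ord.
rewrite /= IH1 IH2 andbT; split.
  by apply/eqP; congr (inl (_, _)); apply/ord_inj; rewrite inordK /= /fintype.bump /=; lia.
by congr (inl (_, _)); apply/ord_inj; rewrite inordK //=; lia.
Qed.

Lemma partial_diagram_prog k : k <= m -> exists X : seq crossing,
  (forall x, (x \in X) = (m - k <= x.1)) /\
  let z := proc s (prog 0 (rev (drop (m - k) (enum 'I_m)))) (rain n, 0) in
  partial_diagram (joined_by s X) (below (m - k)) (frontier (m - k)) z.1 z.2.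
Proof.
elim: k => [|k IH] km.
  exists [::]; rewrite subn0 drop_oversize ?size_enum_ord //; split; last exact: sys0.
  by move=> x; rewrite in_nil; have := ltn_ord x.1; lia.
have [X [XE]] := IH (ltnW km); cbv zeta.
have hr : m - k.+1 < m by lia.
pose r : 'I_m := Ordinal hr.
have rv : nat_of_ord r = m - k.+1 by [].
have dr : drop (m - k.+1) (enum 'I_m) = r :: drop (m - k) (enum 'I_m).
  rewrite (drop_nth r) ?size_enum_ord //; congr (_ :: drop _ _); last by lia.
  by apply/ord_inj; rewrite nth_enum_ord.
rewrite dr rev_cons -cats1 prog_cat size_rev size_drop size_enum_ord add0n proc_cat.
have -> : m - (m - k) = k by lia.
case: (proc s (prog 0 _) _) => f c /= H.
set E := drop (m - k) (enum 'I_m) in dr H *.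
have szE : size E = k by rewrite size_drop size_enum_ord; lia.
pose xs := [seq (r, j) | j <- enum 'I_n].
pose s1 : seq V := rev [seq inl (r0, ord0) | r0 <- E].
have sz1 : size s1 = k by rewrite size_rev size_map.
have botE : [seq bot_of x | x <- xs] = [seq inr (inord (m - k), j) | j <- enum 'I_n] :> seq V.
  rewrite -map_comp; apply: eq_map => j /=; congr (inr (_, _)); apply/val_inj.
  by rewrite /= inordK /fintype.bump /=; lia.
have topE : [seq top_of x | x <- xs] = [seq inr (inord (m - k.+1), j) | j <- enum 'I_n] :> seq V.
  rewrite -map_comp; apply: eq_map => j /=; congr (inr (_, _)); apply/val_inj.
  by rewrite /= inordK /=; lia.
pose R : V := inl (r, ord_max).
have Rn : R \notin below (m - k) by rewrite inE /=; lia.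
move: H; rewrite /frontier -/E -/s1 -botE catA => H.
have {}H := partial_diagram_ins H Rn; rewrite size_cat sz1 size_map size_map size_enum_ord in H.
rewrite -catA in H.
have [] := chain_drop r (leq0n n); rewrite drop0 -/xs -/R => ch hd0.
have hd : head R [seq left_of x | x <- xs] = inl (r, ord0).
  by rewrite hd0; congr (inl (_, _)); apply/ord_inj; rewrite inordK.
have u1 : uniq [seq top_of x | x <- xs].
  by rewrite topE map_inj_uniq ?enum_uniq // => a b [].
have u2 : uniq [seq left_of x | x <- xs].
  by rewrite -map_comp map_inj_uniq ?enum_uniq // => a b [e]; exact: ord_inj e.
have fr x : x \in xs -> (top_of x \notin R |: below (m - k)) && (left_of x \notin R |: below (m - k)).
  case/mapP => j _ ->; rewrite !inE /=; apply/andP; split; first by lia.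
  rewrite negb_or; apply/andP; split; last by lia.
  by apply/eqP => -[]; have := ltn_ord j; lia.
have := partial_diagram_row ch u1 u2 fr H.
rewrite sz1 hd topE cats0; cbv zeta => {}H.
exists (xs ++ X); split.
  move=> [r' j']; rewrite mem_cat XE /=.
  have -> : ((r', j') \in xs) = (r' == r).
    by apply/mapP/eqP => [[j _ [-> _]] //|->]; exists j'; rewrite ?mem_enum.
  by rewrite -(inj_eq val_inj) /=; lia.
have e1 : frontier (m - k.+1) = s1 ++ inl (r, ord0) :: [seq inr (inord (m - k.+1), j) | j <- enum 'I_n]
   ++ R :: [seq inl (r, ord_max) | r <- E] ++ rev [seq inr (ord_max, j) | j <- enum 'I_n].
  by rewrite /frontier dr /= rev_cons -cats1 -catA.
rewrite -e1 in H.
suff <- : [set v in [seq inr (inord (m - k.+1), j) | j <- enum 'I_n]]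
           :|: [set v in [seq left_of x | x <- xs]] :|: (R |: below (m - k)) = below (m - k.+1).
  exact: H.
apply/setP => -[[r' j']|[r' j']]; rewrite !inE /=.
  have -> : (inl (r', j') \in ([seq inr (inord (m - k.+1), j) | j <- enum 'I_n] : seq V)) = false.
    by apply/mapP => -[].
  have -> : (inl (r', j') \in ([seq left_of x | x <- xs] : seq V)) = (r' == r) && (j' < n).
    apply/mapP/andP => [[x /mapP[j _ ->] [-> ->]]|[/eqP -> hj]]; first by rewrite /= ltn_ord.
    exists (r, Ordinal hj); first by apply: map_f; rewrite mem_enum.
    by congr (inl (_, _)); apply/ord_inj.
  have -> : (inl (r', j') == R) = (r' == r) && (n <= j').
    rewrite [LHS]xpair_eqE; congr (_ && _); rewrite -(inj_eq val_inj) /=.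
    by have := ltn_ord j'; lia.
  by rewrite -!(inj_eq val_inj) /=; have := ltn_ord j'; lia.
have -> : (inr (r', j') \in ([seq inr (inord (m - k.+1), j) | j <- enum 'I_n] : seq V)) = (r' == m - k.+1 :> nat).
  apply/mapP/eqP => [[j _ [-> _]]|e]; first by rewrite inordK //; lia.
  exists j'; first by rewrite mem_enum.
  by congr (inr (_, _)); apply/ord_inj; rewrite inordK //; lia.
have -> : (inr (r', j') \in ([seq left_of x | x <- xs] : seq V)) = false.
  by apply/mapP => -[].
by rewrite /= ?orbF; lia.
Qed.

End Whole.

(** * From programs back to Catalan states and coefficients *)

Section StateProc.
Variables (m n : nat).
Notation M := ((m + n) + (m + n)).

Lemma frontier0 : frontier m n 0 = [seq end_segment p | p <- clockwise m n].
Proof.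
rewrite /frontier /clockwise /over_top !map_cat !map_rev drop0 -!catA.
congr (rev _ ++ (_ ++ (_ ++ rev _))); rewrite -[RHS]map_comp //.
by apply: eq_map => j /=; congr (inr (_, _)); apply/ord_inj; rewrite inordK.
Qed.

Definition outcome (s : kstate m n) : matching * nat :=
  proc s (prog n 0 (rev (enum 'I_m))) (rain n, 0).

Lemma partial_diagram_joined (s : kstate m n) :
  partial_diagram (joined s) setT [seq end_segment p | p <- clockwise m n] (outcome s).1 (outcome s).2.
Proof.
have [X [XE]] := partial_diagram_prog s (leqnn m); rewrite subnn drop0 frontier0 -/(outcome s) => H.
have e : joined_by s X =2 joined s.
  move=> u v; apply/hasP/existsP => [[x _ h]|[x h]]; exists x => //.
  by rewrite XE subnn.
apply: (partial_diagram_ext e); suff <- : below m n 0 = setT by [].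
by apply/setP => -[v|v]; rewrite !inE.
Qed.

Lemma state_connect (s : kstate m n) (p q : bpt m n) :
  connect (joined s) (end_segment p) (end_segment q)
  = (pos q == pos p) || (pos q == (outcome s).1 (pos p)).
Proof.
have H := partial_diagram_joined s.
have nE r : nth (end_segment p) [seq end_segment p | p <- clockwise m n] (pos r) = end_segment r.
  by rewrite (nth_map r) ?index_mem ?mem_clockwise // nth_index ?mem_clockwise.
by rewrite -(nE q) -{1}(nE p) (partial_diagram_conn H) // size_map index_mem mem_clockwise.
Qed.

Lemma state_loops (s : kstate m n) : closed_components s = (outcome s).2.
Proof.
have H := partial_diagram_joined s; have es := joined_connect_sym s.
rewrite /closed_components n_comp_component //; last first.
  apply: intro_closed => // u v euv; rewrite !inE; apply: contra => /existsP[p c].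
  by apply/existsP; exists p; apply: connect_trans (connect1 euv) c.
rewrite -(partial_diagram_loops H); congr #|pred_of_set _|; apply/setP => X.
have e u : has (connect (joined s) u) [seq end_segment p | p <- clockwise m n]
     = [exists p, connect (joined s) u (end_segment p)].
  apply/hasP/existsP => [[v /mapP[p _ ->] c]|[p c]]; first by exists p.
  by exists (end_segment p) => //; apply: map_f; rewrite mem_clockwise.
by apply/imsetP/imsetP => -[u uS ->]; exists u => //; move: uS; rewrite !inE e.
Qed.

Lemma posP x : x < M -> exists p : bpt m n, pos p = x.
Proof.
rewrite -(size_clockwise m n) => lt.
case E : (clockwise m n) => [|p0 t]; first by rewrite E in lt.
exists (nth p0 (clockwise m n) x); rewrite /pos index_uniq //; exact: uniq_clockwise.
Qed.

Lemma cat_catalan (C : Cat m n) : [/\ involutive C, forall p, C p != p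
  & forall p q, ~~ [&& pos p < pos q, pos q < pos (C p) & pos (C p) < pos (C q)]].
Proof. by apply/catalanP; case: C. Qed.

(* [K] is [C] read on positions, and trivial from [M] on. *)
Definition represents (C : Cat m n) (K : matching) : Prop :=
  (forall p, K (pos p) = pos (C p)) /\ (forall x, M <= x -> K x = next x).

Lemma cat_matching (C : Cat m n) : exists K : matching, represents C K.
Proof.
have [CK CN _] := cat_catalan C.
pose g x := nth (next x) [seq pos (C p) | p <- clockwise m n] x.
have gp p : g (pos p) = pos (C p).
  by rewrite /g (nth_map p) ?index_mem ?mem_clockwise // nth_index ?mem_clockwise.
have gM x : M <= x -> g x = next x.
  by move=> h; rewrite /g nth_default // size_map size_clockwise.
have gK : involutive g.
  move=> x; case: (ltnP x M) => [/posP[p <-]|h]; first by rewrite !gp CK.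
  by rewrite (gM x) // gM ?mtK //= /next_fun; lia.
have gN x : g x <> x.
  case: (ltnP x M) => [/posP[p <-]|h]; first by rewrite gp => /pos_inj /eqP; apply/negP.
  by rewrite gM //; apply: mt_neq.
by exists (Matching gK gN).
Qed.

Lemma represents_lt C K x : represents C K -> x < M -> K x < M.
Proof. by case=> h _ /posP[p <-]; rewrite h ltn_pos. Qed.

Lemma represents_noncrossing C K : represents C K -> noncrossing K.
Proof.
move=> RK; have [KC KM] := RK; have [CK CN CX] := cat_catalan C => p q.
case: (ltnP p M) => [lt|ge].
  have lt' := represents_lt RK lt; move=> /andP[pq qK].
  have [P eP] := posP lt; have [Q eQ] : exists Q : bpt m n, pos Q = q by apply: posP; lia.
  have c1 := CX P Q; have c2 := CX (C Q) P; rewrite CK in c2.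
  have Kp : K p = pos (C P) by rewrite -eP KC.
  have Kq : K q = pos (C Q) by rewrite -eQ KC.
  have n1 : pos (C Q) <> pos P.
    by move=> /pos_inj e; have := congr1 (fun r => pos (C r)) e; rewrite CK; lia.
  have n2 : pos (C Q) <> pos (C P).
    by move=> /pos_inj /(can_inj CK) e; move: pq; rewrite -eP -eQ e ltnn.
  lia.
have ge' : M <= p by []; rewrite (KM p) //= /next_fun; lia.
Qed.

Lemma realizesE (s : kstate m n) C K : represents C K ->
  realizes s C = [forall x : 'I_M, (outcome s).1 x == K x].
Proof.
move=> RK; have [KC KM] := RK; have [CK CN _] := cat_catalan C.
apply/idP/idP => [/forallP h|/agreeP h].
  apply/agreeP => x /posP[p <-]; rewrite KC.
  have /forallP/(_ (C p)) := h p; rewrite eqxx /state_arc state_connect.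
  move=> /eqP/andP[_ /orP[/eqP/pos_inj e|/eqP //]].
  by have := CN p; rewrite e eqxx.
apply/forallP => p; apply/forallP => q; rewrite /state_arc state_connect.
rewrite h ?ltn_pos // KC !(inj_eq (@pos_inj m n)) eq_sym [C p == q]eq_sym.
by case: (eqVneq q p) => [->|] /=; rewrite ?[p == C p]eq_sym ?(negbTE (CN p)).
Qed.
End StateProc.

Section Coefficient.
Variables (R : comNzRingType) (A Ai : R).
Variables (m n : nat).
Notation M := ((m + n) + (m + n)).
Local Open Scope ring_scope.

Lemma eval_prog (rs : seq 'I_m) phi : eval A Ai (prog n 0 rs) phi = latticeF A Ai n (size rs) (phi : matching -> R) :> (matching -> R).
Proof.
elim/last_ind: rs phi => [|rs r IH] phi //.
rewrite -cats1 prog_cat eval_cat IH cats1 size_rcons /=; congr (latticeF _ _ _ _ _).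
by rewrite cats0 eval_row size_map size_enum_ord add0n.
Qed.

Lemma crossings_prog l (rs : seq 'I_m) :
  perm_eq (crossings (prog n l rs)) [seq (r, j) | r <- rs, j <- enum 'I_n].
Proof.
elim: rs l => [|r rs IH] l //=.
by rewrite crossings_cat; apply: perm_cat; [exact: crossings_row | exact: IH].
Qed.

(** The bridge between the two views: expanding the action on functionals over markers gives the
    state sum, because [outcome] computes both the Catalan state and the number of closed
    components. *)
Lemma latticeF_states C (K : matching) : represents C K ->
  latticeF A Ai n m (agree R M K) (rain n) =
  \sum_(s : kstate m n | realizes s C)
    A ^+ #|[set x | s x]| * Ai ^+ #|[set x | ~~ s x]| * loop_value A Ai ^+ closed_components s.
Proof.
move=> RK; have -> : latticeF A Ai n m = latticeF A Ai n (size (rev (enum 'I_m))).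
  by rewrite size_rev size_enum_ord.
rewrite -eval_prog eval_states; last first.
  apply: uniq_perm; rewrite ?enum_uniq //.
    rewrite (perm_uniq (crossings_prog _ _)); apply: allpairs_uniq; rewrite ?rev_uniq ?enum_uniq //.
    by move=> [? ?] [? ?].
  move=> [r j]; rewrite (perm_mem (crossings_prog _ _)) mem_enum; apply/allpairsP.
  by exists (r, j); rewrite mem_rev !mem_enum.
rewrite [RHS]big_mkcond /=; apply: eq_bigr => s _.
rewrite (realizesE s RK) /agree -/(outcome s) -state_loops.
by case: ifP => _; rewrite ?mulr1 // !mulr0.
Qed.
End Coefficient.

Section CoeffA.
Local Open Scope ring_scope.

Lemma A_neq0 : A != 0.
Proof. by rewrite /A tofrac_eq0 polyX_eq0. Qed.

Lemma coeff_latticeF m n (C : Cat m n) (K : matching) : represents C K ->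
  coeff C = latticeF A A^-1 n m (agree _ ((m + n) + (m + n)) K) (rain n).
Proof.
move=> RK; rewrite (latticeF_states _ _ RK); apply: eq_bigr => s _.
rewrite /loop_value expfzDr ?A_neq0 // -exprnP exprVn -exprnN.
by rewrite exprVn.
Qed.
End CoeffA.

(** Removability in terms of positions: the short arcs at the places from [m - j0] to [m + n + j0]
    lie between [p] and [q], the others beyond them. Both ends of the chord drawn in row j0 + 1 can
    thus travel to [p] and [q] without meeting one. *)
Lemma coeff_core m n (C : Cat m.+1 n) (C' : Cat m n) (p q : bpt m.+1 n) (j0 : nat)
    (old : bpt m n -> bpt m.+1 n) :
  C p = q -> pos p < pos q -> pos p < m.+1 + n -> m < pos q -> pos q < m.+1 + n + m.+1 ->
  j0 <= m ->
  (forall u, u != p -> pos (C u) = (pos u).+1 -> (pos u).+1 < m.+1 + n ->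
     if m <= pos u + j0 then pos p < pos u /\ (pos u).+1 < pos q
     else (pos u).+1 < pos p \/ pos q < pos u) ->
  (forall u, u != p -> pos (C u) = (pos u).+1 -> m < pos u -> (pos u).+1 < m.+1 + n + m.+1 ->
     if pos u <= m + n + j0 then pos p < pos u /\ (pos u).+1 < pos q
     else (pos u).+1 < pos p \/ pos q < pos u) ->
  (forall r, pos (old r) = skip2 (pos p) (pos q) (pos r)) ->
  (forall r, C (old r) = old (C' r)) ->
  coeff C = (A ^ ((pos p)%:Z + (pos q)%:Z - (m + m + n).+1%:Z) * coeff C')%R.
Proof.
move=> Cp pq p1 q1 q2 jm Hy Hy' oldE oldC.
have [K RK] := cat_matching C; have [K' RK'] := cat_matching C'.
rewrite (coeff_latticeF RK) (coeff_latticeF RK').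
have [KC KM] := RK; have [KC' KM'] := RK'.
set P := pos p in Hy Hy' oldE pq p1 *; set Q := pos q in Hy Hy' oldE pq q1 q2 *.
have KP : K P = Q by rewrite /P KC Cp.
have AAi : (A * A^-1 = 1)%R by rewrite mulfV // A_neq0.
have pt x : x < m.+1 + n + (m.+1 + n) -> exists u : bpt m.+1 n, pos u = x by apply: posP.
have Ky k : K k = k.+1 -> k <> P -> k.+1 < m.+1 + n ->
    if m <= k + j0 then P < k /\ k.+1 < Q else k.+1 < P \/ Q < k.
  move=> Kk kP km; have [u eu] := pt k (ltac:(lia)).
  have := Hy u; rewrite -KC eu; apply => //.
  by apply/eqP => e; apply: kP; rewrite -eu e.
have Ky' k : K k = k.+1 -> k <> P -> m < k -> k.+1 < m.+1 + n + m.+1 ->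
    if k <= m + n + j0 then P < k /\ k.+1 < Q else k.+1 < P \/ Q < k.
  move=> Kk kP km km'; have [u eu] := pt k (ltac:(lia)).
  have := Hy' u; rewrite -KC eu; apply => //.
  by apply/eqP => e; apply: kP; rewrite -eu e.
have rem : removed P Q K K'.
  move=> x; case: (ltnP x (m + n + (m + n))) => [/posP[r <-]|h].
    by rewrite -oldE KC oldC oldE KC'.
  have e y : m + n + (m + n) <= y -> skip2 P Q y = y.+2 by rewrite /skip2; lia.
  rewrite e // KM; last lia.
  by rewrite KM' // e /= /next_fun; lia.
rewrite (latticeF_row AAi n (agree _ _ K) jm).
have -> : (m.+1 + n + (m.+1 + n) = (m + n + (m + n)).+2)%N by lia.
set M := m + n + (m + n).
have mv f : (chordF A A^-1 (m - j0) (n + j0.*2) (agree _ M.+2 K) f =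
  A ^ (P%:Z + Q%:Z - (m + m + n).+1%:Z) * chordF A A^-1 P (Q - P.+1) (agree _ M.+2 K) f)%R.
  (* The positions of the labels j0 + 1 on the left and on the right side. *)
  pose P0 := m - j0; pose Q0 := m.+1 + n + j0.
  have e1 : (chordF A A^-1 (m - j0) (n + j0.*2) (agree _ M.+2 K) f =
     A ^ (P%:Z - P0%:Z) * chordF A A^-1 P (Q0 - P.+1) (agree _ M.+2 K) f)%R.
    case: (leqP P0 P) => h.
      have -> : n + j0.*2 = (Q0 - P.+1) + (P - P0) by rewrite /Q0 /P0; lia.
      rewrite (@chordF_move_left _ A A^-1 P0).
      + have -> : (P%:Z - P0%:Z = (P - P0)%N%:Z)%R by lia.
        by congr (_ * chordF _ _ _ _ _ _)%R; lia.
      + by rewrite /P0; lia.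
      by move=> k hk Kk; have := Ky k Kk; case: (leqP m (k + j0)); rewrite /P0 in hk h; lia.
    have h' : Q0 - P.+1 = (n + j0.*2) + (P0 - P) by rewrite /Q0 /P0; lia.
    rewrite h' (@chordF_move_left _ A A^-1 P).
    + rewrite mulrA exprnP -expfzDr ?A_neq0 //.
      have -> : ((P%:Z - P0%:Z) + (P0 - P)%N%:Z = 0)%R by lia.
      by rewrite expr0z mul1r; congr (chordF _ _ _ _ _ _)%R; rewrite /P0; lia.
    + by rewrite /P0; lia.
    (* The hypotheses on short arcs exclude c itself. It is not short here, as its left end is below
       [m] and its right end above. *)
    move=> k hk Kk; have [kP|kP] := eqVneq k P.
      by move: Kk; rewrite kP KP /P0 in hk *; lia.
    by have := Ky k Kk; case: (leqP m (k + j0)); move/eqP: kP; rewrite /P0 in hk h; lia.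
  have e2 : (chordF A A^-1 P (Q0 - P.+1) (agree _ M.+2 K) f =
     A ^ (Q%:Z - Q0%:Z) * chordF A A^-1 P (Q - P.+1) (agree _ M.+2 K) f)%R.
    case: (leqP Q0 Q) => h.
      rewrite -(chordF_move_right AAi (t := Q - Q0)).
      + have -> : (Q%:Z - Q0%:Z = (Q - Q0)%N%:Z)%R by lia.
        by congr (_ * chordF _ _ _ _ _ _)%R; rewrite /Q0 in h *; lia.
      + by rewrite /M /Q0 in h *; lia.
      by move=> k hk Kk; have := Ky' k Kk; case: (leqP k (m + n + j0)); rewrite /Q0 in hk h; lia.
    have h' : Q0 - P.+1 = (Q - P.+1) + (Q0 - Q) by rewrite /Q0 in h *; lia.
    rewrite -(chordF_move_right AAi (d := Q - P.+1) (t := Q0 - Q)).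
    + rewrite h' mulrA exprnP -expfzDr ?A_neq0 //.
      have -> : ((Q%:Z - Q0%:Z) + (Q0 - Q)%N%:Z = 0)%R by lia.
      by rewrite expr0z mul1r.
    + by rewrite /M /Q0 in h *; lia.
    by move=> k hk Kk; have := Ky' k Kk; case: (leqP k (m + n + j0)); rewrite /Q0 in hk h; lia.
  rewrite e1 e2 mulrA -expfzDr ?A_neq0 //; congr (A ^ _ * _)%R.
  by rewrite /P0 /Q0; lia.
have -> : chordF A A^-1 (m - j0) (n + j0.*2) (agree _ M.+2 K) = fun f =>
  (A ^ (P%:Z + Q%:Z - (m + m + n).+1%:Z) * chordF A A^-1 P (Q - P.+1) (agree _ M.+2 K) f)%R.
  by apply: functional_extensionality.
rewrite latticeF_scale; congr (_ * _)%R.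
apply: latticeF_nceq; last exact: noncrossing_rain.
move=> f nf; apply: (chordF_straight AAi) => //; try by rewrite -?KP; lia.
  exact: represents_noncrossing RK.
by have -> : (P + (Q - P.+1)).+1 = Q by lia.
Qed.

(** * Matchings that are trivial beyond the boundary points *)

Definition standard M (f : matching) : Prop :=
  (forall x, x < M -> f x < M) /\ (forall x, M <= x -> f x = next x).

Lemma standard_eq M (f g : matching) : standard M f -> standard M g ->
  (forall x, x < M -> f x = g x) -> f = g.
Proof.
move=> [_ hf] [_ hg] e; apply: matching_eq => x.
by case: (ltnP x M) => h; [exact: e | rewrite hf // hg].
Qed.

Lemma standard_join M a b (ab : a <> b) f : a < M -> b < M -> standard M f -> standard M (join ab f).
Proof.
move=> aM bM [h1 h2]; split=> x hx; rewrite joinE /join_fun.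
  by do !case: ifP => _ //; apply: h1.
have fa := h1 a aM; have fb := h1 b bM.
have /eqP/negbTE-> : x <> a by lia.
have /eqP/negbTE-> : x <> b by lia.
have /eqP/negbTE-> : x <> f a by lia.
have /eqP/negbTE-> : x <> f b by lia.
exact: h2.
Qed.

(** An odd [M] would separate the pair {M - 1, M} of [next]. *)
Lemma standard_even M (f : matching) : standard M f -> ~~ odd M.
Proof.
case=> h1 h2; apply/negP => oM.
have M0 : M.-1 < M by lia.
have := h1 _ M0; have := h2 M (leqnn M); rewrite /= /next_fun => e.
have e1 : f M = M.-1 by lia.
by have := mtK f M; rewrite e1; lia.
Qed.

Lemma standard_ins M k f : k <= M -> standard M f -> standard M.+2 (ins k f).
Proof.
move=> kM sf; have [h1 h2] := sf; have ev := standard_even sf.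
split=> x; case: (upP k x) => [->|->|[y ->]]; rewrite ?ins_k ?ins_Sk ?ins_up; try lia.
  move=> h; have : y < M by move: h; rewrite /up; lia.
  by move/h1; rewrite /up; lia.
move=> h; have h' : M <= y by move: h; rewrite /up; lia.
have -> : up k y = y.+2 by rewrite /up; lia.
have e : k <= next y by rewrite /= /next_fun; lia.
by rewrite h2 // /up e /= /next_fun /= negbK; lia.
Qed.

Lemma standard_rain n : standard n.*2 (rain n).
Proof.
elim: n => [|n IH]; first by split.
by rewrite doubleS; apply: standard_ins IH; lia.
Qed.

(** * Pluecker products and realizability *)

Section Arcs.
Variables (R : Type) (idx : R) (op : Monoid.com_law idx).
Local Notation "x * y" := (op x y).

(** Stated over a commutative monoid because it serves both for the products of differences and for
    the sum of spans. *)
Definition arcs_big M (F : nat -> nat -> R) (f : nat -> nat) : R :=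
  \big[op/idx]_(0 <= p < M | p < f p) F p (f p).

Definition arc (F : nat -> nat -> R) a b := if a < b then F a b else F b a.

Definition arcs_big_off M (F : nat -> nat -> R) (s : seq nat) (f : nat -> nat) : R :=
  \big[op/idx]_(0 <= p < M | (p < f p) && (p \notin s)) F p (f p).

Lemma arcs_big2 M F (f : matching) a b : a < M -> f a < M -> b < M -> f b < M ->
  a <> b -> f a <> b ->
  arcs_big M F f = arc F a (f a) * (arc F b (f b) * arcs_big_off M F [:: a; b; f a; f b] f).
Proof.
move=> aM faM bM fbM ab fab.
have na := @mt_neq f a; have nb := @mt_neq f b.
have ffa := mtK f a; have ffb := mtK f b.
have fafb : f a <> f b by move/mt_inj.
have afb : a <> f b by move=> e; apply: fab; rewrite e mtK.
pose T p := if p < f p then F p (f p) else idx.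
have TE p : T p * T (f p) = arc F p (f p).
  have np := @mt_neq f p; rewrite /T /arc mtK.
  by case: ltngtP np => [h|h|h] np; rewrite ?Monoid.mulm1 ?Monoid.mul1m //; case: np.
set s := [:: a; b; f a; f b].
have us : uniq s.
  by rewrite /s /= !inE !negb_or !andbT; do !(apply/andP; split); apply/eqP; congruence.
have ps : perm_eq (index_iota 0 M) (s ++ [seq p <- index_iota 0 M | p \notin s]).
  apply: uniq_perm; first exact: iota_uniq.
    rewrite cat_uniq us filter_uniq ?iota_uniq // andbT.
    by apply/hasPn => x; rewrite mem_filter => /andP[].
  move=> x; rewrite mem_cat mem_filter; case: (boolP (x \in s)) => //= xs.
  rewrite mem_index_iota; move: xs; rewrite !inE.
  by case/or4P => /eqP->.
rewrite /arcs_big big_mkcond /= (perm_big _ ps) /= !big_cons.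
rewrite -/(T a) -/(T b) -/(T (f a)) -/(T (f b)).
have -> : arcs_big_off M F s f = \big[op/idx]_(p <- [seq p <- index_iota 0 M | p \notin s]) T p.
  rewrite /arcs_big_off big_filter big_mkcond [RHS]big_mkcond /=; apply: eq_bigr => p _.
  by rewrite /T andbC; case: (p \notin s).
rewrite -!TE -!Monoid.mulmA; congr (_ * _); exact: Monoid.mulmCA.
Qed.

Lemma rest_join M F a b (ab : a <> b) (f : matching) :
  arcs_big_off M F [:: a; b; f a; f b] (join ab f) = arcs_big_off M F [:: a; b; f a; f b] f.
Proof.
apply: congr_big => // p.
  rewrite joinE /join_fun !inE !negb_or; case: eqP; case: eqP; case: eqP; case: eqP;
  by rewrite /= ?andbF.
rewrite !inE !negb_or => /andP[_ /and4P[pa pb pfa pfb]].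
by rewrite joinE /join_fun !(negbTE pa, negbTE pb, negbTE pfa, negbTE pfb).
Qed.

Lemma arcs_big_join M F a b (ab : a <> b) (f : matching) : a < M -> f a < M -> b < M -> f b < M ->
  f a <> b ->
  arcs_big M F (join ab f) = arc F a b * (arc F (f a) (f b) * arcs_big_off M F [:: a; b; f a; f b] f).
Proof.
move=> aM faM bM fbM fab.
have na := @mt_neq f a; have nb := @mt_neq f b.
have ffa := mtK f a; have ffb := mtK f b.
have fafb : f a <> f b by move/mt_inj.
have afb : a <> f b by move=> e; apply: fab; rewrite e mtK.
have ja : join ab f a = b by rewrite joinE /join_fun eqxx.
have jfa : join ab f (f a) = f b.
  rewrite joinE /join_fun eqxx; have /eqP/negbTE-> := na.
  by have /eqP/negbTE-> := fab.
rewrite (@arcs_big2 M F (join ab f) a (f a)) ?ja ?jfa //; try by move/esym.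
congr (_ * (_ * _)).
rewrite -rest_join /arcs_big_off; apply: eq_bigl => p; rewrite !inE.
by case: (p == a); case: (p == b); case: (p == f a).
Qed.
End Arcs.

Definition swap k x := if x == k then k.+1 else if x == k.+1 then k else x.

Lemma swapK k : involutive (swap k).
Proof. by move=> x; rewrite /swap; eqcases; lia. Qed.

Lemma swap_id k x : x != k -> x != k.+1 -> swap k x = x.
Proof. by rewrite /swap => /negbTE-> /negbTE->. Qed.
Lemma swap_k k : swap k k = k.+1. Proof. by rewrite /swap eqxx. Qed.
Lemma swap_Sk k : swap k k.+1 = k.
Proof. by rewrite /swap eqxx; case: eqP => //; lia. Qed.

Lemma cross_funK k (f : matching) : involutive (fun x => swap k (f (swap k x))).
Proof. by move=> x; rewrite swapK mtK swapK. Qed.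
Lemma cross_fun_neq k (f : matching) x : swap k (f (swap k x)) <> x.
Proof. by move=> e; apply: (@mt_neq f (swap k x)); rewrite -[LHS](swapK k) e. Qed.

Definition cross k (f : matching) : matching := Matching (cross_funK k f) (@cross_fun_neq k f).

Lemma standard_cross k M f : k.+1 < M -> standard M f -> standard M (cross k f).
Proof.
move=> kM sf; have [h1 h2] := sf; have ev := standard_even sf; have lt x : (swap k x < M) = (x < M) by rewrite /swap; eqcases; lia.
split=> x hx; rewrite /=; first by rewrite lt h1 ?lt.
have xk : swap k x = x by rewrite swap_id; lia.
by rewrite xk h2 // swap_id //= /next_fun; lia.
Qed.

Section Pluecker.
Local Open Scope ring_scope.
Implicit Types (b : nat -> int) (f : matching).

(** A product of Pluecker coordinates: [b q - b p] is the minor of the columns (1, b p) and (1, b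
    q). Arcs are always read from left to right. *)
Definition arc_product M f b : int := arcs_big *%R M (fun p q => b q - b p) f.

(** Exchanging [k] and [k.+1] reverses no arc other than {k, k + 1}, so no sign appears. *)
Lemma arc_product_cross M k f b : (k.+1 < M)%N -> f k <> k.+1 ->
  arc_product M (cross k f) b = arc_product M f (b \o swap k).
Proof.
move=> kM fk; rewrite /arc_product /arcs_big.
have pe : perm_eq (index_iota 0 M) [seq swap k p | p <- index_iota 0 M].
  apply: uniq_perm; rewrite ?map_inj_uniq ?iota_uniq //; first exact: can_inj (swapK k).
  move=> x; rewrite -{2}(swapK k x) (mem_map (can_inj (swapK k))) !mem_index_iota /swap.
  by eqcases; lia.
rewrite (perm_big _ pe) /= big_map; apply: congr_big => // p; rewrite /= swapK //.
have fSk : f k.+1 <> k by move=> e; apply: fk; rewrite -{1}e mtK.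
have pfp := mtK f p; have np := @mt_neq f p; rewrite /swap.
by eqcases; lia.
Qed.

Lemma arc_product_ins M k f b : (k <= M)%N ->
  arc_product M.+2 (ins k f) b = (b k.+1 - b k) * arc_product M f (b \o up k).
Proof.
move=> kM; rewrite /arc_product /arcs_big.
have pe : perm_eq (index_iota 0 M.+2) (k :: k.+1 :: [seq up k p | p <- index_iota 0 M]).
  apply: uniq_perm; rewrite ?iota_uniq //=.
    rewrite map_inj_uniq ?iota_uniq ?andbT; last exact: up_inj.
    rewrite inE negb_or -andbA; apply/and3P; split; first by lia.
      by apply/mapP => -[y _ /esym /up_neq].
    by apply/mapP => -[y _ /esym /up_neqS].
  move=> x; rewrite mem_index_iota !in_cons; case: (upP k x) => [->|->|[y ->]].
  - by rewrite eqxx; lia.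
  - by rewrite eqxx orbT; lia.
  rewrite (mem_map (@up_inj k)) mem_index_iota.
  have /eqP/negbTE-> := @up_neq k y; have /eqP/negbTE-> := @up_neqS k y.
  by rewrite /up; lia.
rewrite (perm_big _ pe) big_cons big_cons big_map ins_k ins_Sk ltnSn ltnNge leqnSn.
under eq_bigl => p do rewrite ins_up; under eq_bigr => p _ do rewrite ins_up.
by congr (_ * _); apply: eq_bigl => p; rewrite /up; lia.
Qed.

(* The arcs at [k] and [k + 1] are distinct and do not cross. *)
Definition uncrossed k (f : matching) : bool :=
  [|| (f k.+1 < f k) && (f k < k), (f k < k) && (k.+1 < f k.+1)
    | (k.+1 < f k.+1) && (f k.+1 < f k)]%N.

Lemma noncrossing_uncrossed k f : noncrossing f -> f k <> k.+1 -> uncrossed k f.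
Proof.
move=> nf fk; have fSk : f k.+1 <> k by move=> e; apply: fk; rewrite -{1}e mtK.
have h1 := nf k k.+1; have h2 := nf (f k.+1) k; have h3 := nf (f k) (f k.+1).
have h4 := nf (f k.+1) (f k).
have n1 := @mt_neq f k; have n2 := @mt_neq f k.+1.
have e1 := mtK f k; have e2 := mtK f k.+1.
have n3 : f k <> f k.+1 by move/mt_inj; lia.
by rewrite /uncrossed; lia.
Qed.

(* Three-term Pluecker relation. *)
Lemma arc_product_cupcap M k f b : (k.+1 < M)%N -> (forall x, (x < M)%N -> (f x < M)%N) ->
  uncrossed k f -> arc_product M (cupcap k f) b = arc_product M f (b \o swap k) - arc_product M f b.
Proof.
move=> kM fM un; have k0M : (k < M)%N by lia.
have fk : f k <> k.+1 by move: un; rewrite /uncrossed; lia.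
have ne := @n_neqSn k; have h1 := fM k k0M; have h2 := fM k.+1 kM.
rewrite /arc_product arcs_big_join // !(@arcs_big2 _ _ _ M _ f k k.+1) //.
have -> : arcs_big_off *%R M (fun p q => (b \o swap k) q - (b \o swap k) p) [:: k; k.+1; f k; f k.+1] f
   = arcs_big_off *%R M (fun p q => b q - b p) [:: k; k.+1; f k; f k.+1] f.
  apply: eq_bigr => p; rewrite !inE !negb_or => /andP[_ /and4P[pk pk1 pfk pfk1]] /=.
  rewrite !swap_id //.
    by apply: contra pfk => /eqP <-; rewrite mtK.
  by apply: contra pfk1 => /eqP <-; rewrite mtK.
have fSk : f k.+1 <> k by move=> e; apply: fk; rewrite -{1}e mtK.
have n1 := @mt_neq f k; have n2 := @mt_neq f k.+1.
rewrite /arc /= swap_k swap_Sk (@swap_id k (f k)); [|by apply/eqP|by apply/eqP].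
rewrite (@swap_id k (f k.+1)); [|by apply/eqP|by apply/eqP].
rewrite ltnSn; case/or3P: un => h.
- have -> : (k < f k)%N = false by lia.
  have -> : (k.+1 < f k.+1)%N = false by lia.
  have -> : (f k < f k.+1)%N = false by lia.
  ring.
- have -> : (k < f k)%N = false by lia.
  have -> : (k.+1 < f k.+1)%N by lia.
  have -> : (f k < f k.+1)%N by lia.
  ring.
have -> : (k < f k)%N by lia.
have -> : (k.+1 < f k.+1)%N by lia.
have -> : (f k < f k.+1)%N = false by lia.
ring.
Qed.

Lemma arc_product_swap M k f b : (k.+1 < M)%N -> f k = k.+1 ->
  arc_product M f (b \o swap k) = - arc_product M f b.
Proof.
move=> kM /ins_ex[g ->].
have [M' eM] : exists M', M = M'.+2 by exists M.-2; lia.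
subst M; rewrite !arc_product_ins /= ?swap_k ?swap_Sk; try lia.
have -> : (b \o swap k) \o up k = b \o up k.
  apply: functional_extensionality => x /=; rewrite swap_id //; apply/eqP.
    exact: up_neq.
  exact: up_neqS.
ring.
Qed.

(** At A = 1 a crossing acts on arc products as an exchange of two variables. This also holds for an
    arc {k, k + 1}: the exchange changes the sign, and -1 - 1 is the loop value. *)
Lemma arc_product_nonc M k f b : (k.+1 < M)%N -> (forall x, (x < M)%N -> (f x < M)%N) -> noncrossing f ->
  weight_at (1 : int) 1 k f * arc_product M (cupcap k f) b = arc_product M f (b \o swap k) - arc_product M f b.
Proof.
move=> kM fM nf; rewrite /weight_at; case: eqP => fk.
  by rewrite cupcap_id // arc_product_swap // /loop_value; ring.
by rewrite mul1r arc_product_cupcap //; apply: noncrossing_uncrossed.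
Qed.
End Pluecker.

(** * Straightening a matching with crossings *)

Lemma crossing_ex M (f : matching) : standard M f -> ~ noncrossing f ->
  exists a c, [/\ a < c, c < f a, f a < f c & f c < M].
Proof.
move=> sf nf; have [h1 h2] := sf.
have [p nfp] := not_all_ex_not _ (fun p => forall q, p < q < f p -> p < f q < f p) nf.
have [q nfpq] := not_all_ex_not _ _ nfp; have [pq bad] := imply_to_and _ _ nfpq.
have pM : p < M.
  by case: (ltnP p M) => // h; move: pq; rewrite h2 //= /next_fun; lia.
have fpM := h1 p pM; have fqM := h1 q (ltac:(lia)).
have n1 : f q <> p by move=> e; have := mtK f q; rewrite e; lia.
have n2 : f q <> f p by move/mt_inj; lia.
have [lt|ge] := ltnP (f q) p.
  by exists (f q), p; rewrite mtK; split; lia.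
by exists p, q; split; lia.
Qed.

(* The total span of the arcs strictly decreases when a crossing is resolved either
   way, which makes [straighten] terminate. *)
Definition span M p q := (q - p) * (M - (q - p)).

Lemma span_sum1 M a b c d : a < b -> b < c -> c < d -> d < M ->
  span M a b + span M c d < span M a c + span M b d.
Proof.
move=> ab bc cd dM.
have [x ex] : exists x, b = a + x by exists (b - a); lia.
have [y ey] : exists y, c = b + y by exists (c - b); lia.
have [z ez] : exists z, d = c + z by exists (d - c); lia.
have [w ew] : exists w, M = d + w by exists (M - d); lia.
rewrite /span.
have -> : b - a = x by lia.
have -> : d - c = z by lia.
have -> : c - a = x + y by lia.
have -> : d - b = y + z by lia.
have -> : M - x = a + y + z + w by lia.
have -> : M - z = a + x + y + w by lia.
have -> : M - (x + y) = a + z + w by lia.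
have -> : M - (y + z) = a + x + w by lia.
nia.
Qed.

(** The two pairs of arcs have the same total length, so the decrease comes from the strict
    concavity of t (M - t). *)
Lemma span_sum2 M a b c d : a < b -> b < c -> c < d -> d < M ->
  span M a d + span M b c < span M a c + span M b d.
Proof.
move=> ab bc cd dM.
have [x ex] : exists x, b = a + x by exists (b - a); lia.
have [y ey] : exists y, c = b + y by exists (c - b); lia.
have [z ez] : exists z, d = c + z by exists (d - c); lia.
have [w ew] : exists w, M = d + w by exists (M - d); lia.
rewrite /span.
have -> : d - a = x + y + z by lia.
have -> : c - b = y by lia.
have -> : c - a = x + y by lia.
have -> : d - b = y + z by lia.
have -> : M - (x + y + z) = a + w by lia.
have -> : M - y = a + x + z + w by lia.
have -> : M - (x + y) = a + z + w by lia.
have -> : M - (y + z) = a + x + w by lia.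
nia.
Qed.

(** For crossing arcs with ends a < b < c < d the Pluecker relation reads (c - a)(d - b) = (b - a)(d
    - c) + (d - a)(c - b) in the variables at these places. Both terms have sign +, so a list
    without coefficients suffices. *)
Lemma straighten M (D : matching) : standard M D -> exists L : seq matching,
  (forall f, List.In f L -> noncrossing f /\ standard M f) /\
  forall b, (arc_product M D b = \sum_(f <- L) arc_product M f b)%R.
Proof.
have [N] := ubnP (arcs_big addn M (span M) D).
elim: N D => // N IH D DN sD; case: (classic (noncrossing D)) => nD.
  exists [:: D]; split=> [f [<-|[]]|b] //; by rewrite big_seq1.
have [a [b [ab bc cd dM]]] := crossing_ex sD nD.
have [h1 _] := sD.
have neab : a <> b by lia.
have nead : a <> D b by lia.
have bM : b < M by lia.
have aM : a < M by lia.
have cM : D a < M by lia.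
have s1 : standard M (join neab D) by apply: standard_join.
have s2 : standard M (join nead D) by apply: standard_join.
have rE (R : Type) (idx : R) (op : Monoid.com_law idx) F :
    arcs_big_off op M F [:: a; D b; D a; b] D = arcs_big_off op M F [:: a; b; D a; D b] D.
  apply: eq_bigl => p; rewrite !inE.
  by case: (p == a); case: (p == b); case: (p == D a); case: (p == D b).
have o : (a < b) * (a < D a) * (a < D b) * (b < D b) * (b < D a) * (D a < D b).
  by do !split; lia.
have o' : (D a < b = false) by lia.
have [L1 [L1P L1E]] : exists L : seq matching, (forall f, List.In f L -> noncrossing f /\ standard M f) /\
  forall b0, (arc_product M (join neab D) b0 = \sum_(f <- L) arc_product M f b0)%R.
  apply: IH => //; move: DN; rewrite arcs_big_join //; last by lia.
  rewrite (@arcs_big2 _ _ _ M _ D a b) //; last by lia.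
  rewrite /arc !o; have := @span_sum1 M a b (D a) (D b) ab bc cd dM; rewrite /=; lia.
have [L2 [L2P L2E]] : exists L : seq matching, (forall f, List.In f L -> noncrossing f /\ standard M f) /\
  forall b0, (arc_product M (join nead D) b0 = \sum_(f <- L) arc_product M f b0)%R.
  apply: IH => //; move: DN; rewrite arcs_big_join ?mtK //; last by lia.
  rewrite (@arcs_big2 _ _ _ M _ D a b) //; last by lia.
  rewrite rE /arc !o o'; have := @span_sum2 M a b (D a) (D b) ab bc cd dM; rewrite /=; lia.
exists (L1 ++ L2); split.
  by move=> f /List.in_app_iff[]; [apply: L1P | apply: L2P].
move=> b0; rewrite big_cat /= -L1E -L2E /arc_product.
rewrite !arcs_big_join ?mtK //; [|lia|lia].
rewrite (@arcs_big2 _ _ _ M _ D a b) //; last by lia.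
rewrite rE /arc !o o' /=; ring.
Qed.

(** * Linear independence of the noncrossing arc products *)

Definition weight M (f : nat -> nat) : nat := \sum_(0 <= p < M | f p < p) p.

Lemma sum_arcs M (f : matching) (g : nat -> nat) : standard M f ->
  \sum_(0 <= p < M) g p = \sum_(0 <= p < M | p < f p) (g p + g (f p)).
Proof.
move=> [h1 _]; rewrite (bigID (fun p => p < f p)) /= big_split /=; congr (_ + _).
have pe : perm_eq (index_iota 0 M) [seq f p | p <- index_iota 0 M].
  apply: uniq_perm; rewrite ?map_inj_uniq ?iota_uniq //; first exact: mt_inj.
  move=> x; rewrite -{2}(mtK f x) (mem_map (@mt_inj f)) !mem_index_iota.
  apply/idP/idP => /=; first exact: h1.
  by move/h1; rewrite mtK.
rewrite (perm_big _ pe) /= big_map; apply: eq_bigl => p; rewrite mtK.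
by have := @mt_neq f p; lia.
Qed.

(* An evaluation point of the arc products at which those of noncrossing matchings
   are unitriangular with respect to [weight]. *)
Definition closer (K : nat -> nat) : nat -> int := fun p => ((K p < p)%N%:R)%R.

(** At the first closing place q where the mates differ, the longer of the two arcs contains the
    other mate. That point opens an arc closing before q, where the matchings already agree, a
    contradiction. *)
Lemma closers_eq M (f g : matching) : standard M f -> standard M g -> noncrossing f -> noncrossing g ->
  (forall p, p < M -> (f p < p) = (g p < p)) -> f = g.
Proof.
move=> sf sg nf ng e; have [f1 _] := sf; have [g1 _] := sg.
have cl q : q < M -> f q < q -> f q = g q.
  elim/ltn_ind: q => q IH qM fq; have gq : g q < q by rewrite -e.
  have half (u v : matching) : (forall p, p < M -> (u p < p) = (v p < p)) -> noncrossing u ->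
      (forall p, p < q -> p < M -> u p < p -> u p = v p) -> u q < q -> v q < q -> u q < v q -> False.
    move=> euv nu IHu uq vq lt.
    have := nu (u q) (v q); rewrite mtK => /(_ (ltac:(lia))) h.
    have vM : v q < M by lia.
    have op : u (v q) < v q = false by rewrite euv // mtK; lia.
    have ne := @mt_neq u (v q).
    have := IHu (u (v q)); rewrite mtK => h2.
    have h3 : v q = v (u (v q)) by apply: h2; lia.
    by have := mt_inj h3; lia.
  case: (ltngtP (f q) (g q)) => // lt; exfalso.
    apply: (half f g) => // p pq pM fp; exact: IH.
  apply: (half g f) => // [p pM|p pq pM gp]; first by rewrite e.
  by apply/esym/IH; rewrite ?e.
apply: (standard_eq sf sg) => x xM; have [lt|ge] := ltnP (f x) x; first exact: cl.
have h : f x = g (g (f x)) by rewrite mtK.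
rewrite {1}h; congr (g _).
by rewrite -cl ?mtK //; [exact: f1 | have := @mt_neq f x; lia].
Qed.

(** A nonzero factor forces every arc of [f] to contain exactly one closing place of [K]. Since [f]
    closes at the larger end, its weight is at least that of [K], and equality gives the same
    closing places. *)
Lemma arc_product_closer_neq0 M (f K : matching) : standard M f -> standard M K -> noncrossing f -> noncrossing K ->
  (arc_product M f (closer K) != 0)%R ->
  weight M K < weight M f \/ f = K.
Proof.
move=> sf sK nf nK nz.
have two p : p < M -> p < f p -> (K (f p) < f p) != (K p < p).
  move=> pM lt; apply: contra nz => /eqP e.
  rewrite /arc_product /arcs_big big_mkcond (bigD1_seq p) ?mem_index_iota ?iota_uniq //= lt.
  by rewrite /closer e subrr mul0r.
pose g p := if K p < p then p else 0; pose h p := if f p < p then p else 0.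
have wK : weight M K = \sum_(p < M | p < f p) (g p + g (f p)).
  by rewrite /weight big_mkcond -/g (sum_arcs g sf) big_mkord.
have wf : weight M f = \sum_(p < M | p < f p) (h p + h (f p)).
  by rewrite /weight big_mkcond -/h (sum_arcs h sf) big_mkord.
have lif : weight M K <= weight M f ?= iff [forall (p : 'I_M | p < f p), K (f p) < f p].
  rewrite wK wf; apply: leqif_sum => p lt; have tw := two p (ltn_ord p) lt.
  rewrite /g /h mtK; apply/leqifP; move: tw; case: (ltnP (K (f p)) (f p)); case: (ltnP (K p) p);
  have -> : (f p < p) = false by lia.
  all: rewrite ?lt //=; try lia.
have [lt|ge] := ltnP (weight M K) (weight M f); first by left.
right; have /eqP : weight M K = weight M f by apply/eqP; rewrite eqn_leq ge lif.
rewrite lif => /forall_inP cl.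
apply: (closers_eq sf sK) => // p pM; have np := @mt_neq f p.
have [pfp|pfp] := ltnP p (f p).
  have := two p pM pfp; have -> := cl (Ordinal pM) pfp.
  by case: (ltnP (K p) p) => // _ _; lia.
have [f1 _] := sf; have lt : f p < p by lia.
have := cl (Ordinal (f1 p pM)); rewrite /= mtK lt => -> //.
Qed.

Lemma arc_product_closer_self M (K : matching) : (arc_product M K (closer K) = 1)%R.
Proof.
rewrite /arc_product /arcs_big big1 // => p pK; rewrite /closer mtK pK.
by have -> : (K p < p) = false by lia.
Qed.

Section Coef.
Local Open Scope ring_scope.
Implicit Types (L : seq (int * matching)) (K : matching).

(** A matching may occur several times in [L], with coefficients of both signs; this collects
    them. *)
Definition coef M L K : int := \sum_(c <- L) c.1 * agree int M K c.2.

Definition noncrossing_terms M L := forall c, List.In c L -> noncrossing c.2 /\ standard M c.2.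

Lemma big_In (I : Type) (L : seq I) (F G : I -> int) :
  (forall c, List.In c L -> F c = G c) -> \sum_(c <- L) F c = \sum_(c <- L) G c.
Proof.
elim: L => [|c L IH] e; first by rewrite !big_nil.
by rewrite !big_cons e ?IH //; [move=> d dL; apply: e; right | left].
Qed.

Definition agree_on M (f K : matching) : bool := [forall x : 'I_M, f x == K x].

Lemma agree_on_eq M f K : standard M f -> standard M K -> agree_on M f K -> f = K.
Proof. by move=> sf sK /agreeP; apply: standard_eq. Qed.

Lemma In_filter (I : Type) (a : pred I) (L : seq I) c : List.In c (filter a L) <-> List.In c L /\ a c.
Proof.
elim: L => [|d L IH] /=; first by split=> [|[]].
case: ifP => ad /=; rewrite IH; split; firstorder; subst; by rewrite ?ad in H0 *.
Qed.

(** The entries equal to the head contribute its collected coefficient times [psi]; they are then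
    deleted from the list. *)
Lemma sum_classes M L (psi : matching -> int) : noncrossing_terms M L ->
  (forall c, List.In c L -> psi c.2 != 0 -> coef M L c.2 = 0) ->
  \sum_(c <- L) c.1 * psi c.2 = 0.
Proof.
have [N] := ubnP (size L); elim: N L => // N IH [|c L'] sz ok h; first by rewrite big_nil.
set L := c :: L' in ok h *.
have cL : List.In c L by left.
have [_ sc] := ok c cL.
rewrite (bigID (fun d : int * matching => agree_on M d.2 c.2)) /=.
have -> : \sum_(d <- L | agree_on M d.2 c.2) d.1 * psi d.2 = psi c.2 * coef M L c.2.
  rewrite /coef mulr_sumr big_mkcond /=; apply: big_In => d /ok[_ sd].
  rewrite /agree -/(agree_on M d.2 c.2); case: ifP => [/(agree_on_eq sd sc) ->|_]; [rewrite mulr1; exact: mulrC | by rewrite !mulr0].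
have -> : psi c.2 * coef M L c.2 = 0.
  by case: (eqVneq (psi c.2) 0) => [->|/(h c cL) ->]; rewrite ?mul0r ?mulr0.
rewrite add0r -big_filter; apply: IH.
- rewrite /L /= /agree_on; have -> : [forall x : 'I_M, c.2 x == c.2 x] by apply/forallP.
  by rewrite /= size_filter; apply: leq_ltn_trans (count_size _ _) _.
- by move=> d /In_filter[dL _]; apply: ok.
move=> d /In_filter[dL nd] pd; rewrite -(h d dL pd) /coef big_filter big_mkcond /=.
apply: big_In => e eL; case: ifP => // /negbFE ec.
have [_ se] := ok e eL; have [_ sd] := ok d dL.
rewrite /agree -/(agree_on M e.2 d.2); case: (boolP (agree_on M e.2 d.2)) => [ed|_]; last by rewrite mulr0.
by rewrite -(agree_on_eq se sd ed) ec in nd.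
Qed.

(** Induction from heavy to light: evaluated at [closer K], the relation involves only [K], with
    value 1, and heavier matchings. [B] is a crude bound for the weights. *)
Lemma arc_product_indep M L : noncrossing_terms M L -> (forall b, \sum_(c <- L) c.1 * arc_product M c.2 b = 0) ->
  forall K, coef M L K = 0.
Proof.
move=> ok z; pose B := (M * M)%N.
have wB f : (weight M f <= B)%N.
  rewrite /weight big_mkcond /= big_mkord; apply: (@leq_trans (\sum_(p < M) M)).
    by apply: leq_sum => p _; case: ifP => // _; apply: ltnW.
  by rewrite sum_nat_const card_ord.
have main K : noncrossing K -> standard M K -> coef M L K = 0.
  have [N] := ubnP (B - weight M K); elim: N K => // N IH K KN nK sK.
  rewrite -(z (closer K)); apply/eqP; rewrite -subr_eq0 /coef -sumrB; apply/eqP.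
  pose psi f := agree int M K f - arc_product M f (closer K).
  transitivity (\sum_(c <- L) c.1 * psi c.2); first by apply: eq_bigr => c _; rewrite /psi mulrBr.
  apply: (sum_classes ok) => c cL; have [nc sc] := ok c cL; rewrite /psi => ps.
  case: (boolP (agree_on M c.2 K)) => [a|na].
    by move: ps; rewrite (agree_on_eq sc sK a) arc_product_closer_self /agree -/(agree_on M K K) -{1}(agree_on_eq sc sK a) a subrr eqxx.
  have nz : arc_product M c.2 (closer K) != 0.
    by apply: contra ps => /eqP ->; rewrite /agree -/(agree_on M c.2 K) (negbTE na) subrr.
  case: (arc_product_closer_neq0 sc sK nc nK nz) => [lt|e]; last first.
    by case/negP: na; rewrite e; apply/forallP.
  by apply: IH => //; have := wB c.2; lia.
move=> K; case: (classic (exists2 c, List.In c L & agree_on M c.2 K)) => [[c cL /agreeP a]|nc].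
  have [nn sc] := ok c cL; rewrite -(main c.2 nn sc); apply: eq_bigr => d _.
  congr (_ * (nat_of_bool _)%:R); apply: eq_forallb => x.
  by rewrite a.
rewrite /coef (@big_In _ L _ (fun=> 0)) ?big1 // => c cL.
rewrite /agree; case: (boolP [forall x : 'I_M, c.2 x == K x]) => [a|_]; last by rewrite mulr0.
by case: nc; exists c.
Qed.
End Coef.

(** * Positivity at A = 1 *)

Section Expand.
Local Open Scope ring_scope.
Variable I : finType.
Implicit Types (L : seq (int * matching)) (D K f : matching) (p : seq (instr I)).

Definition cupcaps k L := [seq (weight_at (1 : int) 1 k c.2 * c.1, cupcap k c.2) | c <- L].

Fixpoint expand p L : seq (int * matching) :=
  match p with
  | [::] => L
  | Insert k :: p' => expand p' [seq (c.1, ins k c.2) | c <- L]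
  | Cross k _ :: p' => expand p' (L ++ cupcaps k L)
  end.

Lemma expand_cat p q L : expand (p ++ q) L = expand q (expand p L).
Proof. by elim: p L => [|[k|k x] p IH] L /=. Qed.

Lemma expand_eval p L (phi : matching -> int) :
  \sum_(c <- expand p L) c.1 * phi c.2 = \sum_(c <- L) c.1 * eval 1 1 p phi c.2.
Proof.
elim: p L => [|[k|k x] p IH] L //=; rewrite IH.
  by rewrite big_map.
rewrite big_cat /cupcaps big_map /= -big_split /=; apply: eq_bigr => c _.
by rewrite /crossF /cupcapF /=; ring.
Qed.

(** Every crossing keeps both smoothings in the list, so the outcome of any state is among the
    listed terms. *)
Lemma expand_proc (s : I -> bool) p L c l : List.In c L ->
  exists2 d, List.In d (expand p L) & d.2 = (proc s p (c.2, l)).1.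
Proof.
have In_map (T U : Type) (g : T -> U) x (t : seq T) : List.In x t -> List.In (g x) (map g t).
  by elim: t => //= y t IH [->|/IH]; [left | right].
elim: p L c l => [|[k|k x] p IH] L c l cL /=; first by exists c.
  by apply: (IH _ (c.1, ins k c.2)); apply: (In_map _ _ (fun c : int * matching => (c.1, ins k c.2))).
case: (s x); first by apply: IH; apply/List.in_or_app; left.
apply: (IH _ (weight_at 1 1 k c.2 * c.1, cupcap k c.2)); apply/List.in_or_app; right.
exact: (In_map _ _ (fun c : int * matching => (weight_at 1 1 k c.2 * c.1, cupcap k c.2))).
Qed.

Lemma In_mapE (T U : Type) (g : T -> U) u (t : seq T) :
  List.In u (map g t) -> exists2 x, List.In x t & u = g x.
Proof.
elim: t => //= y t IH [<-|/IH[x xt ->]]; first by exists y; [left|].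
by exists x; [right|].
Qed.

(* [L] is the expansion, at A = 1, of the crossing matching [D]. *)
Record expands M L D : Prop := Expands {
  expands_ok : noncrossing_terms M L;
  expands_std : standard M D;
  expands_pf : forall b, \sum_(c <- L) c.1 * arc_product M c.2 b = arc_product M D b;
  expands_pos : forall c, List.In c L -> 0 < coef M L c.2 }.

(** Straightening [D] gives a second expansion, without signs. By independence it has the same
    collected coefficients. *)
Lemma coef_ge0 M L D : noncrossing_terms M L -> standard M D ->
  (forall b, \sum_(c <- L) c.1 * arc_product M c.2 b = arc_product M D b) -> forall K, 0 <= coef M L K.
Proof.
move=> ok sD E K; have [Ls [LsP LsE]] := straighten sD.
have := @arc_product_indep M (L ++ [seq (-1, f) | f <- Ls]) _ _ K.
rewrite /coef big_cat big_map /= => h.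
have {h}/eqP : \sum_(c <- L) c.1 * agree int M K c.2 + \sum_(f <- Ls) -1 * agree int M K f = 0.
  apply: h => [c /List.in_app_iff[cL|cL]|b]; first exact: ok.
    by have [f fL ->] := In_mapE cL; apply: LsP.
  by rewrite big_cat big_map /= E -mulr_sumr mulN1r -LsE subrr.
rewrite addr_eq0 -sumrN => /eqP ->; apply: sumr_ge0 => f _.
by rewrite mulN1r opprK ler0n.
Qed.

Lemma noncrossing_terms_cupcaps M k L : (k.+1 < M)%N -> noncrossing_terms M L -> noncrossing_terms M (cupcaps k L).
Proof.
move=> kM ok c cL; have [d dL ->] := In_mapE cL; have [nd sd] := ok d dL.
by split; [exact: noncrossing_cupcap | apply: standard_join => //; apply: ltnW].
Qed.

(** A total form of [join], which needs a proof of [a <> b]; the sums below run over [b]. *)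
Definition tjoin a b f : matching := if a =P b is ReflectF ab then join ab f else f.

Lemma tjoinE a b (ab : a <> b) f : tjoin a b f = join ab f.
Proof.
by rewrite /tjoin; case: eqP => // ab'; rewrite (proof_irrelevance _ ab' ab).
Qed.

Lemma tjoin_cupcap k f : f k <> k.+1 -> tjoin k (f k) (cupcap k f) = f.
Proof.
move=> fk; have na : k <> f k by move/esym/mt_neq.
have join_id a b (ab : a <> b) (g : matching) : g a = b -> join ab g = g.
  move=> ga; have gb : g b = a by rewrite -ga mtK.
  by apply: matching_eq => x; rewrite joinE /join_fun ga gb; eqcases.
have aux x (kx : k <> x) : f k = x -> x <> k.+1 -> join kx (cupcap k f) = f.
  move=> fx xk1; have xk : x <> k by move/esym.
  rewrite -[in RHS](join_id _ _ kx f fx) -[in LHS](join_id _ _ kx f fx).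
  by rewrite !(joinC kx xk) join_braid.
by rewrite tjoinE; apply: aux.
Qed.

Lemma cupcap_tjoin k b K : K k = k.+1 -> b <> k -> b <> k.+1 -> cupcap k (tjoin k b K) = K.
Proof.
move=> Kk bk bk1; have kb : k <> b by move/esym.
have ne : k.+1 <> k by lia.
rewrite tjoinE -[in RHS](cupcap_id Kk) -[in LHS](cupcap_id Kk) /cupcap.
by rewrite !(joinC (@n_neqSn k) ne) join_braid // => /esym.
Qed.

(** The preimages of [K] under the cup-cap are [K] itself, which closes a loop of value -2, and the
    matchings obtained from it by joining [k] to another point [b]. *)
Lemma cupcapF_agree M k K f : (k.+1 < M)%N -> standard M K -> standard M f -> K k = k.+1 ->
  cupcapF 1 1 k (agree int M K) f = - 2%:R * agree int M K f +
    \sum_(0 <= b < M | (b != k) && (b != k.+1)) agree int M (tjoin k b K) f.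
Proof.
move=> kM sK sf Kk; have k0M : (k < M)%N by apply: ltnW.
have off b : b <> k -> f k <> b -> agree int M (tjoin k b K) f = 0.
  move=> bk fb; rewrite /agree; case: (agreeP M (tjoin k b K) f) => // /(_ k k0M).
  have kb : k <> b by move/esym.
  by rewrite tjoinE joinE /join_fun eqxx.
rewrite /cupcapF; have [fk|/eqP fk] := eqVneq (f k) k.+1.
  rewrite cupcap_id // big1 ?addr0; last first.
    by move=> b /andP[/eqP bk /eqP bk1]; apply: off => //; rewrite fk => /esym.
  by rewrite /weight_at fk eqxx /loop_value; ring.
have -> : weight_at 1 1 k f = 1 :> int by rewrite /weight_at; case: eqP.
have -> : agree int M K f = 0.
  by rewrite /agree; case: (agreeP M K f) => // /(_ k k0M); rewrite Kk.
rewrite mul1r mulr0 add0r big_mkcond /= (bigD1_seq (f k)) ?iota_uniq //=; last first.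
  by rewrite mem_index_iota; have [-> //] := sf.
rewrite [X in _ + X]big1 ?addr0; last first.
  move=> b /eqP bf; case: ifP => // /andP[/eqP bk _]; apply: off => // e.
  by apply: bf; rewrite e.
have nk := @mt_neq f k; have -> : (f k != k) && (f k != k.+1) by apply/andP; split; apply/eqP.
have kfk : k <> f k by move/esym.
have fkM : (f k < M)%N by have [-> //] := sf.
have sc : standard M (cupcap k f) by apply: standard_join.
have st : standard M (tjoin k (f k) K) by rewrite tjoinE; apply: standard_join.
rewrite /agree -/(agree_on M (cupcap k f) K) -/(agree_on M f (tjoin k (f k) K)); congr (nat_of_bool _)%:R.
apply/idP/idP => [/(agree_on_eq sc sK) e|/(agree_on_eq sf st) e].
  by rewrite -e tjoin_cupcap //; apply/forallP.
by rewrite {1}e cupcap_tjoin //; apply/forallP.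
Qed.

Lemma coef_cupcaps M k L f K : (k.+1 < M)%N -> noncrossing_terms M L -> standard M f -> standard M K -> K = cupcap k f ->
  f k <> k.+1 -> (forall K0, 0 <= coef M L K0) ->
  - 2%:R * coef M L K + coef M L f <= coef M (cupcaps k L) K.
Proof.
move=> kM ok sf sK Kf fk ge0; have k0M : (k < M)%N by apply: ltnW.
have Kk : K k = k.+1 by rewrite Kf cupcap_k.
have fkM : (f k < M)%N by have [-> //] := sf.
have -> : coef M (cupcaps k L) K = - 2%:R * coef M L K +
   \sum_(0 <= b < M | (b != k) && (b != k.+1)) coef M L (tjoin k b K).
  rewrite /coef exchange_big /= mulr_sumr -big_split /cupcaps big_map /=.
  apply: big_In => c /ok[_ sc]; rewrite -mulr_sumr.
  have := cupcapF_agree kM sK sc Kk; rewrite /cupcapF => e.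
  by rewrite -mulrA mulrCA e mulrDr mulrCA.
rewrite lerD2l big_mkcond /= (bigD1_seq (f k)) ?iota_uniq //=; last first.
  by rewrite mem_index_iota.
have nk := @mt_neq f k; have -> : (f k != k) && (f k != k.+1) by apply/andP; split; apply/eqP.
rewrite Kf tjoin_cupcap // lerDl; apply: sumr_ge0 => b _.
by case: ifP.
Qed.

(** [cupcaps k L] expands the matching [cupcap k D], so its coefficients are nonnegative and no
    positive one is destroyed. If a new term had coefficient 0 in [L], its loop contribution would
    vanish too, and its preimage listed in [L] makes it positive by [coef_cupcaps]. *)
Lemma expands_cross M k L D : expands M L D -> (k.+1 < M)%N -> uncrossed k D ->
  expands M (L ++ cupcaps k L) (cross k D).
Proof.
move=> [ok sD E pos] kM un; have [D1 _] := sD.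
have Dk : D k <> k.+1 by move: un; rewrite /uncrossed; lia.
have ok' := noncrossing_terms_cupcaps kM ok.
have E' b : \sum_(c <- cupcaps k L) c.1 * arc_product M c.2 b = arc_product M (cupcap k D) b.
  rewrite arc_product_cupcap // -!E /cupcaps big_map -sumrB; apply: big_In => c /ok[nc [c1 _]] /=.
  by have := @arc_product_nonc M k c.2 b kM c1 nc => e; rewrite -mulrBr -e mulrCA mulrA.
have sD' : standard M (cupcap k D) by apply: standard_join => //; apply: ltnW.
have ge0 := coef_ge0 ok sD E.
have ge0' := coef_ge0 ok' sD' E'.
have coefU K : coef M (L ++ cupcaps k L) K = coef M L K + coef M (cupcaps k L) K.
  by rewrite /coef big_cat.
split.
- by move=> c /List.in_app_iff[/ok|/ok'].
- exact: standard_cross.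
- move=> b; rewrite big_cat /= E E' arc_product_cross // arc_product_cupcap //; ring.
move=> c /List.in_app_iff[cL|cL]; rewrite coefU.
  by apply: ltr_pwDl; [exact: pos | exact: ge0'].
have [nc sc] := ok' c cL.
have [d dL ec] := In_mapE cL; have [nd sd] := ok d dL.
have [fk|/eqP fk] := eqVneq (d.2 k) k.+1.
  have e2 : c.2 = d.2 by rewrite ec /= cupcap_id.
  by rewrite e2; apply: ltr_pwDl; [exact: pos | rewrite -e2; exact: ge0'].
have := ge0 c.2; rewrite le_eqVlt => /orP[/eqP e0|lt]; last by apply: ltr_pwDl.
have := @coef_cupcaps M k L d.2 c.2 kM ok sd sc _ fk ge0; rewrite -e0 mulr0 !add0r.
by rewrite ec => /(_ erefl); apply: lt_le_trans; apply: pos.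
Qed.

Lemma coef_ins M k L K : (k <= M)%N -> coef M.+2 [seq (c.1, ins k c.2) | c <- L] (ins k K) = coef M L K.
Proof.
move=> kM; rewrite /coef big_map; apply: eq_bigr => c _ /=; congr (_ * _).
by rewrite -[in RHS](@insF_agree int k M K kM).
Qed.

Lemma expands_ins M k L D : expands M L D -> (k <= M)%N ->
  expands M.+2 [seq (c.1, ins k c.2) | c <- L] (ins k D).
Proof.
move=> [ok sD E pos] kM; split.
- move=> c cL; have [d dL ->] := In_mapE cL; have [nd sd] := ok d dL.
  by split; [apply/noncrossing_ins | apply: standard_ins].
- exact: standard_ins.
- move=> b; rewrite big_map arc_product_ins // -E mulr_sumr; apply: eq_bigr => c _ /=.
  by rewrite arc_product_ins // mulrCA.
by move=> c cL; have [d dL ->] := In_mapE cL; rewrite coef_ins //; apply: pos.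
Qed.
End Expand.

Section ExpandProg.
Local Open Scope ring_scope.

Lemma swap_gt k x : (k.+1 < x)%N -> swap k x = x.
Proof. by move=> h; apply: swap_id; apply/eqP; lia. Qed.

(** The moving end of the chord stays joined to [r], and the strands still to be crossed lead beyond
    [r]. At each crossing the two arcs are therefore nested, as [uncrossed] demands. *)
Lemma expands_row (I : finType) M P (xs : seq I) L D r : expands M L D -> (r < M)%N ->
  (P + size xs < r)%N -> D (P + size xs)%N = r -> (forall j, (j < size xs)%N -> (r < D (P + j))%N) ->
  exists D', [/\ expands M (expand (row P xs) L) D', D' P = r,
    forall j, (j < size xs)%N -> (r < D' (P.+1 + j))%N
    & forall y, (y < P)%N -> (r < D y)%N -> D' y = D y].
Proof.
elim: xs P L D => [|x xs IH] P L D H rM Pr Dr Dj /=.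
  by exists D; split => //; rewrite -Dr /= addn0.
have [||j hj|D1 [H1 D1h D1j D1f]] := IH P.+1 L D H rM; rewrite ?addSnnS //.
  by apply: Dj.
have DP : D1 P = D P by apply: D1f; rewrite // -(addn0 P) Dj.
have rDP : (r < D1 P)%N by rewrite DP -(addn0 P) Dj.
have Pr' : (P.+1 < r)%N by move: Pr => /=; lia.
exists (cross P D1); split.
- rewrite -cats1 expand_cat /=; apply: expands_cross => //; first by lia.
  by rewrite /uncrossed D1h; lia.
- by rewrite /= swap_k D1h swap_gt.
- move=> j hj; rewrite /=; case: j hj => [|j] hj.
    by rewrite addn0 swap_Sk swap_gt //; lia.
  have gt := D1j j hj; rewrite (swap_gt (x := (P.+1 + j.+1)%N)); last lia.
  by rewrite -addSnnS swap_gt //; lia.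
move=> y yP ry; rewrite /= (@swap_id P y); try lia.
by rewrite D1f // ?swap_gt //; lia.
Qed.

Lemma expands_prog m n l (rs : seq 'I_m) M L D : expands M L D -> (l + n <= M)%N ->
  (forall j, (j < n)%N -> (l + n <= D (l + j))%N) ->
  exists D', expands (M + (size rs).*2) (expand (prog n l rs) L) D'.
Proof.
elim: rs l M L D => [|r rs IH] l M L D H lM Dj /=; first by exists D; rewrite addn0.
have H1 := expands_ins H lM.
rewrite expand_cat; set xs := [seq _ | j <- _].
have sx : size xs = n by rewrite size_map size_enum_ord.
have [||||D' [H' D'l D'j _]] := @expands_row _ _ l xs _ _ (l + n).+1 H1; rewrite ?sx ?ins_k //; try lia.
  move=> j hj; have e : (l + j = up (l + n) (l + j))%N by rewrite /up; lia.
  by rewrite e ins_up; have := Dj j hj; rewrite /up; lia.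
have [||D2 H2] := IH l.+1 _ _ _ H'; try lia.
  by move=> j hj; have := D'j j; rewrite sx => /(_ hj); lia.
by exists D2; have -> : (M + (size rs).+1.*2 = M.+2 + (size rs).*2)%N by lia.
Qed.

Lemma expands_rain n : expands n.*2 [:: (1, rain n)] (rain n).
Proof.
split.
- by move=> c [<-|[]]; split; [exact: noncrossing_rain | exact: standard_rain].
- exact: standard_rain.
- by move=> b; rewrite big_seq1 mul1r.
move=> c [<-|[]] //; rewrite /coef big_seq1 mul1r /agree.
by have -> : [forall x : 'I_n.*2, rain n x == rain n x] by apply/forallP.
Qed.

Lemma realizable_sum m n (C : Cat m n) : realizable C ->
  0 < \sum_(s : kstate m n | realizes s C) (loop_value 1 1 : int) ^+ closed_components s.
Proof.
case=> s sC; have [K RK] := cat_matching C.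
pose M := ((m + n) + (m + n))%N.
have -> : \sum_(s : kstate m n | realizes s C) (loop_value 1 1 : int) ^+ closed_components s
    = latticeF 1 1 n m (agree int M K) (rain n).
  rewrite (latticeF_states _ _ RK); apply: eq_bigr => s' _.
  by rewrite !expr1n !mul1r.
have [|j hj|D] := @expands_prog m n 0 (rev (enum 'I_m)) _ _ _ (expands_rain n); first by lia.
  by rewrite rainE; lia.
rewrite size_rev size_enum_ord.
have -> : (n.*2 + m.*2 = M)%N by rewrite /M; lia.
case=> _ _ _ pos.
have [|d dL ed] := @expand_proc _ s (prog n 0 (rev (enum 'I_m))) [:: (1, rain n)] (1, rain n) 0.
  by left.
have := pos d dL; rewrite /coef expand_eval big_seq1 mul1r eval_prog size_rev size_enum_ord.
suff -> : agree int M d.2 = agree int M K by [].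
apply: functional_extensionality => f; rewrite /agree; congr (nat_of_bool _)%:R.
move: sC; rewrite (realizesE s RK) => /agreeP e.
by apply: eq_forallb => x; rewrite ed /= -[proc _ _ _]/(outcome s) e.
Qed.

(** [realizable_sum] is the value of the coefficient at A = 1. To evaluate there, the coefficient is
    first turned into an honest polynomial. *)
Lemma realizable_coeff m n (C : Cat m n) : realizable C <-> coeff C != 0.
Proof.
split; last first.
  case: (classic (exists s, realizes s C)) => // nC; rewrite /coeff big1 ?eqxx // => s sC.
  by case: nC; exists s.
move/realizable_sum; apply: contraTneq => c0.
pose B := (\sum_(s : {ffun 'I_m * 'I_n -> bool}) closed_components (s : kstate m n))%N.
have lB (s : {ffun 'I_m * 'I_n -> bool}) : (closed_components (s : kstate m n) <= B)%N by rewrite /B (bigD1 s) //= leq_addr.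
pose N := #|{: 'I_m * 'I_n}|.
pose a (s : kstate m n) := #|[set x | s x]|.
pose b (s : kstate m n) := #|[set x | ~~ s x]|.
have bN s : (b s <= N)%N by exact: max_card.
(* The term of [s] times A^(N + 2B), which clears the negative powers coming from markers and
   loops. *)
pose q (s : kstate m n) : {poly int} :=
  'X^(a s + (N - b s) + (B - closed_components s).*2) * (- 'X^4 - 1) ^+ closed_components s.
have qE s : tofrac (q s) = A ^+ (N + B.*2) *
   (A ^ ((a s)%:Z - (b s)%:Z) * (- A ^+ 2 - A ^- 2) ^+ closed_components s).
  have e : - A ^+ 2 - A ^- 2 = A ^- 2 * (- A ^+ 4 - 1).
    rewrite mulrBr mulr1 mulrN -[4%N]/(2 + 2)%N exprD mulrA mulVf ?mul1r //.
    by rewrite expf_neq0 // A_neq0.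
  rewrite e exprMn mulrA mulrA.
  have -> : A ^+ (N + B.*2) * A ^ ((a s)%:Z - (b s)%:Z) * A ^- 2 ^+ closed_components s =
     A ^+ (a s + (N - b s) + (B - closed_components s).*2).
    rewrite -exprVn -exprM exprVn !exprnP exprnN -!expfzDr ?A_neq0 //; congr (_ ^ _).
    by have := lB s; have := bN s; lia.
  by rewrite /q rmorphM rmorphXn /= rmorphXn /= rmorphB rmorphN rmorphXn /= rmorph1.
have : tofrac (\sum_(s : kstate m n | realizes s C) q s) = 0.
  rewrite rmorph_sum /= (eq_bigr _ (fun s _ => qE s)) -mulr_sumr.
  by rewrite -[X in _ * X]/(coeff C) c0 mulr0.
move/eqP; rewrite tofrac_eq0 => /eqP /(congr1 (fun r => r.[1])).
rewrite horner0 horner_sum => e.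
rewrite (eq_bigr (fun s => (q s).[1])) ?e ?ltxx // => s _.
by rewrite /q !hornerE /loop_value !expr1n mul1r.
Qed.
End ExpandProg.

(** * Rotation and removal of an arc *)

Section Rotation.
Variables (m n : nat).
Implicit Types (C : Cat m n) (s : kstate m n).

Definition rot C : Cat m n := MkCat (rotate_catalan (valP C)).

Lemma rotE C p : rot C p = rotate (C (rotate p)).
Proof. by rewrite ffunE. Qed.

Definition rotx (x : 'I_m * 'I_n) := (rev_ord x.1, rev_ord x.2).
Lemma rotxK : involutive rotx. Proof. by case=> i j; rewrite /rotx /= !rev_ordK. Qed.

Definition rotv (v : segment m n) : segment m n :=
  match v with
  | inl u => inl (rev_ord u.1, rev_ord u.2)
  | inr u => inr (rev_ord u.1, rev_ord u.2)
  end.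
Lemma rotvK : involutive rotv.
Proof. by case=> -[i j]; rewrite /rotv /= !rev_ordK. Qed.

Definition rots s : kstate m n := [ffun x => s (rotx x)].
Lemma rotsK : involutive rots.
Proof. by move=> s; apply/ffunP => x; rewrite !ffunE rotxK. Qed.

Lemma top_rot x : top_of (rotx x) = rotv (bot_of x).
Proof.
by congr (inr (_, _)); apply/ord_inj; rewrite /= /fintype.bump /=; have := ltn_ord x.1; lia.
Qed.

Lemma left_rot x : left_of (rotx x) = rotv (right_of x).
Proof.
by congr (inl (_, _)); apply/ord_inj; rewrite /= /fintype.bump /=; have := ltn_ord x.2; lia.
Qed.

Lemma bot_rot x : bot_of (rotx x) = rotv (top_of x).
Proof. by rewrite -[RHS]rotvK -[x in RHS]rotxK top_rot !rotvK. Qed.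
Lemma right_rot x : right_of (rotx x) = rotv (left_of x).
Proof. by rewrite -[RHS]rotvK -[x in RHS]rotxK left_rot !rotvK. Qed.

(** Rotation by pi exchanges the two strands of each smoothing, so markers are preserved. *)
Lemma joined_rot s u v : joined (rots s) (rotv u) (rotv v) = joined s u v.
Proof.
have half x : ((u, v) \in smoothing s x) || ((v, u) \in smoothing s x) =
   ((rotv u, rotv v) \in smoothing (rots s) (rotx x)) ||
   ((rotv v, rotv u) \in smoothing (rots s) (rotx x)).
  rewrite /smoothing /rots ffunE rotxK top_rot left_rot bot_rot right_rot.
  case: (s x); rewrite !inE !xpair_eqE !(inj_eq (inv_inj rotvK));
  by do !case: (@eq_op _ _ _).
apply/existsP/existsP => -[x h]; exists (rotx x).
  by rewrite half rotxK.
by rewrite -half.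
Qed.

Lemma connect_rot s u v : connect (joined (rots s)) (rotv u) (rotv v) = connect (joined s) u v.
Proof.
have sub t u0 v0 : connect (joined t) u0 v0 -> connect (joined (rots t)) (rotv u0) (rotv v0).
  move=> c; apply: (connect_min (r := fun a b => connect (joined (rots t)) (rotv a) (rotv b)) _ _ c).
    by move=> w; apply: connect0.
  by move=> a b d ab bd; apply: connect_trans ab (connect1 _); rewrite joined_rot.
apply/idP/idP => [/sub|/sub //]; by rewrite rotsK !rotvK.
Qed.

Lemma end_segment_rot (p : bpt m n) : end_segment (rotate p) = rotv (end_segment p).
Proof.
case: p => i /=.
- by congr (inr (_, _)); apply/ord_inj; rewrite /=; lia.
- by congr (inr (_, _)); apply/ord_inj; rewrite /=; lia.
- by congr (inl (_, _)); apply/ord_inj; rewrite /=; lia.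
by congr (inl (_, _)); apply/ord_inj; rewrite /=; lia.
Qed.

Lemma realizes_rot s C : realizes (rots s) (rot C) = realizes s C.
Proof.
have arcE p q : state_arc (rots s) (rotate p) (rotate q) = state_arc s p q.
  by rewrite /state_arc !end_segment_rot connect_rot (inj_eq (inv_inj (@rotateK m n))).
apply/forallP/forallP => h p; apply/forallP => q.
  have /forallP/(_ (rotate q)) := h (rotate p).
  by rewrite arcE rotE rotateK (inj_eq (inv_inj (@rotateK m n))).
have /forallP/(_ (rotate q)) := h (rotate p).
by rewrite -arcE !rotateK rotE (can2_eq (@rotateK m n) (@rotateK m n)).
Qed.

Lemma closed_rot s : closed_components (rots s) = closed_components s.
Proof.
rewrite /closed_components (@adjunction_n_comp _ _ rotv _ (joined s)).
- apply: eq_n_comp_r => u; rewrite !inE; congr (~~ _).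
  apply/existsP/existsP => -[p c]; exists (rotate p).
    by rewrite -connect_rot -end_segment_rot rotateK.
  by rewrite end_segment_rot connect_rot.
- exact: joined_connect_sym.
- exact: joined_connect_sym.
- apply: intro_closed; first exact: joined_connect_sym.
  move=> u v euv; rewrite !inE; apply: contra => /existsP[p c].
  by apply/existsP; exists p; apply: connect_trans (connect1 euv) c.
apply: strict_adjunction.
- exact: joined_connect_sym.
- apply: intro_closed; first exact: joined_connect_sym.
  move=> u v euv; rewrite !inE; apply: contra => /existsP[p c].
  by apply/existsP; exists p; apply: connect_trans (connect1 euv) c.
- exact: inv_inj rotvK.
- by apply/subsetP => u _; apply/codomP; exists (rotv u); rewrite rotvK.
by move=> u v _; rewrite joined_rot.
Qed.

Lemma coeff_rot C : coeff (rot C) = coeff C.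
Proof.
rewrite /coeff (reindex_inj (inv_inj rotsK)) /=; apply: eq_big => [s|s _].
  by rewrite realizes_rot.
rewrite closed_rot; congr (_ ^ (_%:Z - _%:Z) * _)%R.
  rewrite -[in RHS](card_preimset [set x | s x] (inv_inj rotxK)).
  by apply: eq_card => x; rewrite !inE ffunE.
rewrite -[in RHS](card_preimset [set x | ~~ s x] (inv_inj rotxK)).
by apply: eq_card => x; rewrite !inE ffunE.
Qed.
End Rotation.

(** * Labels and regions in terms of positions *)

Section Positions.
Variables (m n : nat).
Implicit Types (p q r u : bpt m n).

Lemma pos_bot p : on_bot p = (m + n + m <= pos p).
Proof. by rewrite posE; case: p => i /=; have := ltn_ord i; lia. Qed.

Lemma mem_over_top p : (p \in over_top m n) = ~~ on_bot p.
Proof.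
have := mem_clockwise p; rewrite mem_cat mem_rev; case: p => i /=.
- by have -> : (Top i \in bots m n) = false; [apply/mapP => -[] | rewrite orbF].
- move=> _; rewrite !mem_cat mem_rev; apply/negbTE; rewrite !negb_or.
  by apply/and3P; split; apply/mapP => -[].
- by have -> : (Lft i \in bots m n) = false; [apply/mapP => -[] | rewrite orbF].
by have -> : (Rgt i \in bots m n) = false; [apply/mapP => -[] | rewrite orbF].
Qed.

Lemma index_over_top p :
  index p (over_top m n) = if on_bot p then m + n + m else pos p.
Proof.
case: ifP => pb.
  have pn : p \notin over_top m n by rewrite mem_over_top pb.
  by rewrite memNindex // size_over_top.
by rewrite /pos [in RHS]/clockwise [in RHS]index_cat mem_over_top pb.
Qed.

Lemma index_rev (T : eqType) (x : T) s : uniq s -> x \in s ->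
  index x (rev s) = size s - (index x s).+1.
Proof.
move=> us xs; have lt : index x s < size s by rewrite index_mem.
have e : x = nth x (rev s) (size s - (index x s).+1).
  rewrite nth_rev; last by lia.
  by have -> : size s - (size s - (index x s).+1).+1 = index x s; [lia | rewrite nth_index].
by rewrite {1}e index_uniq ?rev_uniq ?size_rev //; lia.
Qed.

Lemma index_under_bot p :
  index p (under_bot m n) = if on_top p then m + n + m else (m + n + m).-1 - pos (rotate p).
Proof.
have uR : uniq (rights m n) by rewrite map_inj_uniq ?enum_uniq // => ? ? [].
have szL : size (lefts m n) = m by rewrite size_map size_enum_ord.
have szR : size (rights m n) = m by rewrite size_map size_enum_ord.
have szB : size (bots m n) = n by rewrite size_map size_enum_ord.
rewrite posE /under_bot !index_cat szL szB.
case: p => i /=.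
- have -> : Top i \in lefts m n = false by apply/mapP => -[].
  have -> : Top i \in bots m n = false by apply/mapP => -[].
  rewrite memNindex ?size_rev ?szR ?addnA // mem_rev; by apply/mapP => -[].
- have -> : Bot i \in lefts m n = false by apply/mapP => -[].
  rewrite map_f ?mem_enum // index_map => [|? ? [] //]; rewrite index_enum_ord.
  by have := ltn_ord i; lia.
- rewrite map_f ?mem_enum // index_map => [|? ? [] //]; rewrite index_enum_ord.
  by have := ltn_ord i; lia.
have -> : Rgt i \in lefts m n = false by apply/mapP => -[].
have -> : Rgt i \in bots m n = false by apply/mapP => -[].
rewrite index_rev ?map_f ?mem_enum // szR index_map => [|? ? [] //]; rewrite index_enum_ord.
by have := ltn_ord i; lia.
Qed.

Lemma y_labelE j p : pos p < m + n -> y_label j p = (j == m%:Z - (pos p)%:Z)%R.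
Proof. by rewrite posE; case: p => i /=; have := ltn_ord i; lia. Qed.

Lemma y'_labelE j p : m <= pos p < m + n + m ->
  y'_label j p = (j == (pos p)%:Z - m%:Z - n%:Z + 1)%R.
Proof. by rewrite posE; case: p => i /=; have := ltn_ord i; lia. Qed.

Lemma y_label_side j p : y_label j p -> ~~ on_bot p -> pos p < m + n.
Proof. by rewrite posE; case: p => i //=; have := ltn_ord i; lia. Qed.

Lemma y'_label_side j p : y'_label j p -> ~~ on_bot p -> m <= pos p < m + n + m.
Proof. by rewrite posE; case: p => i //=; have := ltn_ord i; lia. Qed.

Lemma y_rotate j p : y_label j p = y'_label (m%:Z + 1 - j)%R (rotate p).
Proof. by case: p => i //=; have := ltn_ord i; lia. Qed.

Lemma y'_rotate j p : y'_label j p = y_label (m%:Z + 1 - j)%R (rotate p).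
Proof. by case: p => i //=; have := ltn_ord i; lia. Qed.

Lemma on_bot_rotate p : on_bot (rotate p) = on_top p.
Proof. by case: p. Qed.

Lemma between_over p q r : ~~ on_bot p -> ~~ on_bot q -> pos p < pos q ->
  (r \in between (over_top m n) [set p; q]) = (pos p < pos r < pos q).
Proof.
move=> pb qb pq; have pB := pos_bot p; have qB := pos_bot q; have rB := pos_bot r.
have xq u : u \in [set p; q] -> u = p \/ u = q by rewrite !inE => /orP[]/eqP; [left|right].
rewrite inE; apply/exists_inP/idP => [[u /xq eu /exists_inP[v /xq ev]]|h].
  rewrite !index_over_top; case: eu => ->; case: ev => ->;
  by rewrite ?(negbTE pb) ?(negbTE qb); case: ifP; lia.
exists p; first by rewrite !inE eqxx.
apply/exists_inP; exists q; first by rewrite !inE eqxx orbT.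
rewrite !index_over_top (negbTE pb) (negbTE qb).
have -> : on_bot r = false by lia.
by [].
Qed.

Lemma between_under p q r : ~~ on_top p -> ~~ on_top q -> pos (rotate q) < pos (rotate p) ->
  (r \in between (under_bot m n) [set p; q]) = (pos (rotate q) < pos (rotate r) < pos (rotate p)).
Proof.
move=> pb qb pq; have pB := pos_bot (rotate p); have qB := pos_bot (rotate q).
have rB := pos_bot (rotate r); rewrite !on_bot_rotate in pB qB rB.
have xq u : u \in [set p; q] -> u = p \/ u = q by rewrite !inE => /orP[]/eqP; [left|right].
rewrite inE; apply/exists_inP/idP => [[u /xq eu /exists_inP[v /xq ev]]|h].
  rewrite !index_under_bot; case: eu => ->; case: ev => ->;
  by rewrite ?(negbTE pb) ?(negbTE qb); case: ifP; lia.
exists p; first by rewrite !inE eqxx.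
apply/exists_inP; exists q; first by rewrite !inE eqxx orbT.
rewrite !index_under_bot (negbTE pb) (negbTE qb).
have -> : on_top r = false by lia.
by lia.
Qed.
End Positions.

(** * The relabelling after the removal of an arc *)

Section Removal.
Variables (m n : nat) (C : Cat m.+1 n) (p q : bpt m.+1 n).
Hypotheses (Cp : C p = q) (pb : ~~ on_bot p) (qb : ~~ on_bot q) (pq : pos p < pos q).
Let c := [set p; q].

Let Qlt : pos q < m.+1 + n + m.+1.
Proof. by have := pos_bot q; lia. Qed.

(** Two strictly increasing lists with the same elements are equal. *)
Lemma pos_kept : [seq pos u | u <- kept c] = [seq skip2 (pos p) (pos q) x | x <- iota 0 (m + n + m)].
Proof.
have posO : [seq pos u | u <- over_top m.+1 n] = iota 0 (m.+1 + n + m.+1).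
  apply: (@eq_from_nth _ 0); first by rewrite size_map size_over_top size_iota.
  move=> i; rewrite size_map size_over_top => hi.
  have [u eu] : exists u : bpt m.+1 n, pos u = i by apply: posP; lia.
  have uO : u \in over_top m.+1 n by rewrite mem_over_top; have := pos_bot u; lia.
  have iu : index u (over_top m.+1 n) = i.
    by rewrite index_over_top; have := pos_bot u; case: ifP; lia.
  by rewrite (nth_map u) ?size_over_top // -{1}iu nth_index // eu nth_iota.
have lt_trans : transitive ltn by move=> a b d; apply: ltn_trans.
apply: (irr_sorted_eq lt_trans ltnn).
- have -> : [seq pos u | u <- kept c] = [seq x <- iota 0 (m.+1 + n + m.+1) | x \notin [:: pos p; pos q]].
    rewrite -posO filter_map; congr map; apply: eq_filter => u /=.
    by rewrite !inE !(inj_eq (@pos_inj _ _)).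
  by apply: sorted_filter => //; apply: iota_ltn_sorted.
- rewrite sorted_map; apply: (sub_sorted (e := ltn)); last exact: iota_ltn_sorted.
  by move=> a b /=; rewrite /skip2; lia.
move=> x; have -> : (x \in [seq pos u | u <- kept c]) =
    (x < m.+1 + n + m.+1) && (x \notin [:: pos p; pos q]).
  have -> : [seq pos u | u <- kept c] = [seq x <- iota 0 (m.+1 + n + m.+1) | x \notin [:: pos p; pos q]].
    rewrite -posO filter_map; congr map; apply: eq_filter => u /=.
    by rewrite !inE !(inj_eq (@pos_inj _ _)).
  by rewrite mem_filter mem_iota /= add0n andbC.
rewrite !inE; apply/idP/mapP => [h|[y]].
  exists (x - (pos p < x) - (pos q < x)); first by rewrite mem_iota; lia.
  by rewrite /skip2; lia.
by rewrite mem_iota => hy ->; rewrite /skip2; lia.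
Qed.

Lemma size_kept : size (kept c) = m + n + m.
Proof. by have := congr1 size pos_kept; rewrite !size_map size_iota. Qed.

Lemma pos_old (r : bpt m n) : pos (old_point c r) = skip2 (pos p) (pos q) (pos r).
Proof.
have nb u : ~~ on_bot u -> pos (nth (Lft ord0) (kept c) (index u (over_top m n)))
    = skip2 (pos p) (pos q) (pos u).
  move=> ub; have uB := pos_bot u; rewrite index_over_top (negbTE ub).
  have lt : pos u < m + n + m by lia.
  by rewrite -(nth_map _ 0) ?size_kept // pos_kept (nth_map 0) ?size_iota // nth_iota.
case: r => i; rewrite /old_point ?nb //.
have e1 := posE (Bot i : bpt m n); have e2 := posE (Bot i : bpt m.+1 n).
by rewrite e1 e2 /skip2; have := Qlt; have := ltn_ord i; lia.
Qed.

Lemma old_mate (r : bpt m n) : C (old_point c r) = old_point c (remove_over_ffun C c r).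
Proof.
have [CK CN _] := cat_catalan C.
rewrite [in RHS]ffunE; set d := r; set z := C (old_point c r).
have zc : z \notin c.
  have Cq : C q = p by rewrite -Cp CK.
  have : old_point c r \notin c.
    rewrite !inE -!(inj_eq (@pos_inj _ _)) pos_old /skip2; lia.
  by rewrite !inE /z !(can2_eq CK CK) Cq Cp orbC.
apply: pos_inj; case: (boolP (on_bot z)) => zb.
  by case: (z) zb => [i|i|i|i].
have zk : z \in kept c by rewrite mem_filter zc mem_over_top.
set k := index z (kept c); have lt : k < m + n + m by rewrite -size_kept index_mem.
have newE w : ~~ on_bot w -> new_point c d w = nth d (over_top m n) (index w (kept c)).
  by case: w.
rewrite newE // -/k.
set u := nth d (over_top m n) k.
have uO : u \in over_top m n by rewrite mem_nth // size_over_top.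
have pu : pos u = k.
  have uo : uniq (over_top m n) by have := uniq_clockwise m n; rewrite cat_uniq => /andP[].
  have := index_over_top u; rewrite mem_over_top in uO; rewrite (negbTE uO) => <-.
  by rewrite index_uniq // size_over_top.
rewrite pos_old pu -{1}(nth_index z zk) -(nth_map _ 0) ?size_kept //.
by rewrite pos_kept (nth_map 0) ?size_iota // nth_iota.
Qed.
End Removal.

(** * Arcs without a bottom end, and the general case by rotation *)

Local Open Scope ring_scope.

Lemma coeff_over (m n : nat) (C : Cat m.+1 n) (C' : Cat m n) (p q : bpt m.+1 n)
    (a b : int) (j0 : nat) :
  C p = q -> ~~ on_bot p -> ~~ on_bot q -> (pos p < pos q)%N ->
  y_label a p -> y'_label b q ->
  mate C' = remove_over_ffun C [set p; q] -> (j0 < m.+1)%N ->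
  (forall (u : bpt m.+1 n) (j : int), u \notin [set p; q] ->
     (y_label j u && y_label (j + 1) (C u)) || (y'_label j u && y'_label (j + 1) (C u)) ->
     forall v, v \in [set u; C u] -> (pos p < pos v < pos q)%N = (j <= j0%:Z)) ->
  coeff C = A ^ (b - a) * coeff C'.
Proof.
move=> Cp pb qb pq ya yb C'E jm H.
have [CK CN _] := cat_catalan C.
have Cq : C q = p by rewrite -Cp CK.
have ps := y_label_side ya pb; have qs := y'_label_side yb qb.
have qB := pos_bot q.
rewrite y_labelE // in ya; rewrite y'_labelE // in yb.
rewrite (@coeff_core m n C C' p q j0 (old_point [set p; q])) //; try lia.
- by congr (A ^ _ * _); lia.
- move=> u up Cu uy; set k := pos u in Cu uy *.
  have uq : u != q by apply: contra up => /eqP uq; move: Cu; rewrite /k uq Cq; lia.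
  have vp : C u != p by apply: contra uq => /eqP e; rewrite -(CK u) e Cp.
  have vq : C u != q by apply: contra up => /eqP e; rewrite -(CK u) e Cq.
  (* The labels y decrease along the numbering, so here the lower label is carried by [C u]. *)
  have := H (C u) (m%:Z - k%:Z); rewrite CK !inE (negbTE vp) (negbTE vq) !y_labelE ?Cu; try lia.
  have -> : (m%:Z - k%:Z == m.+1%:Z - k.+1%:Z) by lia.
  have -> : (m%:Z - k%:Z + 1 == m.+1%:Z - k%:Z) by lia.
  move=> /(_ isT isT) h; have := h u; have := h (C u); rewrite !inE !eqxx !orbT Cu -/k.
  move: up uq vp vq; rewrite -!(inj_eq (@pos_inj _ _)) Cu -/k.
  by case: ifP; lia.
move=> u up Cu uy uy'; set k := pos u in Cu uy uy' *.
have uq : u != q by apply: contra up => /eqP uq; move: Cu; rewrite /k uq Cq; lia.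
have vp : C u != p by apply: contra uq => /eqP e; rewrite -(CK u) e Cp.
have vq : C u != q by apply: contra up => /eqP e; rewrite -(CK u) e Cq.
have := H u (k%:Z - m%:Z - n%:Z); rewrite !inE (negbTE up) (negbTE uq) !y'_labelE ?Cu -/k; try lia.
have -> : (k%:Z - m%:Z - n%:Z == k%:Z - m.+1%:Z - n%:Z + 1) by lia.
have -> : (k%:Z - m%:Z - n%:Z + 1 == k.+1%:Z - m.+1%:Z - n%:Z + 1) by lia.
rewrite orbT => /(_ isT isT) h; have := h u; have := h (C u); rewrite !inE !eqxx !orbT Cu -/k.
move: up uq vp vq; rewrite -!(inj_eq (@pos_inj _ _)) Cu -/k.
by case: ifP; lia.
by move=> r; rewrite pos_old.
by move=> r; rewrite C'E old_mate.
Qed.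

Lemma left_end_mem m n (c : {set bpt m n}) p : left_end c p -> p \in c.
Proof. by case/and3P. Qed.

Lemma proper_over m n (C : Cat m n) (c : {set bpt m n}) : proper_arc C c ->
  no_bot_end c = false -> no_top_end c.
Proof.
case/and4P => _ tb _ _ /negbT; rewrite negb_forall_in => /exists_inP[r rc rb].
apply/forall_inP => q qc; apply: contra tb => qt; apply/andP; split.
  by apply/exists_inP; exists q.
by apply/exists_inP; exists r => //; apply/negPn.
Qed.

Lemma A_expz_mul_neq0 (z : int) (x y : {fraction {poly int}}) :
  x = A ^ z * y -> (x != 0) = (y != 0).
Proof.
move=> e; have e' : y = A ^ (- z) * x.
  by rewrite e mulrA -expfzDr ?A_neq0 // addNr expr0z mul1r.
apply/idP/idP; apply: contraNneq => h; first by rewrite e h mulr0.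
by rewrite e' h mulr0.
Qed.

Theorem theorem4p3 (m n : nat) (C : Cat m.+1 n) (c : {set bpt m.+1 n})
    (hc : removable C c) (p q : bpt m.+1 n) (a b : int)
    (hp : left_end c p) (hq : right_end c q)
    (ha : 1 - n%:Z <= a <= (m.+1)%:Z + n%:Z) (hpa : y_label a p)
    (hb : 1 - n%:Z <= b <= (m.+1)%:Z + n%:Z) (hqb : y'_label b q) :
  let C' := remove (proj1 hc) in
  coeff C = A ^ (b - a) * coeff C' /\ (realizable C <-> realizable C').
Proof.
move=> C'; suff e : coeff C = A ^ (b - a) * coeff C'.
  split=> //; have eq0 := A_expz_mul_neq0 e.
  split=> /realizable_coeff h; apply/realizable_coeff.
    rewrite -eq0; exact h.
  rewrite eq0; exact h.
have [CK CN _] := cat_catalan C.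
have mC : mate C' = remove_ffun C c by [].
move: C' mC => C' mC; case: hc => pc [j0 j0m H].
have pin := left_end_mem hp; have /andP[qin qnl] := hq.
have pq : p != q by apply: contraNneq qnl => <-.
have [Cp cE] : C p = q /\ c = [set p; q].
  case/and4P: (pc) => /imsetP[r _ cr] _ _ _; move: pin qin pq; rewrite cr !inE.
  by case/orP => /eqP->; case/orP => /eqP->; rewrite ?eqxx // CK setUC.
have Cq : C q = p by rewrite -Cp CK.
have H' u j : u \notin c ->
    (y_label j u && y_label (j + 1)%R (C u)) || (y'_label j u && y'_label (j + 1)%R (C u)) ->
    forall v, v \in [set u; C u] -> v \in (if (j <= j0%:Z)%R then side1 c else side2 c).
  by move=> uc l; apply/subsetP; apply: H.
case nb : (no_bot_end c).
  have nbP := forall_inP nb; have pb := nbP p pin; have qb := nbP q qin.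
  have pqlt : (pos p < pos q)%N.
    have /and3P[_ /implyP/(_ nb)/forall_inP/(_ q qin)] := hp.
    rewrite !index_over_top (negbTE pb) (negbTE qb) leq_eqVlt (inj_eq (@pos_inj _ _)).
    by rewrite (negbTE pq).
  apply: (coeff_over Cp pb qb pqlt hpa hqb (j0 := j0)) => //.
    by rewrite mC /remove_ffun nb cE.
  move=> u j; rewrite -cE => uc l v vu; have := H' u j uc l v vu.
  rewrite /side1 /side2 nb cE; case: (j <= j0%:Z); first by rewrite between_over.
  rewrite inE in_setU negb_or between_over // => /andP[_ /negbTE]; exact.
have nt := proper_over pc nb; have ntP := forall_inP nt.
have pt := ntP p pin; have qt := ntP q qin.
have pqlt : (pos (rotate q) < pos (rotate p))%N.
  have /and3P[_ _ /implyP/(_ nt)/forall_inP/(_ q qin)] := hp.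
  have pB := pos_bot (rotate p); have qB := pos_bot (rotate q); rewrite !on_bot_rotate in pB qB.
  have : pos (rotate p) != pos (rotate q).
    by rewrite (inj_eq (@pos_inj _ _)) (inj_eq (inv_inj (@rotateK _ _))).
  move: pB qB; rewrite !index_under_bot (negbTE pt) (negbTE qt).
  by move: (pos (rotate p)) (pos (rotate q)); clear; lia.
(* Rotation sends label j to m + 2 - j and makes the image of [q] the left end, so the difference is
   unchanged. *)
have -> : b - a = (m.+1%:Z + 1 - a) - (m.+1%:Z + 1 - b) by clear; lia.
rewrite -(coeff_rot C) -(coeff_rot C').
have cs : [set rotate u | u in c] = [set rotate q; rotate p].
  by rewrite cE imsetU1 imset_set1 setUC.
(* The labels j, j + 1 turn into m + 2 - j, m + 1 - j and the regions A_1 and A_2 are exchanged, so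
   the threshold becomes [m - j0]. *)
apply: (coeff_over (p := rotate q) (q := rotate p) (j0 := m - j0)); rewrite ?on_bot_rotate //.
- by rewrite rotE rotateK Cq.
- by rewrite -y'_rotate.
- by rewrite -y_rotate.
- rewrite -cs; apply/ffunP => r; rewrite rotE mC /remove_ffun nb ffunE !rotateK.
  by congr (fun_of_fin (remove_over_ffun _ _) r); apply/ffunP => x; rewrite !ffunE.
- by move: j0m; clear; lia.
move=> u j uc; rewrite rotE => l v vu.
have wc : C (rotate u) \notin c.
  move: uc; rewrite cE !inE !(can2_eq CK CK) Cp Cq.
  by rewrite !(can2_eq (@rotateK _ _) (@rotateK _ _)) orbC.
have := H' (C (rotate u)) (m.+1%:Z - j) wc; rewrite CK.
have e1 : y'_label (m.+1%:Z - j) (C (rotate u)) = y_label (j + 1) (rotate (C (rotate u))).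
  by rewrite y'_rotate; congr y_label; clear; lia.
have e2 : y_label (m.+1%:Z - j) (C (rotate u)) = y'_label (j + 1) (rotate (C (rotate u))).
  by rewrite y_rotate; congr y'_label; clear; lia.
have e3 : y'_label (m.+1%:Z - j + 1) (rotate u) = y_label j u.
  by rewrite y'_rotate rotateK; congr y_label; clear; lia.
have e4 : y_label (m.+1%:Z - j + 1) (rotate u) = y'_label j u.
  by rewrite y_rotate rotateK; congr y'_label; clear; lia.
rewrite e1 e2 e3 e4 orbC ![_ && y'_label j u]andbC ![_ && y_label j u]andbC => /(_ l (rotate v)).
have -> : rotate v \in [set C (rotate u); rotate u].
  move: vu; rewrite !inE => /orP[]/eqP->; rewrite ?rotateK eqxx ?orbT //.
move=> /(_ isT); rewrite /side1 /side2 nb cE.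
have -> : (j <= (m - j0)%N%:Z) = ~~ (m.+1%:Z - j <= j0%:Z) by move: j0m; clear; lia.
have bu r := between_under r pt qt pqlt.
case: (m.+1%:Z - j <= j0%:Z); last by rewrite bu rotateK.
by rewrite inE in_setU negb_or bu rotateK => /andP[_ /negbTE].
Qed.
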